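(* Let $D_1,\dots,D_N\subset\mathbb{R}^3$ be a system of $N\in\mathbb{N}$ resonators and let $C=(C_{ij})_{i,j=1}^N\in\mathbb{R}^{N\times N}$ be its capacitance matrix. Let $$\mu:=2\max_{i=1,\dots,N}C_{ii}>0,$$ let $J_{N,1}\in\mathbb{R}^N$ denote the vector all of whose entries equal $1$, and define the upper landscape vector $\hat{\mathbf{u}}\in\mathbb{R}^N$ as the solution to $$(\mu I-C)^\ddag\,\hat{\mathbf{u}}=J_{N,1},$$ where $I$ is the $N\times N$ identity matrix and the superscript $\ddag$ denotes the comparison matrix. Then for any eigenpair $(\lambda,\mathbf{v})\in(0,\infty)\times\mathbb{R}^N$ of $C$, that is, $\mathbf{v}\neq0$ and $C\mathbf{v}=\lambda\mathbf{v}$, it holds that $$\frac{|\mathbf{v}_i|}{\|\mathbf{v}\|_\infty}\leq(\mu-\lambda)\,\hat{\mathbf{u}}_i\qquad\text{for each } i=1,\dots,N,$$ where $\|\mathbf{v}\|_\infty:=\max_{j=1,\dots,N}|\mathbf{v}_j|$.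
   Context: Resonators: $D_1,\dots,D_N$ are nonempty bounded open subsets of $\mathbb{R}^3$ with pairwise disjoint closures, and each boundary $\partial D_n$ is of class $C^{1,s}$ for some $0<s<1$ (locally the graph of a differentiable function whose derivatives are Hölder continuous with exponent $s$). Write $D=\bigcup_{n=1}^N D_n$, so that $\partial D=\bigcup_{n=1}^N\partial D_n$. Laplace single layer potential: for $\varphi\in L^2(\partial D)$, $$\mathcal{S}_D^0[\varphi](x)=-\int_{\partial D}\frac{1}{4\pi|x-y|}\,\varphi(y)\,\mathrm{d}\sigma(y),$$ where $\sigma$ is surface measure. Restricted to $x\in\partial D$, it is invertible as a map from $L^2(\partial D)$ to $H^1(\partial D)$ (standard fact). Capacitance matrix: for $j=1,\dots,N$ let $\psi_j:=(\mathcal{S}_D^0)^{-1}[\chi_{\partial D_j}]\in L^2(\partial D)$, where $\chi_{\partial D_j}$ is the characteristic function of $\partial D_j$ (as a function on $\partial D$). The capacitance coefficients are the real numbers $$C_{ij}:=-\int_{\partial D_i}\psi_j\,\mathrm{d}\sigma,\qquad i,j=1,\dots,N,$$ and $C=(C_{ij})_{i,j=1}^N$ is the capacitance matrix. Comparison matrix: for an $N\times N$ matrix $A$, the comparison matrix $A^\ddag$ is the $N\times N$ matrix with entries $(A^\ddag)_{ii}=|A_{ii}|$ and $(A^\ddag)_{ij}=-|A_{ij}|$ for $i\neq j$. *)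

(* Defs.v *)
From mathcomp Require Import all_boot all_order all_algebra.
From mathcomp Require Import all_classical all_reals all_analysis.

Set Implicit Arguments.
Unset Strict Implicit.
Unset Printing Implicit Defensive.

Import Order.TTheory GRing.Theory Num.Theory.
Import numFieldNormedType.Exports.

Local Open Scope classical_set_scope.
Local Open Scope ring_scope.

(* R^3 is the product type R * R * R: the library equips it with the product
   topology and the product (Borel) sigma-algebra. Its library norm is the
   sup norm, so the Euclidean structure is defined here. *)
Definition dot3 (R : realType) (x y : R * R * R) : R :=
  x.1.1 * y.1.1 + x.1.2 * y.1.2 + x.2 * y.2.

Definition enorm3 (R : realType) (x : R * R * R) : R := Num.sqrt (dot3 x x).

Definition boundary (T : topologicalType) (A : set T) : set T :=
  closure A `\` interior A.

(* Cartesian coordinate systems of R^3, of either orientation. *)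
Record frame (R : realType) := Frame {
  origin : R * R * R;
  axis1 : R * R * R;
  axis2 : R * R * R;
  axis3 : R * R * R;
  axis11 : dot3 axis1 axis1 = 1;
  axis22 : dot3 axis2 axis2 = 1;
  axis33 : dot3 axis3 axis3 = 1;
  axis12 : dot3 axis1 axis2 = 0;
  axis13 : dot3 axis1 axis3 = 0;
  axis23 : dot3 axis2 axis3 = 0 }.

Definition graph_pt (R : realType) (F : frame R) (g : R * R -> R) (w : R * R) :
    R * R * R :=
  origin F + w.1 *: axis1 F + w.2 *: axis2 F + g w *: axis3 F.

Definition partial1 (R : realType) (g : R * R -> R) (w : R * R) : R :=
  'D_((1, 0) : R * R) g w.

Definition partial2 (R : realType) (g : R * R -> R) (w : R * R) : R :=
  'D_((0, 1) : R * R) g w.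

Definition C1_on (R : realType) (V : set (R * R)) (g : R * R -> R) : Prop :=
  forall w, V w -> [/\ differentiable g w,
    {for w, continuous (partial1 g)} & {for w, continuous (partial2 g)}].

(* The sup norm of R * R in the Hoelder condition is equivalent to the
   Euclidean one, which only changes the constant K. *)
Definition holder_on (R : realType) (s : R) (V : set (R * R))
    (f : R * R -> R) : Prop :=
  exists K : R, forall w w', V w -> V w' ->
    `|f w - f w'| <= K * `|w - w'| `^ s.

Definition C1holder_on (R : realType) (s : R) (V : set (R * R))
    (g : R * R -> R) : Prop :=
  [/\ forall w, V w -> differentiable g w,
      holder_on s V (partial1 g) & holder_on s V (partial2 g)].

Definition graph_patch (R : realType) (E U : set (R * R * R)) (F : frame R)
    (V : set (R * R)) (g : R * R -> R) : Prop :=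
  [/\ open U, open V & E `&` U = graph_pt F g @` V].

Definition C1holder_surface (R : realType) (s : R) (E : set (R * R * R)) :
    Prop :=
  forall p, E p -> exists U F V g,
    [/\ U p, graph_patch E U F V g & C1holder_on s V g].

Definition resonators (R : realType) (s : R) (N : nat)
    (D : 'I_N -> set (R * R * R)) : Prop :=
  [/\ forall n, [/\ D n !=set0, bounded_set (D n) & open (D n)],
      forall m n, m != n -> closure (D m) `&` closure (D n) = set0 &
      forall n, C1holder_surface s (boundary (D n))].

(* dsigma = sqrt (1 + |grad g|^2) dw on every patch of E that is the graph of
   a C^1 function g. When E is locally such a graph, countably many patches
   cover E, so that this determines sigma on the Borel subsets of E; nothing
   is required of sigma outside E. *)
Definition is_surface_measure (R : realType) (E : set (R * R * R))
    (sigma : {measure set (R * R * R) -> \bar R}) : Prop :=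
  forall U F V g, graph_patch E U F V g -> C1_on V g ->
  forall A, measurable A ->
    sigma (A `&` (E `&` U)) =
    (\int[(@lebesgue_measure R \x @lebesgue_measure R)%E]_(w in
        V `&` graph_pt F g @^-1` A)
      (Num.sqrt (1 + partial1 g w ^+ 2 + partial2 g w ^+ 2))%:E)%E.

Definition square_integrable (R : realType)
    (sigma : {measure set (R * R * R) -> \bar R}) (E : set (R * R * R))
    (phi : R * R * R -> R) : Prop :=
  measurable_fun E phi /\ (\int[sigma]_(y in E) (phi y ^+ 2)%:E < +oo)%E.

Definition single_layer (R : realType)
    (sigma : {measure set (R * R * R) -> \bar R}) (E : set (R * R * R))
    (phi : R * R * R -> R) (x : R * R * R) : R :=
  - \int[sigma]_(y in E) ((4 * pi * enorm3 (x - y))^-1 * phi y).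

(* phi represents the preimage of f under the single layer operator of E;
   functions on E are identified when they agree almost everywhere. *)
Definition is_single_layer_preimage (R : realType)
    (sigma : {measure set (R * R * R) -> \bar R}) (E : set (R * R * R))
    (f phi : R * R * R -> R) : Prop :=
  square_integrable sigma E phi /\
  {ae sigma, forall x, E x -> single_layer sigma E phi x = f x}.

Definition capacitance_mx (R : realType) (N : nat)
    (sigma : {measure set (R * R * R) -> \bar R})
    (D : 'I_N -> set (R * R * R)) (psi : 'I_N -> R * R * R -> R) : 'M[R]_N :=
  \matrix_(i, j) - \int[sigma]_(y in boundary (D i)) psi j y.

Definition comparison_mx (R : realType) (N : nat) (A : 'M[R]_N) : 'M[R]_N :=
  \matrix_(i, j) (if i == j then `|A i i| else - `|A i j|).

Definition supnorm (R : realType) (N : nat) (v : 'cV[R]_N) : R :=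
  \big[Num.max/0]_(j < N) `|v j 0|.

(* Main.v *)
(* Put C for the capacitance matrix. If C is positive definite with nonpositive
   off-diagonal entries, then M = (mu I - C)^ddag is C plus a nonnegative
   diagonal matrix, hence has a nonnegative inverse, and the eigenvalues of C
   are at most mu. As M |v| <= (mu - lambda) |v| <= (mu - lambda) |v|_oo J
   entrywise, the bound |v| <= (mu - lambda) |v|_oo u follows.

   Both properties of C come from one inequality about the Newton potential
   U phi(x) = int phi(y) / |x - y| dsigma(y) of phi in L^2(sigma):
     int phi min(U phi, 0) dsigma >= 0.
   Applied to phi and -phi it gives int phi U phi >= 0, and strict positivity
   follows from Cauchy-Schwarz against the indicators of the boundaries; applied
   to e psi_i - psi_j with e -> 0 it gives C_ij <= 0.

   The inequality avoids gradients and traces by using the heat kernel p_T on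
   R^3. For theta bounded, nondecreasing and 1-Lipschitz, symmetrization in
   (x, z) shows that
     int int p_T(x, z) (U phi(x) - U phi(z)) theta(U phi(x)) dx dz >= 0,
   and by Fubini the left side is int phi(y) int r_T(x, y) theta(U phi(x)) dx
   dsigma(y) with r_T(., y) = (1 - p_T * ) |. - y|^-1 proportional to
   int_0^T p_t(., y) dt. As T -> 0, r_T / T is a multiple of an approximate
   identity; since |x - y|^-1 is superharmonic, the averages of theta(U phi)
   converge with a bound that dominated convergence can use. Then theta tends
   to min(., 0).

   The only facts needed about sigma are that the boundaries have positive mass
   and that balls of radius r have mass at most C r^2, which makes the integrals
   of |x - y|^-1 bounded uniformly in x. *)

From HB Require Import structures.
Require Import Defs.
From mathcomp Require Import -(notations) finmap.
From mathcomp Require Import all_boot all_order all_algebra.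
From mathcomp Require Import all_classical all_reals all_analysis.
From mathcomp Require Import measurable_realfun.
From mathcomp Require Import ring lra.
Import Order.TTheory GRing.Theory Num.Theory.
Import numFieldNormedType.Exports.
Local Open Scope classical_set_scope.
Local Open Scope ring_scope.

Set Implicit Arguments.
Unset Strict Implicit.

(** * Stieltjes matrices *)

(** The link with C is a change of density. Put phi_j = psi_j / (4 pi), extended by 0 off the
    boundary; then U phi_j = -chi_j almost everywhere, and C_ij, minus the integral of psi_j over
    the i-th boundary, is 4 pi times the mutual energy int phi_i U phi_j. So C is a Gram matrix of
    the energy form. Two obstacles shape the analysis. Lebesgue measure of R^3 is infinite while U
    phi only decays like 1/|x|; the double integral is made absolutely convergent by letting theta
    vanish near 0, which gives theta(U phi) bounded support. Hence min(., 0) is reached through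
    shifted and truncated functions. And U phi need not be continuous or even finite everywhere, so
    the limit T -> 0 cannot rest on continuity of U phi: for each source w, the r_T-average over x
    of the oscillation of 1/|x - w| around x = y is bounded both by 2/|y - w| and by a multiple of
    sqrt T / |y - w|^2. The second bound gives convergence, the first is integrable against |phi(w)|
    for almost every y. *)

Section StieltjesMatrix.
Context {R : realType} {n : nat}.
Implicit Types (A C : 'M[R]_n) (x y v : 'cV[R]_n).

Definition quad_form A x : R := \sum_i \sum_j x i 0 * A i j * x j 0.

Definition pos_def A := forall x, x != 0 -> 0 < quad_form A x.

Definition offdiag_le0 A := forall i j, i != j -> A i j <= 0.

Lemma quad_formE A x : quad_form A x = \sum_i x i 0 * (A *m x) i 0.
Proof.
apply: eq_bigr => i _; rewrite mxE big_distrr /=.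
by apply: eq_bigr => j _; rewrite mulrA.
Qed.

Lemma pos_def_diag_gt0 A i : pos_def A -> 0 < A i i.
Proof.
move=> Apd; have d0 : (delta_mx i 0 : 'cV[R]_n) != 0.
  by apply/eqP => /matrixP/(_ i 0)/eqP; rewrite !mxE !eqxx oner_eq0.
have := Apd _ d0; rewrite quad_formE (bigD1 i) //= big1 => [|j /negbTE ji].
  by rewrite -colE !mxE !eqxx mul1r addr0.
by rewrite !mxE ji mul0r.
Qed.

Lemma pos_def_unitmx A : pos_def A -> A \in unitmx.
Proof.
move=> Apd; rewrite -unitmx_tr -row_free_unit -kermx_eq0; apply/rowV0P => w.
move=> /sub_kermxP wA; apply/eqP/negPn/negP => w0.
have wT0 : w^T != 0 by rewrite -(inj_eq trmx_inj) trmxK trmx0.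
have := Apd _ wT0; rewrite quad_formE big1 ?ltxx // => i _.
by rewrite -[A]trmxK -trmx_mul wA !mxE mulr0.
Qed.

(** Test with the negative part y of x, so that x + y is the positive part. As y and x + y have
    disjoint supports, y^T A (x + y) only sees off-diagonal entries and is <= 0, while y^T A x >= 0.
    Subtracting, y^T A y <= 0, which forces y = 0. *)
Lemma stieltjes_monotone A x : pos_def A -> offdiag_le0 A ->
  (forall i, 0 <= (A *m x) i 0) -> forall i, 0 <= x i 0.
Proof.
move=> Apd Aoff Ax i; pose y : 'cV[R]_n := \col_i Num.max (- x i 0) 0.
have y_ge0 j : 0 <= y j 0 by rewrite mxE le_max lexx orbT.
have xy_ge0 j : 0 <= x j 0 + y j 0.
  by rewrite mxE; case: (leP (- x j 0) 0) => h; rewrite ?addrN // addr0 -oppr_le0.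
have yxy j : y j 0 * (x j 0 + y j 0) = 0.
  by rewrite mxE; case: (leP (- x j 0) 0) => h; rewrite ?addrN ?mulr0 // mul0r.
clearbody y; have xyE j : (x + y) j 0 = x j 0 + y j 0 by rewrite mxE.
have [y0|/Apd] := eqVneq y 0.
  by have := xy_ge0 i; rewrite y0 [X in _ + X]mxE addr0.
have : 0 <= \sum_j y j 0 * (A *m x) j 0 by apply: sumr_ge0 => j _; rewrite mulr_ge0.
have : \sum_j y j 0 * (A *m (x + y)) j 0 <= 0.
  apply: sumr_le0 => j _; rewrite mxE big_distrr /=; apply: sumr_le0 => l _.
  have [<-|jl] := eqVneq j l.
    by rewrite xyE mulrCA yxy mulr0.
  rewrite mulr_ge0_le0 // mulr_le0_ge0 ?Aoff //.
  by rewrite xyE.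
rewrite quad_formE mulmxDr.
under eq_bigr do rewrite mxE mulrDr.
rewrite big_split /=; lra.
Qed.

Lemma sum_sqr_gt0 v : v != 0 -> 0 < \sum_i v i 0 ^+ 2.
Proof.
move=> v0; have [i vi0] : exists i, v i 0 != 0.
  apply/existsP; rewrite -negb_forall; apply: contraNN v0 => /forallP v0.
  by apply/eqP/matrixP => i j; rewrite ord1 mxE; exact/eqP.
rewrite (bigD1 i) //= ltr_pwDl ?exprn_even_gt0 //.
by apply: sumr_ge0 => j _; exact: sqr_ge0.
Qed.

(* Replacing v by |v| can only decrease the off-diagonal part of the form, so
   positivity at |v| bounds the off-diagonal part at v by the diagonal one. *)
Lemma stieltjes_eigenvalue_le C v lambda m : pos_def C -> offdiag_le0 C ->
  (forall i, C i i <= m) -> v != 0 -> C *m v = lambda *: v -> lambda <= 2 * m.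
Proof.
move=> Cpd Coff Cm v0 Cv; pose w : 'cV[R]_n := \col_i `|v i 0|.
have w0 : w != 0.
  apply: contraNneq v0 => /matrixP w0; apply/eqP/matrixP => i j.
  by rewrite ord1; have /eqP := w0 i 0; rewrite !mxE normr_eq0 => /eqP.
have := Cpd _ w0; rewrite -(ler_pM2r (sum_sqr_gt0 v0)).
have -> : lambda * (\sum_i v i 0 ^+ 2) = quad_form C v.
  rewrite quad_formE Cv mulr_sumr; apply: eq_bigr => i _; rewrite mxE; ring.
move=> Cw; suff : quad_form C w + quad_form C v <= 2 * m * (\sum_i v i 0 ^+ 2) by lra.
rewrite -big_split mulr_sumr; apply: ler_sum => i _ /=; rewrite -big_split /=.
rewrite (bigD1 i) //= [X in _ + X <= _](_ : _ = \sum_(j < n | j != i)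
  (`|v i 0| * `|v j 0| + v i 0 * v j 0) * C i j); last first.
  by apply: eq_bigr => j _; rewrite !mxE; ring.
have -> : w i 0 * C i i * w i 0 = v i 0 ^+ 2 * C i i.
  by rewrite mxE mulrAC -expr2 real_normK ?num_real.
have : \sum_(j < n | j != i) (`|v i 0| * `|v j 0| + v i 0 * v j 0) * C i j <= 0.
  apply: sumr_le0 => j ji; rewrite mulr_ge0_le0 ?Coff // 1?eq_sym //.
  by rewrite -normrM -lerBlDr sub0r -normrN ler_norm.
have : v i 0 ^+ 2 * C i i <= v i 0 ^+ 2 * m by rewrite ler_wpM2l ?sqr_ge0.
by lra.
Qed.

Lemma supnorm_ge v i : `|v i 0| <= supnorm v.
Proof. by rewrite /supnorm; apply: (le_bigmax _ (fun j => `|v j 0|)). Qed.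

Lemma supnorm_gt0 v : v != 0 -> 0 < supnorm v.
Proof.
move=> v0; rewrite lt_neqAle.
have s0 : 0 <= supnorm v by apply: bigmax_ge_id.
rewrite s0 andbT; apply: contraNneq v0 => sv; apply/eqP/matrixP => i j.
by apply/eqP; rewrite ord1 mxE -normr_le0 sv supnorm_ge.
Qed.

End StieltjesMatrix.

(** * The landscape bound for a positive definite matrix with nonpositive off-diagonal entries *)

Section Landscape.
Context {R : realType} {n : nat}.
Variable C : 'M[R]_n.+1.
Hypotheses (Cpd : pos_def C) (Coff : offdiag_le0 C).

Let mu := 2 * \big[Num.max/C ord0 ord0]_(i < n.+1) C i i.
Let M := comparison_mx (mu%:M - C).

Let le_mu i : 2 * C i i <= mu.
Proof. by rewrite ler_pM2l ?ltr0n //; exact: (le_bigmax _ (fun j => C j j)). Qed.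

Let mu_ge i : C i i <= mu - C i i.
Proof. by have := le_mu i; lra. Qed.

(** The absolute values disappear: on the diagonal mu - C_ii >= C_ii > 0 by the factor 2 in mu, and
    off it -|-C_ij| = C_ij because C_ij <= 0. *)
Let comparisonE i j : M i j = C i j + (i == j)%:R * (mu - 2 * C i i).
Proof.
rewrite !mxE; case: eqVneq => [<-|ij] /=; rewrite ?mulr1n ?mulr0n.
  rewrite eqxx mulr1n ger0_norm; first by ring.
  by rewrite (le_trans _ (mu_ge i)) // ltW // pos_def_diag_gt0.
by rewrite sub0r normrN ler0_norm ?Coff // opprK; ring.
Qed.

Let M_pd : pos_def M.
Proof.
move=> x /Cpd; rewrite /quad_form => /lt_le_trans; apply.
apply: ler_sum => i _; rewrite -subr_ge0 -sumrB (bigD1 i) //= big1 => [|j].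
  rewrite comparisonE eqxx addr0.
  have -> : x i 0 * (C i i + true%:R * (mu - 2 * C i i)) * x i 0 -
    x i 0 * C i i * x i 0 = x i 0 ^+ 2 * (mu - 2 * C i i) by rewrite mulr1n; ring.
  by rewrite mulr_ge0 ?sqr_ge0 ?subr_ge0.
by rewrite eq_sym => /negbTE ij; rewrite comparisonE ij mul0r addr0 subrr.
Qed.

Let M_off : offdiag_le0 M.
Proof.
by move=> i j ij; rewrite comparisonE (negbTE ij) mul0r addr0 Coff.
Qed.

Lemma landscape_bound :
  [/\ 0 < mu,
      exists! u : 'cV[R]_n.+1, M *m u = const_mx 1 &
      forall u : 'cV[R]_n.+1, M *m u = const_mx 1 ->
      forall (lambda : R) (v : 'cV[R]_n.+1),
        0 < lambda -> v != 0 -> C *m v = lambda *: v ->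
      forall i, `|v i 0| / supnorm v <= (mu - lambda) * u i 0].
Proof.
have Munit := pos_def_unitmx M_pd; split.
- by rewrite (lt_le_trans _ (le_mu ord0)) // mulr_gt0 ?ltr0n ?pos_def_diag_gt0.
- exists (invmx M *m const_mx 1); split; first by rewrite mulKVmx.
  by move=> u Mu; rewrite -Mu mulKmx.
- move=> u Mu lambda v lambda0 v0 Cv i.
  have lmu : lambda <= mu.
    apply: stieltjes_eigenvalue_le Cpd Coff _ v0 Cv => j.
    exact: (le_bigmax _ (fun j => C j j)).
  have s0 := supnorm_gt0 v0; rewrite ler_pdivrMr //.
  pose y : 'cV[R]_n.+1 := ((mu - lambda) * supnorm v) *: u - \col_j `|v j 0|.
  suff : 0 <= y i 0 by rewrite !mxE; nra.
  apply: stieltjes_monotone M_pd M_off _ i => i.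
  rewrite mulmxBr -scalemxAr Mu [X in 0 <= X]mxE mxE [const_mx 1 _ _]mxE mulr1.
  rewrite [X in _ + X]mxE subr_ge0.
  apply: le_trans (_ : (mu - lambda) * `|v i 0| <= _); last first.
    by rewrite ler_wpM2l ?subr_ge0 ?supnorm_ge.
  rewrite -[mu - lambda]ger0_norm ?subr_ge0 // -normrM.
  have -> : (mu - lambda) * v i 0 = \sum_j (mu%:M - C) i j * v j 0.
    have -> : \sum_j (mu%:M - C) i j * v j 0 = ((mu%:M - C) *m v) i 0.
      by rewrite mxE.
    by rewrite mulmxBl mul_scalar_mx Cv -scalerBl mxE.
  (* With A = mu I - C, row i of M |v| is |A_ii v_i| minus the sum of the other |A_ij v_j|, so the
     reverse triangle inequality bounds it by |(A v)_i|. *)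
  rewrite mxE (bigD1 i) //= [in leRHS](bigD1 i) //=.
  rewrite ![(\col_j `|v j 0|) _ _]mxE.
  apply: le_trans (lerB_normD _ _); apply: lerD.
    by rewrite normrM; rewrite /M !mxE eqxx.
  rewrite lerNr; apply: le_trans (ler_norm_sum _ _ _) _.
  rewrite -sumrN; apply: ler_sum => j ji.
  by rewrite normrM !mxE eq_sym (negbTE ji) mulNr opprK.
Qed.

End Landscape.

(** * Heat and Newton kernels *)

Section SigmaFiniteProduct.
Local Open Scope ereal_scope.
Context d1 d2 (T1 : measurableType d1) (T2 : measurableType d2) (R : realType).
Variables (m1 : {sigma_finite_measure set T1 -> \bar R})
  (m2 : {sigma_finite_measure set T2 -> \bar R}).

(** A name of its own carries the sigma-finiteness instance, so that the product can be taken again: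
    for R * R * R, and for pairs of points of R^3. *)
Definition prodm : set (T1 * T2) -> \bar R := m1 \x m2.

Let prodm0 : prodm set0 = 0.
Proof. exact: measure0. Qed.

Let prodm_ge0 A : 0 <= prodm A.
Proof. exact: measure_ge0. Qed.

Let prodm_sigma_additive : semi_sigma_additive prodm.
Proof. exact: measure_semi_sigma_additive. Qed.

HB.instance Definition _ :=
  isMeasure.Build _ _ _ prodm prodm0 prodm_ge0 prodm_sigma_additive.

Lemma prodm_setX A B : measurable A -> measurable B ->
  prodm (A `*` B) = m1 A * m2 B.
Proof. exact: product_measure1E. Qed.

Let prodm_sigma_finite : sigma_finite setT prodm.
Proof.
have [F TF Foo] := sigma_finiteT m1; have [G TG Goo] := sigma_finiteT m2.
(* The rectangles F_i x G_j, enumerated by codes of pairs; a code of no pair contributes the empty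
   set. *)
exists (fun n => if unpickle n is Some ij then F ij.1 `*` G ij.2 else set0).
  apply/esym; rewrite -subTset => -[x y] _.
  have [[i _ Fx] [j _ Gy]] : (\bigcup_i F i) x /\ (\bigcup_j G j) y.
    by rewrite -TF -TG.
  by exists (pickle (i, j)) => //; rewrite pickleK.
move=> n; case: (unpickle n) => [[i j] /=|]; last by rewrite measure0.
have [mF Fi] := Foo i; have [mG Gj] := Goo j; split; first exact: measurableX.
by rewrite prodm_setX // lte_mul_pinfty // ge0_fin_numE.
Qed.

HB.instance Definition _ :=
  Measure_isSigmaFinite.Build _ _ _ prodm prodm_sigma_finite.

Lemma prodm_tonelli1 (f : T1 * T2 -> \bar R) : measurable_fun setT f ->
  (forall x, 0 <= f x) ->
  \int[prodm]_z f z = \int[m1]_x \int[m2]_y f (x, y).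
Proof. exact: fubini_tonelli1. Qed.

End SigmaFiniteProduct.

Section LebesgueSpace.
Context {R : realType}.
Local Open Scope ereal_scope.

Let idR : measurableTypeR R -> R := idfun.

Let measurable_idR : measurable_fun setT idR := @measurable_id _ _ setT.

HB.instance Definition _ := isMeasurableFun.Build _ _ _ _ idR measurable_idR.

(** The pushforward along the identity moves Lebesgue measure to the measurable structure of R
    itself, the one whose products give R * R * R. *)
Definition leb1 : set R -> \bar R := pushforward (@lebesgue_measure R) idR.

Let leb1_0 : leb1 set0 = 0.
Proof. exact: (measure0 (@lebesgue_measure R)). Qed.

Let leb1_ge0 A : 0 <= leb1 A.
Proof. exact: (measure_ge0 (@lebesgue_measure R)). Qed.

Let leb1_sigma_additive : semi_sigma_additive leb1.
Proof. exact: (@measure_semi_sigma_additive _ _ _ (@lebesgue_measure R)). Qed.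

HB.instance Definition _ :=
  isMeasure.Build _ _ _ leb1 leb1_0 leb1_ge0 leb1_sigma_additive.

Let leb1_sigma_finite : sigma_finite [set: R] leb1.
Proof.
have [F FT Ffin] := @sigma_finiteT _ _ _ (@lebesgue_measure R).
by exists F.
Qed.

HB.instance Definition _ := Measure_isSigmaFinite.Build _ _ _ leb1 leb1_sigma_finite.

Lemma integral_leb1 (D : set R) (f : R -> \bar R) :
  measurable D -> measurable_fun D f -> (forall x, D x -> 0 <= f x) ->
  \int[leb1]_(x in D) f x = \int[lebesgue_measure]_(x in D) f x.
Proof.
move=> mD mf f0; rewrite ge0_integral_pushforward //.
by move=> x; rewrite inE; exact: f0.
Qed.

Definition leb3 := prodm (prodm leb1 leb1) leb1.
HB.instance Definition _ := SigmaFiniteMeasure.on leb3.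
End LebesgueSpace.

(** * One-dimensional Gaussian densities *)

Section HeatKernel.
Context {R : realType}.
Implicit Types (s t : R).

Lemma measurable_invr_ge0 d (T : measurableType d) (f : T -> R) :
  measurable_fun setT f -> (forall x, 0 <= f x) ->
  measurable_fun setT (fun x => (f x)^-1).
Proof.
move=> mf f0; rewrite (_ : (fun x => _) = (@powR R ^~ (-1)) \o f).
  exact: measurableT_comp.
by apply/funext => x /=; rewrite powR_inv1.
Qed.

Lemma measurable_sqrtr d (T : measurableType d) (f : T -> R) :
  measurable_fun setT f -> measurable_fun setT (fun x => Num.sqrt (f x)).
Proof.
move=> mf; apply: measurableT_comp mf; apply: continuous_measurable_fun.
exact: sqrt_continuous.
Qed.

(** The normal density of variance t, so that [heat] is the kernel of exp(t Laplacian / 2). Since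
    square roots of negative numbers and the inverse of 0 are 0, it vanishes for t <= 0. *)
Definition gauss1 t (a : R) : R :=
  (Num.sqrt (t * pi *+ 2))^-1 * expR (- a ^+ 2 / (t *+ 2)).

Lemma gauss1_ge0 t a : 0 <= gauss1 t a.
Proof. by rewrite mulr_ge0 ?expR_ge0 // invr_ge0 sqrtr_ge0. Qed.

Lemma gauss1N t a : gauss1 t (- a) = gauss1 t a.
Proof. by rewrite /gauss1 sqrrN. Qed.

Lemma gauss1B t a b : gauss1 t (a - b) = gauss1 t (b - a).
Proof. by rewrite -gauss1N opprB. Qed.

Lemma measurable_gauss1 d (T : measurableType d) (f g : T -> R) :
  measurable_fun setT f -> (forall x, 0 <= f x) -> measurable_fun setT g ->
  measurable_fun setT (fun x => gauss1 (f x) (g x)).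
Proof.
move=> mf f0 mg; have mfn c : measurable_fun setT (fun x => f x * c).
  exact: measurable_funM.
have f2 (c : R) x : (f x * c) *+ 2 = f x * (c *+ 2) by rewrite mulrnAr.
apply: measurable_funM.
  apply: measurable_invr_ge0 => [|x]; last exact: sqrtr_ge0.
  apply: measurable_sqrtr; under eq_fun do rewrite f2; exact: mfn.
apply: measurableT_comp; first exact: measurable_expR.
apply: measurable_funM.
  apply: measurableT_comp; first exact: oppr_measurable.
  exact: measurable_funX.
apply: measurable_invr_ge0 => [|x]; last by rewrite mulrn_wge0.
by under eq_fun do rewrite -mulr_natr; exact: mfn.
Qed.

Lemma integral_gauss1 t m : 0 < t ->
  (\int[leb1]_z (gauss1 t (z - m))%:E = 1)%E.
Proof.
move=> t0; have st0 : Num.sqrt t != 0 by rewrite gt_eqF ?sqrtr_gt0.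
have stE : Num.sqrt t ^+ 2 = t by rewrite sqr_sqrtr ?ltW.
rewrite integral_leb1 //; last 2 first.
- apply/measurable_EFinP; apply: measurable_gauss1 => //.
    by move=> _; exact: ltW.
  exact: measurable_funB.
- by move=> x _; rewrite lee_fin gauss1_ge0.
rewrite -(integral_normal_pdf m (Num.sqrt t)); apply: eq_integral => x _.
by rewrite normal_pdfE // /normal_peak /normal_fun stE.
Qed.

(** Completing the square in z: the variance of the second factor is half the harmonic mean of s and
    t, and its mean is the weighted average of a and b. Integrating out z then leaves the semigroup
    property. *)
Lemma gauss1_mul s t a b z : 0 < s -> 0 < t ->
  gauss1 t (a - z) * gauss1 s (z - b) =
  gauss1 (t + s) (a - b) * gauss1 (t * s / (t + s)) (z - (s * a + t * b) / (t + s)).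
Proof.
move=> s0 t0; have st0 : 0 < t + s by rewrite addr_gt0.
have pi0 := pi_gt0 R; rewrite /gauss1 mulrACA [RHS]mulrACA -!expRD -!invfM -!sqrtrM; last 2 first.
- by rewrite mulrn_wge0 // mulr_ge0 ?ltW.
- by rewrite mulrn_wge0 // mulr_ge0 ?ltW.
congr (_^-1 * expR _).
  by congr Num.sqrt; field; rewrite gt_eqF.
by field; rewrite !gt_eqF.
Qed.

Lemma gauss1_conv s t a b : 0 < s -> 0 < t ->
  (\int[leb1]_z (gauss1 t (a - z) * gauss1 s (z - b))%:E =
   (gauss1 (t + s) (a - b))%:E)%E.
Proof.
move=> s0 t0; under eq_integral do rewrite gauss1_mul // EFinM.
have ts0 : 0 < t * s / (t + s) by rewrite divr_gt0 ?mulr_gt0 ?addr_gt0.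
rewrite ge0_integralZl_EFin ?gauss1_ge0 //.
- by rewrite integral_gauss1 // mule1.
- by move=> x _; rewrite lee_fin gauss1_ge0.
- apply/measurable_EFinP; apply: measurable_gauss1 => //.
    by move=> _; exact: ltW.
  exact: measurable_funB.
Qed.

Lemma integral_leb3_prod (f g h : R -> R) :
  measurable_fun setT f -> measurable_fun setT g -> measurable_fun setT h ->
  (forall a, 0 <= f a) -> (forall a, 0 <= g a) -> (forall a, 0 <= h a) ->
  (\int[leb3]_z (f z.1.1 * g z.1.2 * h z.2)%:E =
   \int[leb1]_a (f a)%:E * \int[leb1]_a (g a)%:E * \int[leb1]_a (h a)%:E)%E.
Proof.
move=> mf mg mh f0 g0 h0.
have m11 : measurable_fun setT (fun z : R * R * R => z.1.1).
  by apply: measurableT_comp measurable_fst measurable_fst.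
have m12 : measurable_fun setT (fun z : R * R * R => z.1.2).
  by apply: measurableT_comp measurable_snd measurable_fst.
rewrite prodm_tonelli1 /=; last 2 first.
- apply/measurable_EFinP; apply: measurable_funM; first apply: measurable_funM.
  + exact: measurableT_comp m11.
  + exact: measurableT_comp m12.
  + exact: measurableT_comp measurable_snd.
- by move=> x; rewrite lee_fin !mulr_ge0.
under eq_integral => p _.
  under eq_integral do rewrite EFinM.
  rewrite ge0_integralZl_EFin ?mulr_ge0 //; last first.
  - exact/measurable_EFinP.
  - by move=> *; rewrite lee_fin.
  over.
have mfg : measurable_fun setT (fun p : R * R => f p.1 * g p.2).
  apply: measurable_funM.
  + exact: measurableT_comp measurable_fst.
  + exact: measurableT_comp measurable_snd.
rewrite ge0_integralZr //; last 3 first.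
- exact/measurable_EFinP.
- by move=> *; rewrite lee_fin mulr_ge0.
- by apply: integral_ge0 => *; rewrite lee_fin.
congr (_ * _)%E; rewrite prodm_tonelli1 /=; last 2 first.
- exact/measurable_EFinP.
- by move=> *; rewrite lee_fin mulr_ge0.
under eq_integral => p _.
  under eq_integral do rewrite EFinM.
  rewrite ge0_integralZl_EFin //; last first.
  - exact/measurable_EFinP.
  - by move=> *; rewrite lee_fin.
  over.
rewrite ge0_integralZr //.
- exact/measurable_EFinP.
- by move=> *; rewrite lee_fin.
- by apply: integral_ge0 => *; rewrite lee_fin.
Qed.

End HeatKernel.

(** * The heat kernel on R^3 and its scaling *)

Section NewtonKernel.
Context {R : realType}.
Implicit Types (s t u : R) (x y z w : R * R * R).

Lemma measurable_coords d (T : measurableType d) (f : T -> R * R * R) :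
  measurable_fun setT f ->
  [/\ measurable_fun setT (fun p => (f p).1.1),
      measurable_fun setT (fun p => (f p).1.2) &
      measurable_fun setT (fun p => (f p).2)].
Proof.
move=> mf; split.
- by apply: measurableT_comp (measurableT_comp measurable_fst mf).
- by apply: measurableT_comp (measurableT_comp measurable_fst mf).
- by apply: measurableT_comp mf.
Qed.

Definition heat t x y : R :=
  gauss1 t (x.1.1 - y.1.1) * gauss1 t (x.1.2 - y.1.2) * gauss1 t (x.2 - y.2).

Lemma heat_ge0 t x y : 0 <= heat t x y.
Proof. by rewrite !mulr_ge0 ?gauss1_ge0. Qed.

Lemma heatC t x y : heat t x y = heat t y x.
Proof. by rewrite /heat; congr (_ * _ * _); rewrite gauss1B. Qed.

Lemma measurable_heat d (T : measurableType d) (f : T -> R)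
    (g h : T -> R * R * R) :
  measurable_fun setT f -> (forall p, 0 <= f p) ->
  measurable_fun setT g -> measurable_fun setT h ->
  measurable_fun setT (fun p => heat (f p) (g p) (h p)).
Proof.
move=> mf f0 /measurable_coords[g1 g2 g3] /measurable_coords[h1 h2 h3].
apply: measurable_funM; first apply: measurable_funM.
- by apply: measurable_gauss1 => //; exact: measurable_funB.
- by apply: measurable_gauss1 => //; exact: measurable_funB.
- by apply: measurable_gauss1 => //; exact: measurable_funB.
Qed.

Lemma integral_heat t x : 0 < t -> (\int[leb3]_z (heat t x z)%:E = 1)%E.
Proof.
move=> t0; have m1 (a : R) : measurable_fun setT (fun b : R => gauss1 t (b - a)).
  apply: measurable_gauss1 => //; first by move=> _; exact: ltW.
  exact: measurable_funB.
under eq_integral do rewrite heatC /heat.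
rewrite (@integral_leb3_prod _ (fun b : R => gauss1 t (b - x.1.1))
  (fun b : R => gauss1 t (b - x.1.2)) (fun b : R => gauss1 t (b - x.2))) //;
  last 3 first.
- by move=> a; exact: gauss1_ge0.
- by move=> a; exact: gauss1_ge0.
- by move=> a; exact: gauss1_ge0.
by rewrite !integral_gauss1 // !mule1.
Qed.

Lemma heat_conv s t x y : 0 < s -> 0 < t ->
  (\int[leb3]_z (heat t x z * heat s z y)%:E = (heat (t + s) x y)%:E)%E.
Proof.
move=> s0 t0.
pose G (a b c : R) := gauss1 t (a - c) * gauss1 s (c - b).
have G0 a b c : 0 <= G a b c by rewrite mulr_ge0 ?gauss1_ge0.
have mG a b : measurable_fun setT (G a b).
  apply: measurable_funM; apply: measurable_gauss1 => //.
  - by move=> _; exact: ltW.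
  - exact: measurable_funB.
  - by move=> _; exact: ltW.
  - exact: measurable_funB.
transitivity (\int[leb3]_z (G x.1.1 y.1.1 z.1.1 * G x.1.2 y.1.2 z.1.2 *
    G x.2 y.2 z.2)%:E)%E.
  by apply: eq_integral => z _; rewrite /heat /G; congr EFin; ring.
by rewrite integral_leb3_prod // !gauss1_conv.
Qed.

(* The heat kernel at unit distance; the square root of a negative number
   being 0, it vanishes for t <= 0. *)
Definition heat_profile t : R :=
  (Num.sqrt (t * pi *+ 2))^-1 ^+ 3 * expR (- (t *+ 2)^-1).

Lemma enorm3_ge0 x : 0 <= enorm3 x. Proof. exact: sqrtr_ge0. Qed.

Lemma dot3_ge0 x : 0 <= dot3 x x.
Proof. by rewrite /dot3 -!expr2 !addr_ge0 ?sqr_ge0. Qed.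

Lemma enorm3_sqr x : enorm3 x ^+ 2 = dot3 x x.
Proof. by rewrite sqr_sqrtr ?dot3_ge0. Qed.

Lemma heatE t x y : 0 < t -> heat t x y =
  (Num.sqrt (t * pi *+ 2))^-1 ^+ 3 * expR (- enorm3 (x - y) ^+ 2 / (t *+ 2)).
Proof.
move=> t0; rewrite /heat /gauss1 enorm3_sqr /dot3 /=.
set c := (Num.sqrt _)^-1.
have -> : - ((x.1.1 - y.1.1) * (x.1.1 - y.1.1) +
    (x.1.2 - y.1.2) * (x.1.2 - y.1.2) + (x.2 - y.2) * (x.2 - y.2)) / (t *+ 2) =
    - (x.1.1 - y.1.1) ^+ 2 / (t *+ 2) + - (x.1.2 - y.1.2) ^+ 2 / (t *+ 2) +
    - (x.2 - y.2) ^+ 2 / (t *+ 2) by field; rewrite gt_eqF.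
by rewrite !expRD; ring.
Qed.

Lemma heat_scale t x y : 0 < t -> x != y ->
  heat t x y = (enorm3 (x - y))^-1 ^+ 3 * heat_profile (t / enorm3 (x - y) ^+ 2).
Proof.
move=> t0 xy; rewrite heatE // /heat_profile.
have d0 : 0 < enorm3 (x - y).
  rewrite /enorm3 sqrtr_gt0 lt_neqAle dot3_ge0 andbT eq_sym.
  apply: contraNneq xy; rewrite /dot3 -!expr2 => /eqP.
  rewrite !paddr_eq0 ?addr_ge0 ?sqr_ge0 // !sqrf_eq0 !subr_eq0.
  move=> /andP[/andP[/eqP h1 /eqP h2] /eqP h3].
  by case: x h1 h2 h3 => [[? ?] ?]; case: y => [[? ?] ?] /= -> -> ->.
set r := enorm3 (x - y) in d0 *; rewrite mulrA -exprMn -invfM.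
have -> : t * pi *+ 2 = r ^+ 2 * (t / r ^+ 2 * pi *+ 2).
  by field; rewrite gt_eqF.
rewrite sqrtrM ?sqr_ge0 // sqrtr_sqr gtr0_norm //; congr (_ * expR _).
by field; rewrite !gt_eqF.
Qed.

Lemma heat_profile_ge0 t : 0 <= heat_profile t.
Proof. by rewrite mulr_ge0 ?expR_ge0 // exprn_ge0 // invr_ge0 sqrtr_ge0. Qed.

(** A bound that vanishes at t = 0; it yields continuity there and integrability on ]0, 1]. With w =
    sqrt (2 pi t) and v = 1 / (2 t) it reads 1 <= w^4 e^v, and e^v >= 1 + v^2 / 2 suffices because
    w^4 v^2 / 2 = pi^2 / 2. *)
Lemma heat_profile_le t : heat_profile t <= Num.sqrt (t * pi *+ 2).
Proof.
have [t0|t0] := leP t 0.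
  rewrite /heat_profile (_ : Num.sqrt _ = 0) ?invr0 ?expr0n ?mul0r //.
  by apply/eqP; rewrite sqrtr_eq0 mulrn_wle0 // mulr_le0_ge0 // pi_ge0.
have tp : 0 < t * pi *+ 2 by rewrite mulrn_wgt0 // mulr_gt0 // pi_gt0.
have w0 : 0 < Num.sqrt (t * pi *+ 2) by rewrite sqrtr_gt0.
rewrite /heat_profile; set w := Num.sqrt _ in w0 *.
have wE : w ^+ 2 = t * pi *+ 2 by rewrite sqr_sqrtr // ltW.
rewrite expRN exprVn -invfM -[X in X <= _]div1r.
rewrite ler_pdivrMr ?mulr_gt0 ?exprn_gt0 ?expR_gt0 // mulrA -exprS.
have v0 : 0 <= (t *+ 2)^-1 by rewrite invr_ge0 mulrn_wge0 // ltW.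
have : w ^+ 4 * (1 + (t *+ 2)^-1 ^+ 2 / 2) <= w ^+ 4 * expR (t *+ 2)^-1.
  by rewrite ler_wpM2l ?exprn_ge0 ?(ltW w0) //; exact: (expR_ge1Dxn 1 v0).
apply: le_trans; rewrite (_ : w ^+ 4 = (t * pi *+ 2) ^+ 2); last first.
  by rewrite -wE -exprM.
have -> : (t * pi *+ 2) ^+ 2 * (1 + (t *+ 2)^-1 ^+ 2 / 2) =
  (t * pi *+ 2) ^+ 2 + pi ^+ 2 / 2 by field; rewrite gt_eqF.
have := pi_ge2 R; have := sqr_ge0 (t * pi *+ 2); nra.
Qed.

Lemma sqrt_cont_scale (c : R) : continuous (fun t : R => Num.sqrt (t * c)).
Proof.
move=> t; apply: (@continuous_comp _ _ _ (fun t => t * c) Num.sqrt).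
  by apply: cvgMl; exact: cvg_id.
exact: sqrt_continuous.
Qed.

Lemma continuous_heat_profile : continuous heat_profile.
Proof.
move=> t; have cs : continuous (fun t : R => Num.sqrt (t * pi *+ 2)).
  by under eq_fun do rewrite -mulrnAr; exact: sqrt_cont_scale.
have [t0|t0] := leP t 0.
  have ht : heat_profile t = 0.
    apply/eqP; rewrite eq_le heat_profile_ge0 andbT.
    rewrite (le_trans (heat_profile_le t)) // le_eqVlt sqrtr_eq0.
    by rewrite mulrn_wle0 // mulr_le0_ge0 // pi_ge0.
  have st : Num.sqrt (t * pi *+ 2) = 0.
    by apply/eqP; rewrite sqrtr_eq0 mulrn_wle0 // mulr_le0_ge0 // pi_ge0.
  rewrite /continuous_at ht.
  apply: (@squeeze_cvgr _ _ _ _ (fun=> 0) (fun t => Num.sqrt (t * pi *+ 2))).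
  - by near=> u; rewrite heat_profile_ge0 heat_profile_le.
  - exact: cvg_cst.
  - by have := cs t; rewrite /continuous_at st.
apply: cvgM.
  have cV : (Num.sqrt (u * pi *+ 2))^-1 @[u --> t] -->
      (Num.sqrt (t * pi *+ 2))^-1.
    apply: cvgV; last exact: cs.
    by rewrite gt_eqF // sqrtr_gt0 mulrn_wgt0 // mulr_gt0 // pi_gt0.
  exact: (cvg_comp _ _ cV (@exprn_continuous _ 3 _)).
have cV : - (u *+ 2)^-1 @[u --> t] --> - (t *+ 2)^-1.
  apply: cvgN; apply: cvgV; first by rewrite gt_eqF // mulrn_wgt0.
  by under eq_fun do rewrite -mulr_natr; rewrite -[t *+ 2]mulr_natr; apply: cvgMl; exact: cvg_id.
exact: (cvg_comp _ _ cV (@continuous_expR _ _)).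
Unshelve. all: by end_near. Qed.

End NewtonKernel.

(** * The Newton kernel as a time integral of the heat kernel *)

Section NewtonKernelIntegrals.
Context {R : realType}.
Implicit Types (s t u : R) (x y z w : R * R * R).

(** The substitution u = s c + T. It serves twice: with T = 0 to scale time by the squared distance,
    and with c = 1 to shift time in the semigroup property. *)
Lemma integral_affine (c T : R) (G : R -> R) : 0 < c ->
  (forall u, T <= u -> {for u, continuous G}) -> measurable_fun setT G -> (forall u, 0 <= G u) ->
  (\int[leb1]_(u in `]T, +oo[) (G u)%:E =
   \int[leb1]_(s in `]0%R, +oo[) (G (s * c + T) * c)%:E)%E.
Proof.
move=> c0 cG mG G0; pose F (s : R) := s * c + T.
have mF : measurable_fun setT F.
  by apply: measurable_funD => //; exact: measurable_funM.
have dF (s : R) : is_derive s (1 : R) F c.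
  by rewrite /F; apply: is_derive_eq; rewrite scaler0 add0r addr0 [_ *: _]mulr1.
have F'E : F^`()%classic = cst c.
  by apply/funext => s; rewrite derive1E derive_val.
have mGF : measurable_fun setT (fun s => G (s * c + T) * c).
  apply: measurable_funM => //; exact: (measurableT_comp mG mF).
rewrite !integral_leb1 //; last 4 first.
- by apply/measurable_EFinP; apply: measurable_funTS.
- by move=> s _; rewrite lee_fin mulr_ge0 // ltW.
- by apply/measurable_EFinP; apply: measurable_funTS.
- by move=> s _; rewrite lee_fin.
rewrite !integral_itv_obnd_cbnd; last 2 first.
- by apply/measurable_EFinP; apply: measurable_funTS.
- by apply/measurable_EFinP; apply: measurable_funTS.
have FT : T = F 0 by rewrite /F mul0r add0r.
rewrite [in LHS]FT increasing_ge0_integration_by_substitutiony.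
- by apply: eq_integral => s _; rewrite F'E.
- by move=> a b _ _ ab; rewrite /F ltrD2r ltr_pM2r.
- by move=> a _; rewrite F'E; exact: cvg_cst.
- by rewrite F'E; exact: is_cvg_cst.
- by rewrite F'E; exact: is_cvg_cst.
- split; first by move=> a _; exact: ex_derive.
  apply: cvg_at_right_filter; apply: cvgD; last exact: cvg_cst.
  by apply: cvgMl; exact: cvg_id.
- have cy : r * c @[r --> +oo] --> +oo by apply: (gt0_cvgMly c0); exact: cvg_id.
  exact: (cvg_comp _ _ cy (cvg_addrr T)).
- rewrite -FT; apply: continuous_in_subspaceT => u.
  by rewrite inE /= in_itv /= andbT; exact: cG.
- by move=> u _; exact: G0.
Qed.

(** Its value is 1 / (2 pi), as 1 / (2 pi |x|) is the Green function of half the Laplacian on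
    R^3. *)
Definition newton_const : R :=
  fine (\int[leb1]_(t in `]0%R, +oo[) (heat_profile t)%:E)%E.

Lemma measurable_heat_profile : measurable_fun setT (@heat_profile R).
Proof. apply: continuous_measurable_fun; exact: continuous_heat_profile. Qed.

(** The tail t^(-3/2) of [heat_profile], with antiderivative -2 t^(-1/2). *)
Lemma sqrtV_sub_lty :
  (\int[leb1]_(t in `]1%R, +oo[) ((Num.sqrt (t : R))^-1 ^+ 3)%:E < +oo)%E.
Proof.
have mf : measurable_fun setT (fun t : R => (Num.sqrt t)^-1 ^+ 3).
  apply: measurable_funX; apply: measurable_invr_ge0 => [|t].
    exact: measurable_sqrtr.
  exact: sqrtr_ge0.
have f0 (t : R) : 0 <= (Num.sqrt t)^-1 ^+ 3.
  by rewrite exprn_ge0 // invr_ge0 sqrtr_ge0.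
have cV (t : R) : 0 < t -> (Num.sqrt u)^-1 @[u --> t] --> (Num.sqrt t)^-1.
  by move=> t0; apply: cvgV; [rewrite gt_eqF // sqrtr_gt0|exact: sqrt_continuous].
have dF (t : R) : 0 < t ->
    is_derive t (1 : R) (fun u => - 2 * (Num.sqrt u)^-1) ((Num.sqrt t)^-1 ^+ 3).
  move=> t0; have s0 : Num.sqrt t != 0 by rewrite gt_eqF // sqrtr_gt0.
  have dV := is_deriveV s0 (is_derive1_sqrt t0).
  apply: (is_derive_eq (is_deriveZ (- 2) dV)).
  rewrite /GRing.scale /=; have := s0; set w := Num.sqrt t => w0.
  by field; rewrite w0.
rewrite integral_leb1 //; last first.
  by apply/measurable_EFinP; apply: measurable_funTS.
rewrite integral_itv_obnd_cbnd; last first.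
  by apply/measurable_EFinP; apply: measurable_funTS.
have gt0 (t : R) : 1 <= t -> 0 < t by exact: lt_le_trans.
rewrite (@ge0_continuous_FTC2y _ (fun t => (Num.sqrt t)^-1 ^+ 3)
  (fun u => - 2 * (Num.sqrt u)^-1) 1 0).
- by rewrite -EFinB ltry.
- by move=> t _; exact: f0.
- apply: continuous_in_subspaceT => t; rewrite inE /= in_itv /= andbT => /gt0 t0.
  exact: (cvg_comp _ _ (cV _ t0) (@exprn_continuous _ 3 _)).
- have sy : Num.sqrt (t : R) @[t --> +oo] --> +oo.
    apply/cvgryPge => A; near=> t.
    have At : `|A| ^+ 2 <= t by near: t; exact: nbhs_pinfty_ge.
    rewrite (le_trans (ler_norm A)) // -[`|A|]normr_id -sqrtr_sqr.
    by rewrite ler_wsqrtr.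
  rewrite -[X in _ --> X](mulr0 (- 2)); apply: cvgMr.
  apply/gtr0_cvgV0 => //; near=> t; rewrite sqrtr_gt0.
  by near: t; exact: nbhs_pinfty_gt.
- by move=> t t1; have [] := dF t (lt_trans ltr01 t1).
- apply: cvg_at_right_filter; apply: cvgMr; exact: cV.
- move=> t; rewrite in_itv /= andbT => t1; rewrite derive1E.
  by apply: derive_val; apply: dF; rewrite (lt_trans _ t1).
Unshelve. all: by end_near. Qed.

Lemma integral_heat_profile :
  (\int[leb1]_(t in `]0%R, +oo[) (heat_profile (t : R))%:E = newton_const%:E)%E.
Proof.
rewrite fineK // ge0_fin_numE; last first.
  by apply: integral_ge0 => t _; rewrite lee_fin heat_profile_ge0.
have mf D : measurable_fun D (fun t : R => (heat_profile t)%:E).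
  by apply: measurable_funTS; apply/measurable_EFinP; exact: measurable_heat_profile.
have -> : `]0%R, +oo[%classic = `]0%R, 1%R] `|` `]1%R, +oo[ :> set R.
  apply/seteqP; split=> t; rewrite /= !in_itv /= !andbT.
    by case: (leP t 1) => t1 t0; [left; rewrite t0|right].
  by case=> [/andP[]//|]; exact: lt_trans.
rewrite ge0_integral_setU //=; last 2 first.
- by move=> t _; rewrite lee_fin heat_profile_ge0.
- apply/disj_setPS => t /=; rewrite !in_itv /= andbT => -[/andP[_ t1] t2].
  by have := le_lt_trans t1 t2; rewrite ltxx.
rewrite lte_add_pinfty //.
  have : (\int[leb1]_(t in `]0%R, 1%R]) (Num.sqrt (pi *+ 2 : R))%:E < +oo)%E.
    rewrite integral_cst // lte_mul_pinfty ?lee_fin ?sqrtr_ge0 //.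
    change (@lebesgue_measure R `]0%R, 1%R] < +oo)%E.
    by rewrite lebesgue_measure_itv /= lte_fin ltr01 ltry.
  apply: le_lt_trans; apply: ge0_le_integral => //.
  - by move=> t _; rewrite lee_fin heat_profile_ge0.
  - move=> t; rewrite /= in_itv /= => /andP[t0 t1]; rewrite lee_fin.
    rewrite (le_trans (heat_profile_le t)) // ler_wsqrtr // lerMn2r.
    by rewrite ler_piMl // pi_ge0.
apply: le_lt_trans sqrtV_sub_lty; apply: ge0_le_integral => //.
- by move=> t _; rewrite lee_fin heat_profile_ge0.
- apply/measurable_EFinP; apply: measurable_funTS; apply: measurable_funX.
  apply: measurable_invr_ge0 => [|t]; last exact: sqrtr_ge0.
  exact: measurable_sqrtr.
- move=> t; rewrite /= in_itv /= andbT => t1; rewrite lee_fin.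
  have t0 : 0 < t by rewrite (lt_trans _ t1).
  have tpi : t <= t * pi *+ 2.
    have := pi_ge2 R; rewrite -mulrnAr => pi2; rewrite ler_peMr ?(ltW t0) //.
    by rewrite -mulr_natr; lra.
  rewrite -[leRHS]mulr1; apply: ler_pM.
  - by rewrite exprn_ge0 // invr_ge0 sqrtr_ge0.
  - exact: expR_ge0.
  - rewrite lerXn2r ?nnegrE ?invr_ge0 ?sqrtr_ge0 //.
    by rewrite lef_pV2 ?posrE ?sqrtr_gt0 ?(lt_le_trans t0) // ler_wsqrtr.
  - by rewrite expR_le1 oppr_le0 invr_ge0 mulrn_wge0 // ltW.
Qed.

Lemma newton_const_gt0 : 0 < newton_const.
Proof.
rewrite -lte_fin -integral_heat_profile.
(* A lower bound of the profile on ]1, 2]: the prefactor is smallest at t = 2, and the exponent -1 /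
   (2 t) stays above -1. *)
pose m : R := (Num.sqrt (2 * pi *+ 2))^-1 ^+ 3 * expR (- 1).
have m0 : 0 < m.
  rewrite mulr_gt0 ?expR_gt0 // exprn_gt0 // invr_gt0 sqrtr_gt0 mulrn_wgt0 //.
  by rewrite mulr_gt0 // pi_gt0.
have mf D : measurable_fun D (fun t : R => (heat_profile t)%:E).
  by apply: measurable_funTS; apply/measurable_EFinP; exact: measurable_heat_profile.
apply: (@lt_le_trans _ _ (\int[leb1]_(t in `]1%R, 2%R]) m%:E)%E).
  rewrite integral_cst //.
  change (0 < m%:E * @lebesgue_measure R `]1%R, 2%R])%E.
  rewrite lebesgue_measure_itv /= lte_fin ltr1n -EFinB lte_fin mulr_gt0 //; lra.
apply: (@le_trans _ _ (\int[leb1]_(t in `]1%R, 2%R]) (heat_profile (t : R))%:E)%E).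
  apply: ge0_le_integral => //.
  - by move=> t _; rewrite lee_fin ltW.
  - move=> t; rewrite /= in_itv /= => /andP[t1 t2]; rewrite lee_fin.
    have t0 : 0 < t by rewrite (lt_trans _ t1).
    have tp : 0 < t * pi *+ 2 by rewrite mulrn_wgt0 // mulr_gt0 // pi_gt0.
    have tp2 : t * pi *+ 2 <= 2 * pi *+ 2 by rewrite lerMn2r ler_wpM2r // pi_ge0.
    apply: ler_pM; rewrite ?expR_ge0 ?exprn_ge0 ?invr_ge0 ?sqrtr_ge0 //.
      rewrite lerXn2r ?nnegrE ?invr_ge0 ?sqrtr_ge0 //.
      by rewrite lef_pV2 ?posrE ?sqrtr_gt0 ?(lt_le_trans tp) // ler_wsqrtr.
    rewrite ler_expR lerN2 invf_le1 ?mulrn_wgt0 // -mulr_natr; lra.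
apply: ge0_subset_integral => //.
- by move=> t _; rewrite lee_fin heat_profile_ge0.
- move=> t; rewrite /= !in_itv /= andbT => /andP[t1 _]; exact: lt_trans t1.
Qed.

Lemma enorm3_gt0 x y : x != y -> 0 < enorm3 (x - y).
Proof.
move=> xy; rewrite /enorm3 sqrtr_gt0 lt_neqAle dot3_ge0 andbT eq_sym.
apply: contraNneq xy; rewrite /dot3 -!expr2 => /eqP.
rewrite !paddr_eq0 ?addr_ge0 ?sqr_ge0 // !sqrf_eq0 !subr_eq0.
move=> /andP[/andP[/eqP h1 /eqP h2] /eqP h3].
by case: x h1 h2 h3 => [[? ?] ?]; case: y => [[? ?] ?] /= -> -> ->.
Qed.

Lemma measurable_heatT x y T : 0 <= T ->
  measurable_fun setT (fun s : R => heat (T + Num.max s 0) x y).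
Proof.
move=> T0; apply: measurable_heat => //.
  by apply: measurable_funD => //; apply: measurable_maxr.
by move=> s; rewrite addr_ge0 // le_max lexx orbT.
Qed.

Lemma heat_le0 t x y : t <= 0 -> heat t x y = 0.
Proof.
move=> t0; rewrite /heat /gauss1 (_ : Num.sqrt _ = 0) ?invr0 ?mul0r //.
by apply/eqP; rewrite sqrtr_eq0 mulrn_wle0 // mulr_le0_ge0 // pi_ge0.
Qed.

Lemma measurable_heat_time x y : measurable_fun setT (fun s : R => heat s x y).
Proof.
rewrite (_ : (fun s : R => _) = (fun s => heat (0 + Num.max s 0) x y)).
  exact: measurable_heatT.
apply/funext => s; rewrite add0r; case: leP => // s0.
by rewrite heat_le0 // heat_le0.
Qed.

(** On the diagonal this is 0 rather than +oo. Kernel identities are therefore stated for x != y and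
    integrated off one point, which is null for Lebesgue measure and, later, for the surface
    measure. *)
Definition newton x y : R := (enorm3 (x - y))^-1.

Lemma heat_scaleT t x y : x != y ->
  heat t x y = (enorm3 (x - y))^-1 ^+ 3 * heat_profile (t / enorm3 (x - y) ^+ 2).
Proof.
move=> xy; have [t0|t0] := leP t 0; last exact: heat_scale.
rewrite heat_le0 // /heat_profile (_ : Num.sqrt _ = 0).
  by rewrite invr0 expr0n mul0r mulr0.
apply/eqP; rewrite sqrtr_eq0 mulrn_wle0 // mulr_le0_ge0 ?pi_ge0 //.
by rewrite mulr_le0_ge0 // invr_ge0 exprn_ge0 // enorm3_ge0.
Qed.

Lemma continuous_heat x y : x != y -> continuous (fun t : R => heat t x y).
Proof.
move=> xy t; rewrite (_ : (fun u : R => _) = (fun u =>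
  (enorm3 (x - y))^-1 ^+ 3 * heat_profile (u / enorm3 (x - y) ^+ 2))); last first.
  by apply/funext => u; exact: heat_scaleT.
apply: cvgMr; apply: (@continuous_comp _ _ _ (fun u : R => u / _)).
  by apply: cvgMl; exact: cvg_id.
exact: continuous_heat_profile.
Qed.

(** Substitute t = s d^2 with d = |x - y|: the heat kernel scales by d^-3 and dt by d^2, which
    leaves d^-1 times the integral at unit distance. *)
Lemma integral_heat_time x y : x != y ->
  (\int[leb1]_(t in `]0%R, +oo[) (heat (t : R) x y)%:E =
   (newton_const * newton x y)%:E)%E.
Proof.
move=> xy; have d0 := enorm3_gt0 xy; have hE t := heat_scaleT t xy.
rewrite /newton; set d := enorm3 _ in d0 hE *.
have d20 : 0 < d ^+ 2 by rewrite exprn_gt0.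
rewrite (@integral_affine (d ^+ 2) 0) //; first last.
- by move=> t; exact: heat_ge0.
- exact: measurable_heat_time.
- by move=> t _; exact: continuous_heat.
transitivity (\int[leb1]_(t in `]0%R, +oo[) (d^-1%:E * (heat_profile (t : R))%:E))%E.
  apply: eq_integral => t _; rewrite -EFinM hE addr0 mulfK ?gt_eqF //.
  by congr EFin; field; rewrite gt_eqF.
rewrite ge0_integralZl_EFin //.
- by rewrite integral_heat_profile -EFinM mulrC.
- by move=> t _; rewrite lee_fin heat_profile_ge0.
- by apply/measurable_EFinP; apply: measurable_funTS; exact: measurable_heat_profile.
- by rewrite invr_ge0 ltW.
Qed.

End NewtonKernelIntegrals.

Section HeatSemigroup.
Context {R : realType}.
Implicit Types (s t u T : R) (x y z w : R * R * R).

Lemma leb3_set1 y : leb3 [set y] = 0%E.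
Proof.
have -> : [set y] = ([set y.1.1] `*` [set y.1.2]) `*` [set y.2] :> set (R * R * R).
  apply/seteqP; split=> [_ ->//|[[a b] c] /= [[-> ->] ->]].
  by case: y => [[? ?] ?].
rewrite /leb3 prodm_setX //; last exact: measurableX.
rewrite [X in (_ * X)%E](_ : _ = 0%E) ?mule0 //.
exact: (lebesgue_measure_set1 y.2).
Qed.

Lemma measurable_set1_3 y : measurable [set y].
Proof.
have -> : [set y] = ([set y.1.1] `*` [set y.1.2]) `*` [set y.2] :> set (R * R * R).
  apply/seteqP; split=> [_ ->//|[[a b] c] /= [[-> ->] ->]].
  by case: y => [[? ?] ?].
by apply: measurableX => //; exact: measurableX.
Qed.

Lemma eq_integral_off (f g : R * R * R -> \bar R) y :
  measurable_fun setT f -> measurable_fun setT g ->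
  (forall x, 0 <= f x)%E -> (forall x, 0 <= g x)%E ->
  (forall x, x != y -> f x = g x) ->
  (\int[leb3]_x f x = \int[leb3]_x g x)%E.
Proof.
move=> mf mg f0 g0 fg; apply: ge0_ae_eq_integral => //.
exists [set y]; split; [exact: measurable_set1_3|exact: leb3_set1|].
by move=> x /= /not_implyP[_]; apply: contra_notP => /eqP xy; exact: fg.
Qed.

Lemma measurable_enorm3B d (U : measurableType d) (g h : U -> R * R * R) :
  measurable_fun setT g -> measurable_fun setT h ->
  measurable_fun setT (fun p => enorm3 (g p - h p)).
Proof.
move=> /measurable_coords[g1 g2 g3] /measurable_coords[h1 h2 h3].
apply: measurable_sqrtr; rewrite /dot3 /=.
by do !apply: measurable_funD; apply: measurable_funM; apply: measurable_funB.
Qed.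

Lemma measurable_newton d (U : measurableType d) (g h : U -> R * R * R) :
  measurable_fun setT g -> measurable_fun setT h ->
  measurable_fun setT (fun p => newton (g p) (h p)).
Proof.
move=> mg mh; apply: measurable_invr_ge0; first exact: measurable_enorm3B.
by move=> p; exact: enorm3_ge0.
Qed.

Lemma newton_ge0 x y : 0 <= newton x y.
Proof. by rewrite invr_ge0 enorm3_ge0. Qed.

Lemma newtonC x y : newton x y = newton y x.
Proof.
by rewrite /newton /enorm3 /dot3 /=; congr (Num.sqrt _)^-1; ring.
Qed.

Definition heat_over (D : set R) x y : \bar R :=
  (\int[leb1]_(t in D) (heat t x y)%:E)%E.

Lemma heat_over_ge0 D x y : (0 <= heat_over D x y)%E.
Proof. by apply: integral_ge0 => t _; rewrite lee_fin heat_ge0. Qed.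

Lemma heat_overE D x y :
  heat_over D x y = (\int[leb1]_t (heat t x y * \1_D t)%:E)%E.
Proof.
rewrite /heat_over integral_mkcond; apply: eq_integral => t _.
by rewrite patchE indicE; case: ifPn => _; rewrite ?mulr1 ?mulr0.
Qed.

Lemma measurable_heat_ind d (U : measurableType d) D (f : U -> R)
    (g h : U -> R * R * R) : measurable D ->
  measurable_fun setT f -> measurable_fun setT g -> measurable_fun setT h ->
  measurable_fun setT (fun p => heat (f p) (g p) (h p) * \1_D (f p)).
Proof.
move=> mD mf mg mh; apply: measurable_funM; last first.
  by apply: measurableT_comp mf; exact: measurable_indic.
rewrite (_ : (fun p => _) = fun p => heat (Num.max (f p) 0) (g p) (h p)).
  apply: measurable_heat => //; first exact: measurable_maxr.
  by move=> p; rewrite le_max lexx orbT.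
by apply/funext => p; case: leP => // f0; rewrite !heat_le0.
Qed.

Lemma measurable_heat_over d (U : measurableType d) D (g h : U -> R * R * R) :
  measurable D -> measurable_fun setT g -> measurable_fun setT h ->
  measurable_fun setT (fun p => heat_over D (g p) (h p)).
Proof.
move=> mD mg mh; under eq_fun do rewrite heat_overE.
pose f (p : U * R) := (heat p.2 (g p.1) (h p.1) * \1_D p.2)%:E.
apply: (@measurable_fun_fubini_tonelli_F _ _ _ _ _ leb1 f).
  apply/measurable_EFinP; apply: measurable_heat_ind => //.
  - exact: measurableT_comp mg measurable_fst.
  - exact: measurableT_comp mh measurable_fst.
by move=> p; rewrite lee_fin mulr_ge0 ?heat_ge0.
Qed.

(** Every spatial integral against a time-integrated kernel reduces to one at fixed t, where
    semigroup and Gaussian formulas apply. *)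
Lemma heat_over_tonelli D y (F : R * R * R -> R) : measurable D ->
  measurable_fun setT F -> (forall x, 0 <= F x) ->
  (\int[leb3]_x (heat_over D x y * (F x)%:E) =
   \int[leb1]_(t in D) \int[leb3]_x (heat t x y * F x)%:E)%E.
Proof.
move=> mD mF F0; pose f (p : (R * R * R) * R) :=
  (heat p.2 p.1 y * \1_D p.2 * F p.1)%:E.
have mf : measurable_fun setT f.
  apply/measurable_EFinP; apply: measurable_funM.
    exact: measurable_heat_ind.
  exact: measurableT_comp.
have f0 p : (0 <= f p)%E by rewrite lee_fin !mulr_ge0 ?heat_ge0.
transitivity (\int[leb3]_x \int[leb1]_t f (x, t))%E.
  apply: eq_integral => x _; rewrite heat_overE -ge0_integralZr //.
  - apply/measurable_EFinP; exact: measurable_heat_ind.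
  - by move=> t _; rewrite lee_fin mulr_ge0 ?heat_ge0.
  - by rewrite lee_fin.
transitivity (\int[leb1]_t \int[leb3]_x f (x, t))%E.
  exact: (fubini_tonelli f mf f0).
rewrite [RHS]integral_mkcond.
apply: eq_integral => t _; rewrite patchE /f /= indicE; case: ifPn => _.
  by under eq_integral do rewrite mulr1.
by under eq_integral do rewrite mulr0 mul0r; rewrite integral0.
Qed.

(* For t > 0 the heat flow moves newton_const * newton = heat_over ]0, oo[ to
   heat_over ]t, oo[, which is the whole point of the semigroup property. *)
Lemma integral_heat_newton t x y : 0 < t -> x != y ->
  (newton_const%:E * \int[leb3]_z (heat t x z * newton z y)%:E =
   heat_over `]t, +oo[ x y)%E.
Proof.
move=> t0 xy; have mh : measurable_fun setT (heat t x).
  by apply: measurable_heat => // _; exact: ltW.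
have c0 := ltW (@newton_const_gt0 R).
have mn : measurable_fun setT (fun z => heat t x z * newton z y).
  by apply: measurable_funM => //; exact: measurable_newton.
rewrite -ge0_integralZl_EFin //; last 2 first.
- by move=> z _; rewrite lee_fin mulr_ge0 ?heat_ge0 ?newton_ge0.
- exact/measurable_EFinP.
transitivity (\int[leb3]_z (heat_over `]0%R, +oo[ z y * (heat t x z)%:E))%E.
  apply: (@eq_integral_off _ _ y).
  - by apply/measurable_EFinP; apply: measurable_funM.
  - apply: emeasurable_funM; first exact: measurable_heat_over.
    exact/measurable_EFinP.
  - by move=> z; rewrite lee_fin !mulr_ge0 ?heat_ge0 ?newton_ge0.
  - by move=> z; rewrite mule_ge0 ?heat_over_ge0 // lee_fin heat_ge0.
  - move=> z zy; rewrite /heat_over integral_heat_time // -!EFinM.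
    by congr EFin; ring.
rewrite heat_over_tonelli //; last by move=> z; exact: heat_ge0.
rewrite /heat_over (@integral_affine _ 1 t) //; first last.
- by move=> u; exact: heat_ge0.
- exact: measurable_heat_time.
- by move=> u _; exact: continuous_heat.
apply: eq_integral => s; rewrite inE /= in_itv /= andbT => s0.
transitivity (heat (t + s) x y)%:E; last by rewrite !mulr1 addrC.
rewrite -(heat_conv x y s0 t0); apply: eq_integral => z _.
by rewrite mulrC.
Qed.

Lemma heat_over_cut_add T x y : 0 < T ->
  heat_over `]0%R, +oo[ x y =
  (heat_over `]0%R, T] x y + heat_over `]T, +oo[ x y)%E.
Proof.
move=> T0; have mf D : measurable_fun D (fun t : R => (heat t x y)%:E).
  by apply: measurable_funTS; apply/measurable_EFinP; exact: measurable_heat_time.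
have -> : `]0%R, +oo[%classic = `]0%R, T] `|` `]T, +oo[ :> set R.
  apply/seteqP; split=> t; rewrite /= !in_itv /= !andbT.
    by case: (leP t T) => t1 t0; [left; rewrite t0|right].
  by case=> [/andP[]//|]; exact: lt_trans.
rewrite /heat_over ge0_integral_setU //=.
- by move=> t _; rewrite lee_fin heat_ge0.
- apply/disj_setPS => t /=; rewrite !in_itv /= andbT => -[/andP[_ t1] t2].
  by have := le_lt_trans t1 t2; rewrite ltxx.
Qed.

(** The kernel r_T with its constant fixed: dividing by [newton_const] makes it equal to [newton]
    minus its heat average off the diagonal, and gives it the total mass T / [newton_const]. On the
    diagonal the time integral diverges and [fine] turns it into 0. *)
Definition heat_cut T x y : R := fine (heat_over `]0%R, T] x y) / newton_const.

Lemma heat_cut_ge0 T x y : 0 <= heat_cut T x y.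
Proof.
by rewrite mulr_ge0 ?fine_ge0 ?heat_over_ge0 // invr_ge0 ltW // newton_const_gt0.
Qed.

Lemma measurable_heat_cut d (U : measurableType d) T (g h : U -> R * R * R) :
  measurable_fun setT g -> measurable_fun setT h ->
  measurable_fun setT (fun p => heat_cut T (g p) (h p)).
Proof.
move=> mg mh; apply: measurable_funM => //.
by apply: measurableT_comp => //; exact: measurable_heat_over.
Qed.

Lemma heat_overE_cut T x y : 0 < T -> x != y ->
  heat_over `]0%R, T] x y = (newton_const * heat_cut T x y)%:E.
Proof.
move=> T0 xy; rewrite /heat_cut mulrC divfK ?gt_eqF ?newton_const_gt0 //.
rewrite fineK // ge0_fin_numE ?heat_over_ge0 //.
have := heat_over_cut_add x y T0; rewrite [in LHS]/heat_over integral_heat_time //.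
move=> e; apply: (@le_lt_trans _ _ (newton_const * newton x y)%:E).
  by rewrite e leeDl // heat_over_ge0.
by rewrite ltry.
Qed.

Lemma integral_heat_newtonE T x y : 0 < T -> x != y ->
  (\int[leb3]_z (heat T x z * newton z y)%:E =
   (newton x y - heat_cut T x y)%:E)%E.
Proof.
move=> T0 xy; have c0 := @newton_const_gt0 R.
have := heat_over_cut_add x y T0; rewrite [in LHS]/heat_over integral_heat_time //.
rewrite heat_overE_cut // -integral_heat_newton //.
set I := (\int[leb3]_z _)%E.
have : (0 <= I)%E by apply: integral_ge0 => z _; rewrite lee_fin mulr_ge0 ?heat_ge0 ?newton_ge0.
(* An infinite I is excluded because the sum it occurs in is the finite number [newton_const] *
   [newton x y]. *)
case: I => [a| |] // _; last by rewrite mulry gtr0_sg // mul1e addey.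
rewrite -EFinM -EFinD => -[] e; congr EFin.
by apply: (mulfI (lt0r_neq0 c0)); rewrite mulrBr e; ring.
Qed.

Lemma integral_heat_newton_le T x y : 0 < T -> x != y ->
  (\int[leb3]_z (heat T x z * newton z y)%:E <= (newton x y)%:E)%E.
Proof.
by move=> T0 xy; rewrite integral_heat_newtonE // lee_fin lerBlDr lerDl heat_cut_ge0.
Qed.

Let integral_heat_cut_tonelli T y (F : R * R * R -> R) : 0 < T ->
  measurable_fun setT F -> (forall x, 0 <= F x) ->
  (\int[leb3]_x (heat_cut T x y * F x)%:E =
   newton_const^-1%:E *
     \int[leb1]_(t in `]0%R, T]) \int[leb3]_x (heat t x y * F x)%:E)%E.
Proof.
move=> T0 mF F0; have c0 := @newton_const_gt0 R.
have mo : measurable_fun setT (fun x => heat_over `]0%R, T] x y * (F x)%:E)%E.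
  by apply: emeasurable_funM; [exact: measurable_heat_over|exact/measurable_EFinP].
rewrite -heat_over_tonelli // -ge0_integralZl_EFin //; last 2 first.
- by move=> x _; rewrite mule_ge0 ?heat_over_ge0 ?lee_fin.
- by rewrite invr_ge0 ltW.
apply: (@eq_integral_off _ _ y).
- by apply/measurable_EFinP; apply: measurable_funM => //; exact: measurable_heat_cut.
- by apply: emeasurable_funM.
- by move=> x; rewrite lee_fin mulr_ge0 ?heat_cut_ge0.
- by move=> x; rewrite !mule_ge0 ?heat_over_ge0 ?lee_fin // invr_ge0 ltW.
- move=> x xy; rewrite heat_overE_cut // -!EFinM; congr EFin.
  by field; rewrite gt_eqF.
Qed.

Let integral_itv_cst T (c : R) : 0 < T ->
  (\int[leb1]_(t in `]0%R, T]) c%:E = (T * c)%:E)%E.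
Proof.
move=> T0; rewrite integral_cst //.
change (c%:E * @lebesgue_measure R `]0%R, T] = (T * c)%:E)%E.
by rewrite lebesgue_measure_itv /= lte_fin T0 oppr0 adde0 -EFinM mulrC.
Qed.

Lemma integral_heat_cut T y : 0 < T ->
  (\int[leb3]_x (heat_cut T x y)%:E = (T / newton_const)%:E)%E.
Proof.
move=> T0; transitivity (\int[leb3]_x (heat_cut T x y * cst 1 x)%:E)%E.
  by apply: eq_integral => x _; rewrite mulr1.
rewrite integral_heat_cut_tonelli // mulrC EFinM; congr (_ * _)%E.
rewrite -[X in _ = X%:E]mulr1 -integral_itv_cst //; apply: eq_integral => t.
rewrite inE /= in_itv /= => /andP[t0 _]; rewrite -(integral_heat y t0).
by apply: eq_integral => x _; rewrite mulr1 heatC.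
Qed.

Let integral_heat_cut_le T y (F : R * R * R -> R) (c : R) : 0 < T ->
  measurable_fun setT F -> (forall x, 0 <= F x) ->
  (forall t, 0 < t <= T -> (\int[leb3]_x (heat t x y * F x)%:E <= c%:E)%E) ->
  (\int[leb3]_x (heat_cut T x y * F x)%:E <= (T / newton_const * c)%:E)%E.
Proof.
move=> T0 mF F0 Fc; rewrite integral_heat_cut_tonelli //.
have -> : T / newton_const * c = newton_const^-1 * (T * c) by ring.
rewrite EFinM lee_wpmul2l ?lee_fin ?invr_ge0 ?(ltW (@newton_const_gt0 R)) //.
rewrite -integral_itv_cst //; apply: ge0_le_integral => //.
- by move=> t _; apply: integral_ge0 => x _; rewrite lee_fin mulr_ge0 ?heat_ge0.
- pose f (p : R * (R * R * R)) := (heat p.1 p.2 y * \1_`]0%R, T] p.1 * F p.2)%:E.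
  apply: (eq_measurable_fun (fun t => \int[leb3]_x f (t, x))%E).
    move=> t; rewrite inE => tT; apply: eq_integral => x _.
    by rewrite /f /= indicE mem_set // mulr1.
  apply: measurable_funTS; apply: (@measurable_fun_fubini_tonelli_F _ _ _ _ _ leb3 f).
    apply/measurable_EFinP; apply: measurable_funM; last exact: measurableT_comp.
    exact: measurable_heat_ind.
  by move=> p; rewrite lee_fin !mulr_ge0 ?heat_ge0.
Qed.

(** Superharmonicity of the Newton kernel: for each t its heat average at y is at most its value at
    y; integrate this over 0 < t <= T. *)
Lemma integral_heat_cut_newton T y w : 0 < T -> y != w ->
  (\int[leb3]_x (heat_cut T x y * newton x w)%:E <=
   (T / newton_const * newton y w)%:E)%E.
Proof.
move=> T0 yw; apply: integral_heat_cut_le => //.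
- exact: measurable_newton.
- by move=> x; exact: newton_ge0.
- move=> t /andP[t0 _]; apply: le_trans (integral_heat_newton_le t0 yw).
  by under eq_integral do rewrite heatC.
Qed.

(** Half of the exponent pays for the factor d = |x - y|. With v = d^2 / (4 t) the exponent is -2 v
    and d = 2 sqrt t sqrt v, where sqrt v e^-v <= 1; what is left is the kernel at time 2 t up to
    its prefactor, which changes by 2^(3/2) <= 8. Hence 16 = 8 * 2. *)
Let heat_dist_le t x y : 0 < t ->
  heat t x y * enorm3 (x - y) <= 16 * Num.sqrt t * heat (2 * t) x y.
Proof.
move=> t0; have t20 : 0 < 2 * t by rewrite mulr_gt0.
rewrite !heatE //; set d := enorm3 _; have d0 : 0 <= d := enorm3_ge0 _.
set a := (Num.sqrt (t * pi *+ 2))^-1; set b := (Num.sqrt (2 * t * pi *+ 2))^-1.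
have tp : 0 < t * pi *+ 2 by rewrite mulrn_wgt0 // mulr_gt0 // pi_gt0.
have ab : a <= 2 * b.
  have bE : 2 * t * pi *+ 2 = 2 * (t * pi *+ 2) by ring.
  rewrite /a /b bE sqrtrM // invfM mulrA ler_peMl //.
  rewrite ler_pdivlMr ?sqrtr_gt0 // mul1r -[leRHS]ger0_norm // -sqrtr_sqr.
  by rewrite ler_wsqrtr // expr2; lra.
have a0 : 0 <= a by rewrite invr_ge0 sqrtr_ge0.
have b0 : 0 <= b by rewrite invr_ge0 sqrtr_ge0.
have a3 : a ^+ 3 <= 8 * b ^+ 3.
  have -> : 8 * b ^+ 3 = (2 * b) ^+ 3 by ring.
  by rewrite lerXn2r ?nnegrE // mulr_ge0.
pose v := d ^+ 2 / (2 * t *+ 2).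
have v0 : 0 <= v by rewrite divr_ge0 ?exprn_ge0 // mulrn_wge0 // ltW.
have -> : - d ^+ 2 / (t *+ 2) = - v + - v by rewrite /v; field; rewrite gt_eqF.
have -> : - d ^+ 2 / (2 * t *+ 2) = - v by rewrite mulNr.
have dE : d = 2 * Num.sqrt t * Num.sqrt v.
  apply: (@pexpIrn _ 2) => //; rewrite ?nnegrE ?mulr_ge0 ?sqrtr_ge0 //.
  have tE := sqr_sqrtr (ltW t0); have vE := sqr_sqrtr v0.
  rewrite exprMn vE exprMn tE /v.
  by field; rewrite gt_eqF.
have sv : Num.sqrt v * expR (- v) <= 1.
  rewrite expRN ler_pdivrMr ?expR_gt0 // mul1r.
  apply: (le_trans _ (expR_ge1Dx v)).
  have := sqr_ge0 (Num.sqrt v - 1); have := sqr_sqrtr v0; have := sqrtr_ge0 v.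
  by set q := Num.sqrt v; nra.
rewrite expRD [X in _ * X <= _]dE.
have e0 : 0 <= expR (- v) by exact: expR_ge0.
have -> : a ^+ 3 * (expR (- v) * expR (- v)) * (2 * Num.sqrt t * Num.sqrt v) =
  (a ^+ 3 * (2 * Num.sqrt t * expR (- v))) * (Num.sqrt v * expR (- v)) by ring.
have -> : 16 * Num.sqrt t * (b ^+ 3 * expR (- v)) =
  (8 * b ^+ 3) * (2 * Num.sqrt t * expR (- v)) * 1 by ring.
have st0 := sqrtr_ge0 t.
apply: ler_pM => //.
- by rewrite mulr_ge0 ?exprn_ge0 // !mulr_ge0.
- by rewrite ler_wpM2r // !mulr_ge0.
Qed.

(** Concentration at scale sqrt T: the first moment of r_T is its mass times O(sqrt T). *)
Lemma integral_heat_cut_dist T y : 0 < T ->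
  (\int[leb3]_x (heat_cut T x y * enorm3 (x - y))%:E <=
   (T / newton_const * (16 * Num.sqrt T))%:E)%E.
Proof.
move=> T0; have me : measurable_fun setT (fun x => enorm3 (x - y)).
  exact: measurable_enorm3B.
apply: integral_heat_cut_le => //; first by move=> x; exact: enorm3_ge0.
move=> t /andP[t0 tT]; have t20 : 0 < 2 * t by rewrite mulr_gt0.
apply: (@le_trans _ _ (\int[leb3]_x ((16 * Num.sqrt t)%:E * (heat (2 * t) x y)%:E))%E).
  apply: ge0_le_integral => //.
  - by move=> x _; rewrite lee_fin mulr_ge0 ?heat_ge0 ?enorm3_ge0.
  - apply/measurable_EFinP; apply: measurable_funM => //.
    by apply: measurable_heat => // _; exact: ltW.
  - apply/measurable_EFinP; apply: measurable_funM => //.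
    by apply: measurable_heat => // _; exact: ltW.
  - by move=> x _; rewrite -EFinM lee_fin; exact: heat_dist_le.
rewrite ge0_integralZl_EFin //; first last.
- apply/measurable_EFinP; apply: measurable_heat => // _; exact: ltW.
- by move=> x _; rewrite lee_fin heat_ge0.
under eq_integral do rewrite heatC.
by rewrite integral_heat // mule1 lee_fin ler_wpM2l // ler_wsqrtr.
Qed.

End HeatSemigroup.

(** * Oscillation of the Newton kernel under r_T *)

Section Oscillation.
Context {R : realType}.
Implicit Types x y z w : R * R * R.

Lemma enorm3C x y : enorm3 (x - y) = enorm3 (y - x).
Proof. by rewrite /enorm3 /dot3 /=; congr Num.sqrt; ring. Qed.

Lemma dot3_le x y : dot3 x y <= enorm3 x * enorm3 y.
Proof.
rewrite (le_trans (ler_norm _)) // -(ler_pXn2r (ltn0Sn 1)) ?nnegrE //; last first.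
  by rewrite mulr_ge0 ?enorm3_ge0.
rewrite exprMn !enorm3_sqr real_normK ?num_real // /dot3.
case: x y => [[a b] c] [[a' b'] c'] /=; rewrite -subr_ge0.
set e := (X in 0 <= X).
(* Lagrange's identity: the defect in Cauchy-Schwarz is the squared length of the cross product. *)
have -> : e = (a * b' - b * a') ^+ 2 + (a * c' - c * a') ^+ 2 + (b * c' - c * b') ^+ 2.
  by rewrite /e; ring.
by rewrite !addr_ge0 ?sqr_ge0.
Qed.

Lemma enorm3_triangle x y z : enorm3 (x - z) <= enorm3 (x - y) + enorm3 (y - z).
Proof.
rewrite -(ler_pXn2r (ltn0Sn 1)) ?nnegrE ?addr_ge0 ?enorm3_ge0 //.
rewrite sqrrD !enorm3_sqr; have := dot3_le (x - y) (y - z).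
rewrite -mulr_natr; set p := enorm3 _ * enorm3 _; rewrite /dot3 /=; nra.
Qed.

Lemma enorm3_ge_coord x :
  [/\ `|x.1.1| <= enorm3 x, `|x.1.2| <= enorm3 x & `|x.2| <= enorm3 x].
Proof.
have h (a : R) : a ^+ 2 <= dot3 x x -> `|a| <= enorm3 x.
  by move=> ax; rewrite -sqrtr_sqr ler_wsqrtr.
have := sqr_ge0 x.1.1; have := sqr_ge0 x.1.2; have := sqr_ge0 x.2.
by rewrite !expr2 => h1 h2 h3; split; apply: h; rewrite /dot3 expr2; lra.
Qed.

Lemma newton_diag x : newton x x = 0.
Proof.
by rewrite /newton /enorm3 /dot3 /= !subrr !mul0r !addr0 sqrtr0 invr0.
Qed.

(** One-sided on purpose. The left side is positive at x != w only if x is farther from w than y,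
    and then 1 / (|x - w| |y - w|) <= 1 / |y - w|^2, so the bound sees the kernel at y alone. At x =
    w the default value 0 of the kernel gives equality. *)
Lemma newton_sub_le x y w : y != w ->
  newton y w - newton x w <= enorm3 (x - y) * newton y w ^+ 2.
Proof.
move=> yw; have b0 := enorm3_gt0 yw; have [->|xw] := eqVneq x w.
  rewrite newton_diag subr0 /newton (enorm3C w) expr2 mulrA divff ?mul1r //.
  by rewrite gt_eqF.
have a0 := enorm3_gt0 xw; rewrite /newton.
have := enorm3_triangle x y w; have := enorm3_ge0 (x - y).
set b := enorm3 (y - w) in b0 *; set a := enorm3 (x - w) in a0 *.
set d := enorm3 _ => d0 tri.
have -> : b^-1 - a^-1 = (a - b) / (a * b) by field; rewrite !gt_eqF.
have -> : d * b^-1 ^+ 2 = d / (b * b) by field; rewrite gt_eqF.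
have [ab|ab] := leP a b.
  apply: (@le_trans _ _ 0); last by rewrite divr_ge0 // mulr_ge0 // ltW.
  by rewrite mulr_le0_ge0 ?subr_le0 // invr_ge0 mulr_ge0 // ltW.
apply: (@le_trans _ _ (d / (a * b))).
  by rewrite ler_wpM2r ?invr_ge0 ?mulr_ge0 // ?(ltW a0) ?(ltW b0) //; lra.
rewrite ler_wpM2l // lef_pV2 ?posrE ?mulr_gt0 // ler_wpM2r // ?(ltW b0) //.
exact: ltW.
Qed.

(* |a - b| + b = a + 2 (b - a)^+ turns superharmonicity, which controls the
   heat average of a = newton x w by b = newton y w, into an oscillation bound. *)
Lemma heat_cut_oscillation T y w : 0 < T -> y != w ->
  (\int[leb3]_x (heat_cut T x y * `|newton x w - newton y w|)%:E <=
   (T / newton_const *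
     Num.min (2 * newton y w) (32 * Num.sqrt T * newton y w ^+ 2))%:E)%E.
Proof.
move=> T0 yw; have c0 := @newton_const_gt0 R.
set a := fun x => newton x w; set b := newton y w.
have ma : measurable_fun setT a by exact: measurable_newton.
have mh : measurable_fun setT (fun x => heat_cut T x y) by exact: measurable_heat_cut.
have b0 : 0 <= b by exact: newton_ge0.
have a0 x : 0 <= a x by exact: newton_ge0.
have h0 x := heat_cut_ge0 T x y.
pose p x := Num.max (b - a x) 0.
have p0 x : 0 <= p x by rewrite le_max lexx orbT.
have mp : measurable_fun setT p by apply: measurable_maxr => //; exact: measurable_funB.
have mab : measurable_fun setT (fun x => `|a x - b|).
  by apply: measurableT_comp => //; exact: measurable_funB.
have Ic (c : R) : 0 <= c ->
    (\int[leb3]_x (heat_cut T x y * c)%:E = (T / newton_const * c)%:E)%E.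
  move=> c1; under eq_integral do rewrite EFinM.
  rewrite ge0_integralZr //; first by rewrite integral_heat_cut // EFinM.
  - exact/measurable_EFinP.
  - by move=> x _; rewrite lee_fin.
have ID (f g : R * R * R -> R) : measurable_fun setT f -> measurable_fun setT g ->
    (forall x, 0 <= f x) -> (forall x, 0 <= g x) ->
    (\int[leb3]_x (heat_cut T x y * (f x + g x))%:E =
     \int[leb3]_x (heat_cut T x y * f x)%:E +
     \int[leb3]_x (heat_cut T x y * g x)%:E)%E.
  move=> mf mg f0 g0; under eq_integral do rewrite mulrDr EFinD.
  rewrite ge0_integralD //.
  - by move=> x _; rewrite lee_fin mulr_ge0.
  - by apply/measurable_EFinP; apply: measurable_funM.
  - by move=> x _; rewrite lee_fin mulr_ge0.
  - by apply/measurable_EFinP; apply: measurable_funM.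
have osc : (\int[leb3]_x (heat_cut T x y * `|a x - b|)%:E <=
    \int[leb3]_x (heat_cut T x y * (2 * p x))%:E)%E.
  rewrite -(@leeD2rE _ (T / newton_const * b)%:E) // -Ic // -ID //.
  apply: (@le_trans _ _ (\int[leb3]_x (heat_cut T x y * (2 * p x + a x))%:E)%E).
    apply: ge0_le_integral => //.
    - by move=> x _; rewrite lee_fin mulr_ge0 // addr_ge0.
    - by apply/measurable_EFinP; apply: measurable_funM => //; exact: measurable_funD.
    - apply/measurable_EFinP; apply: measurable_funM => //.
      by apply: measurable_funD => //; exact: measurable_funM.
    - move=> x _; rewrite lee_fin ler_wpM2l // /p.
      by case: (leP (b - a x) 0) => h; case: (ler0P (a x - b)) => h'; lra.
  rewrite ID //; last 2 first.
  - exact: measurable_funM.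
  - by move=> x; rewrite mulr_ge0.
  by rewrite Ic // leeD2l // integral_heat_cut_newton.
(* The two entries of the minimum come from (b - a)^+ <= b and from (b - a)^+ <= |x - y| b^2 with
   the first moment of r_T; 32 is 2 * 16. *)
rewrite minr_pMr ?divr_ge0 ?(ltW T0) ?(ltW c0) // EFin_min lexI.
apply/andP; split; apply: (le_trans osc).
  rewrite -Ic ?mulr_ge0 //; apply: ge0_le_integral => //.
  - by move=> x _; rewrite lee_fin; apply: mulr_ge0 => //; exact: mulr_ge0.
  - by apply/measurable_EFinP; apply: measurable_funM => //; exact: measurable_funM.
  - by apply/measurable_EFinP; apply: measurable_funM.
  - move=> x _; rewrite lee_fin !ler_wpM2l // /p ge_max; apply/andP; split => //.
    by rewrite gerBl.
apply: (@le_trans _ _ (\int[leb3]_x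
    (heat_cut T x y * enorm3 (x - y) * (2 * b ^+ 2))%:E)%E).
  apply: ge0_le_integral => //.
  - by move=> x _; rewrite lee_fin; apply: mulr_ge0 => //; exact: mulr_ge0.
  - by apply/measurable_EFinP; apply: measurable_funM => //; exact: measurable_funM.
  - apply/measurable_EFinP; apply: measurable_funM => //.
    by apply: measurable_funM => //; exact: measurable_enorm3B.
  - move=> x _; rewrite lee_fin -mulrA ler_wpM2l // [leRHS]mulrC -mulrA ler_wpM2l //.
    rewrite [leRHS]mulrC /p ge_max newton_sub_le //=.
    by rewrite mulr_ge0 ?enorm3_ge0 ?exprn_ge0.
under eq_integral do rewrite EFinM.
rewrite ge0_integralZr //; first last.
- by rewrite lee_fin mulr_ge0 ?exprn_ge0.
- by move=> x _; rewrite lee_fin mulr_ge0 ?enorm3_ge0.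
- by apply/measurable_EFinP; apply: measurable_funM => //; exact: measurable_enorm3B.
have -> : T / newton_const * (32 * Num.sqrt T * b ^+ 2) =
  T / newton_const * (16 * Num.sqrt T) * (2 * b ^+ 2) by ring.
rewrite [leRHS]EFinM lee_wpmul2r ?integral_heat_cut_dist //.
by rewrite lee_fin mulr_ge0 ?exprn_ge0.
Qed.

End Oscillation.

(** * Newton potentials of finite measures *)

Lemma ae_lty d (T : measurableType d) (R : realType) (nu : {measure set T -> \bar R}) (D : set T)
    (f : T -> \bar R) : measurable D -> measurable_fun D f ->
  (forall x, D x -> (0 <= f x)%E) -> (\int[nu]_(x in D) f x < +oo)%E ->
  {ae nu, forall x, D x -> (f x < +oo)%E}.
Proof.
move=> mD mf f0 fy; have : nu.-integrable D f.
  apply/integrableP; split => //; under eq_integral => x Dx.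
    rewrite gee0_abs; last by apply: f0; rewrite inE in Dx.
    over.
  by [].
move=> /(integrable_ae mD); apply: filterS => x fx Dx.
by have := fx Dx; rewrite ge0_fin_numE // f0.
Qed.

Section Potential.
Context {R : realType}.
Local Notation X := (R * R * R)%type.
Implicit Types (x y z w : X) (phi : X -> R).

Definition box (r : R) : set X :=
  (`[- r, r]%classic `*` `[- r, r]%classic) `*` `[- r, r]%classic.

Lemma measurable_box r : measurable (box r).
Proof. by apply: measurableX => //; exact: measurableX. Qed.

Lemma boxP r x : box r x <-> [/\ `|x.1.1| <= r, `|x.1.2| <= r & `|x.2| <= r].
Proof.
rewrite /box /= !in_itv /= -!ler_norml; split=> [[[]]//|[]//].
Qed.

Lemma box_cover : \bigcup_n box n%:R = [set: X].
Proof.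
apply/seteqP; split=> // x _.
pose m := Num.max `|x.1.1| (Num.max `|x.1.2| `|x.2|).
have [n mn] : exists n : nat, m <= n%:R.
  exists (Num.Def.archi_bound m); rewrite ltW // archi_boundP //.
  by rewrite !le_max normr_ge0.
exists n => //; apply/boxP; move: mn; rewrite /m !ge_max.
by move=> /andP[? /andP[]].
Qed.

Variable mu : {finite_measure set X -> \bar R}.

Definition sqint phi :=
  measurable_fun setT phi /\ (\int[mu]_y (phi y ^+ 2)%:E < +oo)%E.

Definition pot phi x : R := fine (\int[mu]_y (newton x y * phi y)%:E)%E.

(** Finite exactly where the integral behind [pot] converges absolutely; pointwise statements about
    [pot] are restricted to such x. *)
Definition apot phi x : \bar R := (\int[mu]_y (newton x y * `|phi y|)%:E)%E.

Lemma sqint_norm1 phi : sqint phi -> (\int[mu]_y `|phi y|%:E < +oo)%E.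
Proof.
move=> [mphi phi2]; have mn : measurable_fun setT (fun y => `|phi y|).
  exact: measurableT_comp.
apply: (@le_lt_trans _ _ (\int[mu]_y (1 + (phi y ^+ 2)%:E))%E).
  apply: ge0_le_integral => //.
  - exact/measurable_EFinP.
  - by apply: emeasurable_funD => //; apply/measurable_EFinP; exact: measurable_funX.
  - move=> y _; rewrite -EFinD lee_fin -[X in _ <= 1 + X]real_normK ?num_real //.
    by have := sqr_ge0 (`|phi y| - 1); nra.
rewrite ge0_integralD //; last 2 first.
- by move=> y _; rewrite lee_fin sqr_ge0.
- by apply/measurable_EFinP; exact: measurable_funX.
rewrite lte_add_pinfty // integral_cst // mul1e ltey_eq.
by rewrite fin_num_measure.
Qed.

Lemma apot_ge0 phi x : (0 <= apot phi x)%E.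
Proof. by apply: integral_ge0 => y _; rewrite lee_fin mulr_ge0 ?newton_ge0. Qed.

Lemma measurable_apot phi : measurable_fun setT phi -> measurable_fun setT (apot phi).
Proof.
move=> mphi; pose f (p : X * X) := (newton p.1 p.2 * `|phi p.2|)%:E.
apply: (@measurable_fun_fubini_tonelli_F _ _ _ _ _ mu f).
  apply/measurable_EFinP; apply: measurable_funM.
    by apply: measurable_newton.
  by apply: measurableT_comp => //; exact: measurableT_comp.
by move=> p; rewrite lee_fin mulr_ge0 ?newton_ge0.
Qed.

Lemma measurable_pot phi : measurable_fun setT phi -> measurable_fun setT (pot phi).
Proof.
move=> mphi; apply: measurableT_comp => //.
pose f (p : X * X) := (newton p.1 p.2 * phi p.2)%:E.
have mf : measurable_fun setT f.
  apply/measurable_EFinP; apply: measurable_funM; first exact: measurable_newton.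
  exact: measurableT_comp.
rewrite (_ : (fun x => _) = (fun x => \int[mu]_y (f^\+ (x, y)) -
    \int[mu]_y (f^\- (x, y)))%E).
  apply: emeasurable_funB.
    apply: (@measurable_fun_fubini_tonelli_F _ _ _ _ _ mu f^\+%E) => //.
    exact: measurable_funepos.
  apply: (@measurable_fun_fubini_tonelli_F _ _ _ _ _ mu f^\-%E) => //.
  exact: measurable_funeneg.
apply/funext => x; rewrite [LHS]integralE; congr (_ - _)%E.
  by apply: eq_integral => y _; rewrite !funeposE.
by apply: eq_integral => y _; rewrite !funenegE.
Qed.

(** Tonelli, with a second measure nu in the variable x. Taking nu = [mu], and then Lebesgue measure
    on a box, shows that [apot] is finite almost everywhere for both measures. *)
Lemma integral_apot_le (nu : {sigma_finite_measure set X -> \bar R}) (D : set X)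
    (c : R) phi : measurable D -> measurable_fun setT phi ->
  (forall y, (\int[nu]_(x in D) (newton x y)%:E <= c%:E)%E) ->
  (\int[nu]_(x in D) apot phi x <= c%:E * \int[mu]_y `|phi y|%:E)%E.
Proof.
move=> mD mphi Dc; have mn : measurable_fun setT (fun y => `|phi y|).
  exact: measurableT_comp.
pose f (p : X * X) := (newton p.1 p.2 * `|phi p.2| * \1_D p.1)%:E.
have mf : measurable_fun setT f.
  apply/measurable_EFinP; apply: measurable_funM; first apply: measurable_funM.
  - exact: measurable_newton.
  - exact: (measurableT_comp mn measurable_snd).
  - apply: measurableT_comp measurable_fst; exact: measurable_indic.
have f0 p : (0 <= f p)%E by rewrite lee_fin !mulr_ge0 ?newton_ge0.
have -> : (\int[nu]_(x in D) apot phi x = \int[nu]_x \int[mu]_y f (x, y))%E.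
  rewrite integral_mkcond; apply: eq_integral => x _.
  rewrite patchE /f /= indicE; case: ifPn => _.
    by apply: eq_integral => y _; rewrite mulr1.
  by under eq_integral do rewrite mulr0; rewrite integral0.
rewrite (fubini_tonelli f mf f0) -ge0_integralZl //; last 2 first.
- exact/measurable_EFinP.
- apply: le_trans (Dc (0, 0, 0)); apply: integral_ge0 => x _.
  by rewrite lee_fin newton_ge0.
apply: ge0_le_integral => //.
- by move=> y _; apply: integral_ge0 => x _.
- exact: (@measurable_fun_fubini_tonelli_G _ _ _ _ _ nu f mf f0).
- by apply: emeasurable_funM => //; exact/measurable_EFinP.
move=> y _; have -> : (\int[nu]_x f (x, y) =
    \int[nu]_(x in D) (newton x y)%:E * `|phi y|%:E)%E.
  rewrite -ge0_integralZr //; last 2 first.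
  - by apply/measurable_EFinP; apply: measurable_funTS; exact: measurable_newton.
  - by move=> x _; rewrite lee_fin newton_ge0.
  rewrite integral_mkcond; apply: eq_integral => x _.
  by rewrite patchE /f /= indicE; case: ifPn => _; rewrite ?mulr1 ?mulr0.
by rewrite lee_wpmul2r ?lee_fin.
Qed.

Section Bounded.
Variable M : R.
Hypothesis newton_bound : forall x, (\int[mu]_y (newton x y)%:E <= M%:E)%E.

Lemma apot_ae phi : sqint phi -> {ae mu, forall x, (apot phi x < +oo)%E}.
Proof.
move=> phi2; have [mphi _] := phi2.
have h : (\int[mu]_(x in setT) apot phi x < +oo)%E.
  apply: le_lt_trans (@integral_apot_le mu setT M phi measurableT mphi _) _.
    by move=> y; under eq_integral do rewrite newtonC.
  rewrite lte_mul_pinfty ?sqint_norm1 // (le_trans _ (newton_bound (0,0,0))) //.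
  by apply: integral_ge0 => y _; rewrite lee_fin newton_ge0.
have := ae_lty measurableT (measurable_apot mphi) (fun x _ => apot_ge0 phi x) h.
by apply: filterS => x; exact.
Qed.

End Bounded.

End Potential.

(** * Uniform bounds on the potential of measures with quadratic growth *)

Section NewtonPotentialBound.
Context {R : realType}.
Local Notation X := (R * R * R)%type.
Implicit Types (x y z w : X).

Definition eball x (r : R) : set X := [set y | enorm3 (x - y) <= r].

Lemma measurable_eball x r : measurable (eball x r).
Proof.
have mf : measurable_fun setT (fun y => enorm3 (x - y)) by exact: measurable_enorm3B.
rewrite -[eball x r]setTI (_ : eball x r = (fun y => enorm3 (x - y)) @^-1` `]-oo, r]).
  exact: mf.
by apply/seteqP; split=> y; rewrite /= in_itv.
Qed.

(** If 1/|x - y| > 1, it lies in [2^n, 2^(n+1)] for some n; then y is in the ball of radius 2^-n and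
    the n-th term alone dominates. *)
Lemma newton_dyadic_le x y :
  ((newton x y)%:E <= 1 + \sum_(n <oo) (2 ^+ n.+1 * \1_(eball x (2 ^- n)) y)%:E)%E.
Proof.
have S0 : (0 <= \sum_(n <oo) ((2 : R) ^+ n.+1 * \1_(eball x (2 ^- n)) y)%:E)%E.
  by apply: nneseries_ge0 => n _ _; rewrite lee_fin mulr_ge0 // exprn_ge0.
have [n1|n1] := leP (newton x y) 1.
  by apply: (@le_trans _ _ 1%E); rewrite ?lee_fin // leeDl.
have n0 : 0 < newton x y by rewrite (lt_trans _ n1).
set N := Num.truncn (newton x y).
have N0 : (0 < N)%N by rewrite /N truncn_gt0 ltW.
pose n := trunc_log 2 N.
have /andP[nN Nn] := trunc_log_bounds (ltnSn 1) N0.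
have le1 : 2 ^+ n <= newton x y.
  apply: (@le_trans _ _ N%:R); first by rewrite -natrX ler_nat.
  by rewrite truncn_le ltW.
have le2 : newton x y <= 2 ^+ n.+1.
  rewrite ltW // (lt_le_trans (truncnS_gt _)) // -natrX ler_nat.
  exact: Nn.
apply: (@le_trans _ _ (\sum_(n <oo) ((2 : R) ^+ n.+1 * \1_(eball x (2 ^- n)) y)%:E)%E); last first.
  by rewrite leeDr // lee_fin.
apply: (@le_trans _ _ (\sum_(0 <= i < n.+1) ((2 : R) ^+ i.+1 * \1_(eball x (2 ^- i)) y)%:E)%E); last first.
  apply: nneseries_lim_ge => i _ _.
  by rewrite lee_fin mulr_ge0 // exprn_ge0.
rewrite big_nat_recr //=; apply: (@le_trans _ _ ((2 : R) ^+ n.+1 * \1_(eball x (2 ^- n)) y)%:E); last first.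
  rewrite leeDr //; apply: sume_ge0 => i _.
  by rewrite lee_fin mulr_ge0 // exprn_ge0.
rewrite indicE mem_set ?mulr1 ?lee_fin //= /eball /=.
rewrite -[enorm3 _]invrK lef_pV2 ?posrE ?exprn_gt0 //.
Qed.

(** In the dyadic bound the constant 1 contributes the mass m, and term n at most 2^(n+1) c 4^-n = 2
    c 2^-n, which sums to 4 c. *)
Lemma integral_newton_le (nu : {measure set X -> \bar R}) (D : set X) (m c : R) x :
  measurable D -> (nu D <= m%:E)%E ->
  (forall r, 0 < r <= 1 -> (nu (D `&` eball x r) <= (c * r ^+ 2)%:E)%E) ->
  (\int[nu]_(y in D) (newton x y)%:E <= (m + 4 * c)%:E)%E.
Proof.
move=> mD num nuc; have i0 n y : 0 <= (2 : R) ^+ n.+1 * \1_(eball x (2 ^- n)) y.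
  by rewrite mulr_ge0 // exprn_ge0.
have mi n : measurable_fun D (fun y => ((2 : R) ^+ n.+1 * \1_(eball x (2 ^- n)) y)%:E).
  apply/measurable_EFinP; apply: measurable_funTS; apply: measurable_funM => //.
  by apply: measurable_indic; exact: measurable_eball.
apply: (@le_trans _ _ (\int[nu]_(y in D)
    (1 + \sum_(n <oo) ((2 : R) ^+ n.+1 * \1_(eball x (2 ^- n)) y)%:E))%E).
  apply: ge0_le_integral => //.
  - by move=> y _; rewrite lee_fin newton_ge0.
  - by apply/measurable_EFinP; apply: measurable_funTS; exact: measurable_newton.
  - by apply: emeasurable_funD => //; apply: ge0_emeasurable_sum.
  - by move=> y _; exact: newton_dyadic_le.
rewrite ge0_integralD //; last 2 first.
- by move=> y _; apply: nneseries_ge0 => n _ _; rewrite lee_fin.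
- by apply: ge0_emeasurable_sum.
rewrite integral_cst // mul1e EFinD leeD // integral_nneseries //.
apply: (@le_trans _ _ (\sum_(n <oo) ((4 * c) / (2 ^ (n + 1))%:R)%:E)%E); last first.
  by rewrite (cvg_lim _ (@cvg_geometric_eseries_half R (4 * c) 0)) // expr0 divr1.
apply: lee_nneseries => [n _ _|n _].
  by apply: integral_ge0 => y _; rewrite lee_fin.
under eq_integral do rewrite EFinM.
rewrite ge0_integralZl_EFin ?exprn_ge0 //; last first.
  apply/measurable_EFinP; apply: measurable_funTS; apply: measurable_indic.
  exact: measurable_eball.
rewrite integral_indic //; last exact: measurable_eball.
rewrite setIC; apply: (@le_trans _ _ ((2 ^+ n.+1)%:E * (c * (2 ^- n) ^+ 2)%:E)%E).
  rewrite lee_wpmul2l ?lee_fin ?exprn_ge0 // nuc // invr_gt0 exprn_gt0 //=.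
  by rewrite invf_le1 ?exprn_gt0 // exprn_ege1 // ler1n.
rewrite -EFinM lee_fin addn1 natrX.
have -> : (2 : R) ^+ n.+1 * (c * 2 ^- n ^+ 2) = 4 * c / 2 ^+ n.+1.
  by rewrite exprS; field; rewrite expf_neq0.
by [].
Qed.

Lemma leb3_eball x (r : R) : 0 <= r -> (leb3 (eball x r) <= (8 * r ^+ 3)%:E)%E.
Proof.
move=> r0.
pose Q : set X := (`[x.1.1 - r, x.1.1 + r]%classic `*` `[x.1.2 - r, x.1.2 + r]%classic)
   `*` `[x.2 - r, x.2 + r]%classic.
have lebI (a : R) : leb1 `[a - r, a + r]%classic = (2 * r)%:E.
  change (@lebesgue_measure R `[a - r, a + r]%classic = (2 * r)%:E).
  rewrite lebesgue_measure_itv /= lte_fin; case: ltP => h; rewrite -?EFinB.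
    by congr EFin; ring.
  by congr EFin; apply/eqP; rewrite eq_sym; apply/eqP; lra.
have mQ : measurable Q by apply: measurableX => //; exact: measurableX.
have -> : 8 * r ^+ 3 = (2 * r) * (2 * r) * (2 * r) by ring.
apply: (@le_trans _ _ (leb3 Q)).
  apply: le_measure; rewrite ?inE //; first exact: measurable_eball.
  move=> y; rewrite /eball /Q /= !in_itv /= => yr.
  have [h1 h2 h3] := enorm3_ge_coord (x - y).
  have {}h1 := le_trans h1 yr; have {}h2 := le_trans h2 yr; have {}h3 := le_trans h3 yr.
  move: h1 h2 h3; rewrite /= !ler_norml => /andP[? ?] /andP[? ?] /andP[? ?].
  by split; [split|]; apply/andP; split; lra.
rewrite /leb3 /Q prodm_setX //; last exact: measurableX.
rewrite [X in (X * _)%E](_ : _ = (2 * r * (2 * r))%:E); last first.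
  apply: etrans (@prodm_setX _ _ _ _ _ leb1 leb1 _ _ _ _) _ => //.
  by rewrite EFinM; congr (_ * _)%E; exact: lebI.
by rewrite [leRHS]EFinM; rewrite le_eqVlt; apply/orP; left; apply/eqP; congr (_ * _)%E; exact: lebI.
Qed.

Lemma leb3_newton_box (r : R) : exists c : R,
  forall y, (\int[leb3]_(x in box r) (newton x y)%:E <= c%:E)%E.
Proof.
have boxr : (leb3 (box r) < +oo)%E.
  have [r0|r0] := leP 0 r; last first.
    rewrite (_ : box r = set0) ?measure0 //; apply/seteqP; split=> // y /boxP[h _ _].
    by have := le_lt_trans (le_trans (normr_ge0 _) h) r0; rewrite ltxx.
  apply: (@le_lt_trans _ _ (leb3 (eball (0, 0, 0) (Num.sqrt (3 * r ^+ 2))))).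
    apply: le_measure; rewrite ?inE //; [exact: measurable_box|exact: measurable_eball|].
    move=> y /boxP[h1 h2 h3]; rewrite /eball /= /enorm3 ler_wsqrtr //.
    rewrite /dot3 /= !sub0r !mulrNN -!expr2 -[y.1.1 ^+ 2]real_normK ?num_real //.
    rewrite -[y.1.2 ^+ 2]real_normK ?num_real // -[y.2 ^+ 2]real_normK ?num_real //.
    have sq (a : R) : `|a| <= r -> `|a| ^+ 2 <= r ^+ 2.
      by move=> ar; rewrite lerXn2r ?nnegrE.
    have := sq _ h1; have := sq _ h2; have := sq _ h3; lra.
  by apply: le_lt_trans (leb3_eball _ (sqrtr_ge0 _)) _; rewrite ltry.
exists (fine (leb3 (box r)) + 4 * 8) => y.
under eq_integral do rewrite newtonC.
apply: integral_newton_le; first exact: measurable_box.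
  by rewrite fineK // ge0_fin_numE.
move=> s /andP[s0 s1]; apply: (@le_trans _ _ (leb3 (eball y s))).
  apply: le_measure; rewrite ?inE; [|exact: measurable_eball|exact: subIsetr].
  by apply: measurableI; [exact: measurable_box|exact: measurable_eball].
(* Radii at most 1 suffice, and for these the cubic growth 8 s^3 is below 8 s^2. *)
apply: (le_trans (leb3_eball _ (ltW s0))); rewrite lee_fin ler_wpM2l //.
by rewrite ler_wiXn2l // ltW.
Qed.

End NewtonPotentialBound.

(** * Positivity of a double integral by exchanging the two variables *)

Section Symmetrization.
Local Open Scope ereal_scope.
Context d (T : measurableType d) (R : realType).
Variable nu : {sigma_finite_measure set T -> \bar R}.
Variable E : T * T -> \bar R.
Hypothesis iE : (nu \x nu).-integrable setT E.

Let sw (p : T * T) : T * T := (p.2, p.1).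

Let measurable_sw : measurable_fun setT sw.
Proof. exact: measurable_fun_pair. Qed.

Let integrable_swap : (nu \x nu).-integrable setT (E \o sw).
Proof.
have /integrableP[mE _] := iE; apply/integrable12ltyP.
  exact: measurableT_comp mE measurable_sw.
exact: (integrable21ltyP nu nu mE).1.
Qed.

Let integral_swap : \int[nu \x nu]_p E (sw p) = \int[nu \x nu]_p E p.
Proof.
apply: etrans (esym (integral12_prod_meas1 integrable_swap)) _.
exact: (integral21_prod_meas1 iE).
Qed.

(** Exchanging the variables keeps the integral, so twice the integral is that of E(x, z) + E(z, x).
    This sum is nonnegative on A x A, whose complement lies in two strips over a null set. *)
Lemma ge0_integral_symmetrize (A : set T) :
  {ae nu, forall x, A x} ->
  (forall x z, A x -> A z -> 0 <= E (x, z) + E (z, x)) ->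
  0 <= \int[nu \x nu]_p E p.
Proof.
move=> [N [mN N0 subN]] sym.
have /integrableP[mE _] := iE; have /integrableP[mEs _] := integrable_swap.
have mS : measurable_fun setT (E \+ (E \o sw)) by exact: emeasurable_funD.
have : 0 <= \int[nu \x nu]_p (E p + E (sw p)).
  rewrite (ae_eq_integral (E \+ (E \o sw))^\+) //.
  - by apply: integral_ge0 => p _; exact: funepos_ge0.
  - exact: measurable_funepos.
  have a1 : {ae (nu \x nu), forall p, A p.1}.
    exists (N `*` setT); split; first exact: measurableX.
      apply: etrans (product_measure1E nu nu mN measurableT) _.
      by rewrite [X in X * _](_ : _ = 0) ?mul0e.
    by move=> p pN; split=> //; apply: subN.
  have a2 : {ae (nu \x nu), forall p, A p.2}.
    exists (setT `*` N); split; first exact: measurableX.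
      apply: etrans (product_measure1E nu nu measurableT mN) _.
      by rewrite [X in _ * X](_ : _ = 0) ?mule0.
    by move=> p pN; split=> //; apply: subN.
  apply: filterS2 a1 a2 => -[x z] /= xA zA _.
  by rewrite funeposE; apply/esym/max_idPl; exact: sym.
rewrite integralD // integral_swap.
have := integrable_fin_num measurableT iE.
by case: (\int[nu \x nu]_p E p) => // r _; rewrite -EFinD !lee_fin; lra.
Qed.

End Symmetrization.

(** * The energy inequality *)

Section HeatFlow.
Context {R : realType}.
Local Notation X := (R * R * R)%type.
Implicit Types (x y z w : X).
(* The bound of [heat_cut_oscillation]. *)
Definition osc T y w : R := Num.min (2 * newton y w) (32 * Num.sqrt T * newton y w ^+ 2).

Lemma osc_ge0 T y w : 0 <= osc T y w.
Proof.
by rewrite le_min !mulr_ge0 ?newton_ge0 ?sqrtr_ge0 ?exprn_ge0 ?newton_ge0.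
Qed.

Lemma measurable_osc T d (U : measurableType d) (u v : U -> X) :
  measurable_fun setT u -> measurable_fun setT v ->
  measurable_fun setT (fun q => osc T (u q) (v q)).
Proof.
move=> mu_ mv; have mn := measurable_newton mu_ mv.
apply: measurable_minr; first exact: measurable_funM.
by apply: measurable_funM => //; exact: measurable_funX.
Qed.

Variable mu : {finite_measure set X -> \bar R}.
Variables (M r0 : R).
Hypothesis newton_bound : forall x, (\int[mu]_y (newton x y)%:E <= M%:E)%E.
Hypothesis mu_atomless : forall x, mu [set x] = 0%E.
Hypothesis mu_support : mu (~` box r0) = 0%E.

Variable phi : X -> R.
Hypothesis phi2 : sqint mu phi.

Let mphi : measurable_fun setT phi := phi2.1.

Let mnphi : measurable_fun setT (fun y => `|phi y|).
Proof. exact: measurableT_comp. Qed.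

Let N1 : R := fine (\int[mu]_y `|phi y|%:E)%E.

Let N1E : (\int[mu]_y `|phi y|%:E = N1%:E)%E.
Proof.
rewrite fineK // ge0_fin_numE; first exact: sqint_norm1.
by apply: integral_ge0 => y _; rewrite lee_fin.
Qed.

Let N1_ge0 : 0 <= N1.
Proof. by rewrite -lee_fin -N1E; apply: integral_ge0 => y _; rewrite lee_fin. Qed.

Lemma apot_ae_leb3 : {ae leb3, forall x, (apot mu phi x < +oo)%E}.
Proof.
have h (n : nat) : {ae leb3, forall x, box n%:R x -> (apot mu phi x < +oo)%E}.
  have [c hc] := @leb3_newton_box R n%:R.
  apply: ae_lty; first exact: measurable_box.
  - by apply: measurable_funTS; exact: measurable_apot.
  - by move=> x _; exact: apot_ge0.
  - have := @integral_apot_le R mu leb3 (box n%:R) c phi (measurable_box _) mphi hc.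
    by move=> /le_lt_trans; apply; rewrite N1E -EFinM ltry.
have := ae_foralln h; apply: filterS => x hx.
have : [set: X] x by [].
by rewrite -box_cover => -[n _ /hx].
Qed.

(** Some coordinate separates x from the box that carries [mu] by at least s, so the kernel is at
    most 1/s there. *)
Lemma apot_far s x : 0 < s -> ~ box (r0 + s) x ->
  (apot mu phi x <= (s^-1 * N1)%:E)%E.
Proof.
move=> s0 xs; rewrite EFinM -N1E -ge0_integralZl_EFin ?invr_ge0 ?(ltW s0) //; last first.
  exact/measurable_EFinP.
apply: ae_ge0_le_integral => //.
- by move=> y _; rewrite lee_fin mulr_ge0 ?newton_ge0.
- by apply/measurable_EFinP; apply: measurable_funM => //; exact: measurable_newton.
- by move=> y _; rewrite -EFinM lee_fin mulr_ge0 // invr_ge0 ltW.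
- by apply: emeasurable_funM => //; exact/measurable_EFinP.
exists (~` box r0); split => //; first by apply: measurableC; exact: measurable_box.
move=> y /= /not_implyP[_ h] /boxP[y1 y2 y3]; apply: h.
rewrite -EFinM lee_fin ler_wpM2r // /newton.
have far (a b : R) : `|b| <= r0 -> ~ `|a| <= r0 + s -> s <= `|a - b|.
  move=> br /negP; rewrite -ltNge => ar; have := lerB_dist a b; lra.
have sd : s <= enorm3 (x - y).
  have [h1 h2 h3] := enorm3_ge_coord (x - y).
  apply: contrapT => nsd; apply: xs; apply/boxP.
  by split; apply: contrapT => /far xy; apply: nsd;
    [apply: le_trans (xy _ y1) h1|apply: le_trans (xy _ y2) h2|apply: le_trans (xy _ y3) h3].
by rewrite lef_pV2 ?posrE // (lt_le_trans s0).
Qed.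

Lemma pot_le x : (`|pot mu phi x|%:E <= apot mu phi x)%E.
Proof.
have mf : measurable_fun setT (fun y => (newton x y * phi y)%:E).
  by apply/measurable_EFinP; apply: measurable_funM => //; exact: measurable_newton.
have le : (`|\int[mu]_y (newton x y * phi y)%:E| <= apot mu phi x)%E.
  apply: (le_trans (le_abse_integral _ _ _)) => //.
  rewrite le_eqVlt; apply/orP; left; apply/eqP; apply: eq_integral => y _ /=.
  by rewrite normrM ger0_norm ?newton_ge0.
apply: le_trans le; rewrite /pot.
by case: (\int[mu]_y _)%E => [a| |] //=; rewrite normr0 leey.
Qed.

Lemma pot_integrable x : (apot mu phi x < +oo)%E ->
  mu.-integrable setT (fun y => (newton x y * phi y)%:E).
Proof.
move=> xfin; apply/integrableP; split.
  by apply/measurable_EFinP; apply: measurable_funM => //; exact: measurable_newton.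
suff -> : (\int[mu]_y `|(newton x y * phi y)%:E| = apot mu phi x)%E by [].
by apply: eq_integral => y _ /=; rewrite normrM ger0_norm ?newton_ge0.
Qed.

Lemma pot_subE x z (c : R) : (apot mu phi x < +oo)%E -> (apot mu phi z < +oo)%E ->
  (\int[mu]_y (c * (newton x y - newton z y) * phi y)%:E =
   (c * (pot mu phi x - pot mu phi z))%:E)%E.
Proof.
move=> /pot_integrable ix /pot_integrable iz.
transitivity (\int[mu]_y (c%:E *
    ((newton x y * phi y)%:E - (newton z y * phi y)%:E)))%E.
  by apply: eq_integral => y _; rewrite -EFinB -EFinM; congr EFin; ring.
rewrite integralZl //; last exact: integrableB.
rewrite integralB //.
have hx := integrable_fin_num measurableT ix.
have hz := integrable_fin_num measurableT iz.
by rewrite /pot EFinM EFinB !fineK.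
Qed.

(** Not normalized: the kernel has mass T / [newton_const], so it is [newton_const] / T times this
    number that approaches [th (pot mu phi y)]. *)
Definition heat_average (th : R -> R) (T : R) y : R :=
  fine (\int[leb3]_x (heat_cut T x y * th (pot mu phi x))%:E)%E.

(** * Nonnegativity at a fixed time T *)

Section HeatAverage.
Variables (th : R -> R) (b rho T : R).
Hypothesis th_mono : {homo th : a c / a <= c}.
Hypothesis th_bound : forall a, `|th a| <= b.
Hypothesis rho0 : 0 < rho.
Hypothesis th_zero : forall a, `|a| <= rho -> th a = 0.
Hypothesis T0 : 0 < T.

Let b0 : 0 <= b := le_trans (normr_ge0 _) (th_bound 0).

Let g x : R := th (pot mu phi x).

Let mth : measurable_fun setT th.
Proof. exact: nondecreasing_measurable. Qed.

Let mg : measurable_fun setT g.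
Proof. by apply: measurableT_comp => //; exact: measurable_pot. Qed.

Let mng : measurable_fun setT (fun x => `|g x|).
Proof. exact: measurableT_comp. Qed.

(** Outside this box the decay estimate gives |U phi| <= rho N1 / (N1 + 1) <= rho, so theta(U phi) =
    0; the + 1 keeps the margin positive when phi has norm 0. *)
Let r1 := r0 + (N1 + 1) / rho.

Let g_box x : ~ box r1 x -> g x = 0.
Proof.
move=> xb; apply: th_zero; rewrite -lee_fin (le_trans (pot_le x)) //.
have s0 : 0 < (N1 + 1) / rho by rewrite divr_gt0 // ltr_pwDr.
apply: (le_trans (apot_far s0 xb)); rewrite lee_fin invf_div mulrAC ler_pdivrMr.
  by rewrite ler_wpM2l ?(ltW rho0) // lerDl.
by rewrite ltr_pwDr.
Qed.

Let c1_ex := cid (@leb3_newton_box R r1).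
Let c1 : R := sval c1_ex.
Let c1P y : (\int[leb3]_(x in box r1) (newton x y)%:E <= c1%:E)%E.
Proof. exact: (svalP c1_ex). Qed.

Let newton_g_le y : (\int[leb3]_x (newton x y * `|g x|)%:E <= (b * c1)%:E)%E.
Proof.
apply: (@le_trans _ _ (\int[leb3]_(x in box r1) (b%:E * (newton x y)%:E))%E).
  rewrite [leRHS]integral_mkcond; apply: ge0_le_integral => //.
  - by move=> x _; rewrite lee_fin mulr_ge0 ?newton_ge0.
  - by apply/measurable_EFinP; apply: measurable_funM => //; exact: measurable_newton.
  - apply/(measurable_restrictT _ (measurable_box r1)).
    apply: measurable_funTS; apply/measurable_EFinP; apply: measurable_funM => //.
    exact: measurable_newton.
  - move=> x _; rewrite patchE; case: ifPn => [_|].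
      by rewrite -EFinM lee_fin mulrC ler_wpM2r ?newton_ge0 ?th_bound.
    by rewrite notin_setE => /g_box ->; rewrite normr0 mulr0.
rewrite ge0_integralZl_EFin //; last first.
- by apply: measurable_funTS; apply/measurable_EFinP; exact: measurable_newton.
- by move=> x _; rewrite lee_fin newton_ge0.
- exact: measurable_box.
by rewrite EFinM lee_wpmul2l ?lee_fin.
Qed.

Let lebX := prodm (@leb3 R) (@leb3 R).

(** The contribution of one source point y: integrated against phi(y), it becomes p_T(x, z) (U
    phi(x) - U phi(z)). *)
Let flux (p : X * X) y : R := heat T p.1 p.2 * (newton p.1 y - newton p.2 y).

Let measurable_fluxg d (U : measurableType d) (u v w : U -> X) :
  measurable_fun setT u -> measurable_fun setT v -> measurable_fun setT w ->
  measurable_fun setT (fun q => flux (u q, v q) (w q)).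
Proof.
move=> mu_ mv mw; apply: measurable_funM.
  by apply: measurable_heat => // _; exact: ltW.
by apply: measurable_funB; exact: measurable_newton.
Qed.

(** Bound the difference of kernels by their sum and integrate in z first: p_T has mass 1 and does
    not increase the kernel, so 2 [newton x y] * |g x| remains, and g lives in a box. Uniformity in
    y is what allows integration against phi in L^1. *)
Let flux_norm_le y :
  (\int[lebX]_p (`|flux p y * g p.1|)%:E <= (2 * (b * c1))%:E)%E.
Proof.
pose K (p : X * X) := (heat T p.1 p.2 * (newton p.1 y + newton p.2 y) * `|g p.1|)%:E.
have mK : measurable_fun setT K.
  apply/measurable_EFinP; apply: measurable_funM; last exact: (measurableT_comp mng).
  apply: measurable_funM.
    by apply: measurable_heat => // _; exact: ltW.
  by apply: measurable_funD; exact: measurable_newton.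
have K0 p : (0 <= K p)%E.
  by rewrite lee_fin !mulr_ge0 ?heat_ge0 ?addr_ge0 ?newton_ge0.
apply: (@le_trans _ _ (\int[lebX]_p K p)%E).
  apply: ge0_le_integral => //.
  - apply/measurable_EFinP; apply: measurableT_comp => //; apply: measurable_funM.
      exact: (measurable_fluxg measurable_fst measurable_snd).
    exact: (measurableT_comp mg).
  - move=> p _; rewrite lee_fin normrM ler_wpM2r // normrM (ger0_norm (heat_ge0 _ _ _)).
    rewrite ler_wpM2l ?heat_ge0 // (le_trans (ler_normB _ _)) //.
    by rewrite !ger0_norm ?newton_ge0.
rewrite prodm_tonelli1 //.
apply: (@le_trans _ _ (\int[leb3]_x (2%:E * (newton x y * `|g x|)%:E))%E).
  apply: ae_ge0_le_integral => //.
  - by move=> x _; apply: integral_ge0 => z _.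
  - exact: (@measurable_fun_fubini_tonelli_F _ _ _ _ _ leb3 K).
  - by move=> x _; rewrite -EFinM lee_fin !mulr_ge0 ?newton_ge0.
  - apply: emeasurable_funM => //; apply/measurable_EFinP; apply: measurable_funM => //.
    exact: measurable_newton.
  exists [set y]; split; [exact: measurable_set1_3|exact: leb3_set1|].
  move=> x /= /not_implyP[_]; apply: contra_notP => /eqP xy; rewrite /K /=.
  have mz : measurable_fun setT (fun z => heat T x z).
    by apply: measurable_heat => // _; exact: ltW.
  have mzn : measurable_fun setT (fun z => heat T x z * newton z y).
    by apply: measurable_funM => //; exact: measurable_newton.
  under eq_integral do rewrite EFinM mulrDr.
  rewrite ge0_integralZr ?lee_fin //; last 2 first.
  - apply/measurable_EFinP; apply: measurable_funD => //; exact: measurable_funM.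
  - by move=> z _; rewrite lee_fin addr_ge0 ?mulr_ge0 ?heat_ge0 ?newton_ge0.
  rewrite -EFinM mulrA [leRHS]EFinM lee_wpmul2r ?lee_fin //.
  under eq_integral do rewrite EFinD.
  rewrite ge0_integralD //; last 4 first.
  - by move=> z _; rewrite lee_fin mulr_ge0 ?heat_ge0 ?newton_ge0.
  - by apply/measurable_EFinP; exact: measurable_funM.
  - by move=> z _; rewrite lee_fin mulr_ge0 ?heat_ge0 ?newton_ge0.
  - exact/measurable_EFinP.
  have -> : 2 * newton x y = newton x y + newton x y by ring.
  rewrite EFinD; apply: leeD; last exact: integral_heat_newton_le.
  under eq_integral do rewrite EFinM.
  rewrite ge0_integralZr ?lee_fin ?newton_ge0 //; last first.
  - by move=> z _; rewrite lee_fin heat_ge0.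
  - exact/measurable_EFinP.
  by rewrite integral_heat // mul1e.
rewrite ge0_integralZl_EFin //.
- by rewrite EFinM lee_wpmul2l ?lee_fin.
- by move=> x _; rewrite lee_fin mulr_ge0 ?newton_ge0.
- by apply/measurable_EFinP; apply: measurable_funM => //; exact: measurable_newton.
Qed.

Let measurable_flux_g y : measurable_fun setT (fun p => flux p y * g p.1).
Proof.
apply: measurable_funM; last exact: (measurableT_comp mg).
exact: (measurable_fluxg measurable_fst measurable_snd).
Qed.

Let integrable_flux y : lebX.-integrable setT (fun p => (flux p y * g p.1)%:E).
Proof.
apply/integrableP; split; first exact/measurable_EFinP.
by apply: (le_lt_trans (flux_norm_le y)); rewrite ltry.
Qed.

Let integral_flux_z x y : x != y ->
  (\int[leb3]_z (flux (x, z) y * g x)%:E = (heat_cut T x y * g x)%:E)%E.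
Proof.
move=> xy; have mz : measurable_fun setT (fun z => heat T x z).
  by apply: measurable_heat => // _; exact: ltW.
have i1 : leb3.-integrable setT (fun z => (heat T x z)%:E).
  apply/integrableP; split; first exact/measurable_EFinP.
  under eq_integral do rewrite gee0_abs ?lee_fin ?heat_ge0 //.
  by rewrite integral_heat // ltry.
have i2 : leb3.-integrable setT (fun z => (heat T x z * newton z y)%:E).
  apply/integrableP; split.
    by apply/measurable_EFinP; apply: measurable_funM => //; exact: measurable_newton.
  under eq_integral do rewrite gee0_abs ?lee_fin ?mulr_ge0 ?heat_ge0 ?newton_ge0 //.
  by apply: (le_lt_trans (integral_heat_newton_le T0 xy)); rewrite ltry.
transitivity (\int[leb3]_z ((newton x y * g x)%:E * (heat T x z)%:E -
    (g x)%:E * (heat T x z * newton z y)%:E))%E.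
  by apply: eq_integral => z _; rewrite -!EFinM -EFinB /flux /=; congr EFin; ring.
rewrite integralB //; [|exact: integrableZl|exact: integrableZl].
rewrite !integralZl // integral_heat // integral_heat_newtonE // mule1.
by rewrite -EFinM -EFinB; congr EFin; ring.
Qed.

Let integral_flux y :
  (\int[lebX]_p (flux p y * g p.1)%:E = \int[leb3]_x (heat_cut T x y * g x)%:E)%E.
Proof.
rewrite -(integral12_prod_meas1 (integrable_flux y)) /fubini_F /=.
apply: ae_eq_integral => //.
- exact: measurable_fubini_F (integrable_flux y).
- apply/measurable_EFinP; apply: measurable_funM => //; exact: measurable_heat_cut.
exists [set y]; split; [exact: measurable_set1_3|exact: leb3_set1|].
move=> x /= /not_implyP[_]; apply: contra_notP => /eqP xy.
exact: integral_flux_z.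
Qed.

(** Integrable in all three variables, hence read in two orders: y first gives the expression in U
    phi to be symmetrized, (x, z) first gives phi(y) times the average against r_T(., y). *)
Let Psi (q : (X * X) * X) : \bar R := (flux q.1 q.2 * g q.1.1 * phi q.2)%:E.

Let measurable_Psi : measurable_fun setT Psi.
Proof.
apply/measurable_EFinP; apply: measurable_funM; last exact: (measurableT_comp mphi).
have m1 : measurable_fun setT (fun q : (X * X) * X => q.1.1).
  exact: (measurableT_comp measurable_fst measurable_fst).
apply: measurable_funM; last exact: (measurableT_comp mg).
have m2 : measurable_fun setT (fun q : (X * X) * X => q.1.2).
  exact: (measurableT_comp measurable_snd measurable_fst).
have := measurable_fluxg m1 m2 measurable_snd.
by apply: eq_measurable_fun => -[[? ?] ?] _.
Qed.

Let integrable_Psi : (lebX \x mu)%E.-integrable setT Psi.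
Proof.
apply/integrable21ltyP => //; apply: (@le_lt_trans _ _
  (\int[mu]_y ((2 * (b * c1))%:E * `|phi y|%:E))%E).
  apply: ge0_le_integral => //.
  - by move=> y _; apply: integral_ge0 => p _.
  - apply: (@measurable_fun_fubini_tonelli_G _ _ _ _ _ lebX (abse \o Psi)) => //.
      exact: measurableT_comp.
    by move=> q; exact: abse_ge0.
  - by apply: emeasurable_funM => //; exact/measurable_EFinP.
  - move=> y _; rewrite /Psi /=; under eq_integral do rewrite normrM EFinM.
    rewrite ge0_integralZr ?lee_fin //; last first.
      by apply/measurable_EFinP; apply: measurableT_comp.
    by rewrite lee_wpmul2r ?lee_fin // flux_norm_le.
rewrite ge0_integralZl_EFin //.
- by rewrite N1E -EFinM ltry.
- exact/measurable_EFinP.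
- rewrite -lee_fin; apply: le_trans (flux_norm_le (0, 0, 0)).
  by apply: integral_ge0 => p _; rewrite lee_fin.
Qed.

Let heat_averageE y :
  (\int[leb3]_x (heat_cut T x y * g x)%:E = (heat_average th T y)%:E)%E.
Proof.
by rewrite fineK // -integral_flux integrable_fin_num.
Qed.

Let fubini_Psi y : fubini_G lebX Psi y = (phi y * heat_average th T y)%:E.
Proof.
rewrite /fubini_G /Psi /=; under eq_integral do rewrite EFinM.
rewrite integralZr //.
by rewrite integral_flux heat_averageE -EFinM mulrC.
Qed.

Lemma measurable_heat_average : measurable_fun setT (fun y => phi y * heat_average th T y).
Proof.
apply/measurable_EFinP; have := measurable_fubini_G integrable_Psi.
by apply: eq_measurable_fun => y _; rewrite fubini_Psi.
Qed.

Let integral_Psi : (\int[lebX \x mu]_q Psi q =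
  \int[mu]_y (phi y * heat_average th T y)%:E)%E.
Proof.
rewrite -(integral21_prod_meas1 integrable_Psi); apply: eq_integral => y _.
exact: fubini_Psi.
Qed.

Let E (p : X * X) : \bar R := (\int[mu]_y Psi (p, y))%E.

Let integrable_E : lebX.-integrable setT E.
Proof. exact: (integrable_fubini_F integrable_Psi). Qed.

Let integral_E : (\int[lebX]_p E p = \int[lebX \x mu]_q Psi q)%E.
Proof. exact: (integral12_prod_meas1 integrable_Psi). Qed.

Let E_pot x z : (apot mu phi x < +oo)%E -> (apot mu phi z < +oo)%E ->
  E (x, z) = (heat T x z * (pot mu phi x - pot mu phi z) * g x)%:E.
Proof.
move=> ax az.
transitivity (\int[mu]_y (heat T x z * g x * (newton x y - newton z y) * phi y)%:E)%E.
  by apply: eq_integral => y _; rewrite /Psi /flux /=; congr EFin; ring.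
by rewrite (pot_subE _ ax az); congr EFin; ring.
Qed.

Let E_sym_ge0 x z : (apot mu phi x < +oo)%E -> (apot mu phi z < +oo)%E ->
  (0 <= E (x, z) + E (z, x))%E.
Proof.
move=> ax az; rewrite (E_pot ax az) (E_pot az ax) -EFinD lee_fin (heatC T z x).
have -> : heat T x z * (pot mu phi x - pot mu phi z) * g x +
    heat T x z * (pot mu phi z - pot mu phi x) * g z =
    heat T x z * ((pot mu phi x - pot mu phi z) * (g x - g z)) by ring.
apply: mulr_ge0; first exact: heat_ge0.
have [h|h] := leP (pot mu phi x) (pot mu phi z).
  by apply: mulr_le0; rewrite subr_le0 //; exact: th_mono.
by apply: mulr_ge0; rewrite subr_ge0; [|apply: th_mono]; exact: ltW.
Qed.

Lemma heat_average_ge0 : (0 <= \int[mu]_y (phi y * heat_average th T y)%:E)%E.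
Proof.
rewrite -integral_Psi -integral_E.
exact: (ge0_integral_symmetrize integrable_E apot_ae_leb3 E_sym_ge0).
Qed.

End HeatAverage.

(** * Rate at which the averages approach theta(U phi) *)

Section Averages.
Variables (th : R -> R) (b rho T : R).
Hypothesis th_mono : {homo th : a c / a <= c}.
Hypothesis th_lip : forall a c, `|th a - th c| <= `|a - c|.
Hypothesis th_bound : forall a, `|th a| <= b.
Hypothesis T0 : 0 < T.

Let g x : R := th (pot mu phi x).

Let mg : measurable_fun setT g.
Proof.
apply: measurableT_comp; first exact: nondecreasing_measurable.
exact: measurable_pot.
Qed.

Let diff y x : \bar R := (\int[mu]_w (`|newton x w - newton y w| * `|phi w|)%:E)%E.

Let diff_ge0 y x : (0 <= diff y x)%E.
Proof. by apply: integral_ge0 => w _; rewrite lee_fin mulr_ge0. Qed.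

Let measurable_diff y : measurable_fun setT (diff y).
Proof.
pose F (p : X * X) := (`|newton p.1 p.2 - newton y p.2| * `|phi p.2|)%:E.
apply: (@measurable_fun_fubini_tonelli_F _ _ _ _ _ mu F).
  apply/measurable_EFinP; apply: measurable_funM; last exact: (measurableT_comp mnphi).
  by apply: measurableT_comp => //; apply: measurable_funB; exact: measurable_newton.
by move=> p; rewrite lee_fin mulr_ge0.
Qed.

Let theta_diff y x : (apot mu phi x < +oo)%E -> (apot mu phi y < +oo)%E ->
  (`|g x - g y|%:E <= diff y x)%E.
Proof.
move=> ax ay; apply: (@le_trans _ _ (`|1 * (pot mu phi x - pot mu phi y)|%:E)).
  by rewrite lee_fin mul1r; exact: th_lip.
rewrite -abse_EFin -(pot_subE 1 ax ay); apply: (le_trans (le_abse_integral _ _ _)) => //.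
  apply/measurable_EFinP; apply: measurable_funM => //; apply: measurable_funM => //.
  by apply: measurable_funB; exact: measurable_newton.
rewrite le_eqVlt; apply/orP; left; apply/eqP; apply: eq_integral => w _ /=.
by rewrite mul1r normrM.
Qed.

(** Exchange the integrals and apply the oscillation bound for each source w != y; the excluded w =
    y has [mu]-mass 0. *)
Let integral_diff_le y :
  (\int[leb3]_x ((heat_cut T x y)%:E * diff y x) <=
   (T / newton_const)%:E * \int[mu]_w (`|phi w| * osc T y w)%:E)%E.
Proof.
have c0 := @newton_const_gt0 R.
have Tc : 0 <= T / newton_const by rewrite divr_ge0 // ltW.
pose F (p : X * X) := (heat_cut T p.1 y * (`|newton p.1 p.2 - newton y p.2| * `|phi p.2|))%:E.
have mF : measurable_fun setT F.
  apply/measurable_EFinP; apply: measurable_funM; first exact: measurable_heat_cut.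
  apply: measurable_funM; last exact: (measurableT_comp mnphi).
  by apply: measurableT_comp => //; apply: measurable_funB; exact: measurable_newton.
have F0 p : (0 <= F p)%E by rewrite lee_fin mulr_ge0 ?heat_cut_ge0 ?mulr_ge0.
have mow : measurable_fun setT (fun w => `|phi w| * osc T y w).
  by apply: measurable_funM => //; exact: measurable_osc.
have -> : (\int[leb3]_x ((heat_cut T x y)%:E * diff y x) =
    \int[leb3]_x \int[mu]_w F (x, w))%E.
  apply: eq_integral => x _; rewrite -ge0_integralZl_EFin ?heat_cut_ge0 //.
  - apply/measurable_EFinP; apply: measurable_funM => //.
    by apply: measurableT_comp => //; apply: measurable_funB => //; exact: measurable_newton.
apply: (@le_trans _ _ (\int[mu]_w \int[leb3]_x F (x, w))%E).
  by rewrite le_eqVlt; apply/orP; left; apply/eqP; exact: fubini_tonelli.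
rewrite -ge0_integralZl_EFin //; last 2 first.
- by move=> w _; rewrite lee_fin mulr_ge0 ?osc_ge0.
- exact/measurable_EFinP.
apply: ae_ge0_le_integral => //.
- by move=> w _; apply: integral_ge0 => x _.
- exact: (@measurable_fun_fubini_tonelli_G _ _ _ _ _ leb3 F mF F0).
- by move=> w _; rewrite -EFinM lee_fin mulr_ge0 // mulr_ge0 ?osc_ge0.
- by apply: emeasurable_funM => //; exact/measurable_EFinP.
exists [set y]; split; [exact: measurable_set1_3|exact: mu_atomless|].
move=> w /= /not_implyP[_]; apply: contra_notP => /eqP wy.
have yw : y != w by rewrite eq_sym.
have mh : measurable_fun setT (fun x => heat_cut T x y * `|newton x w - newton y w|).
  apply: measurable_funM; first exact: measurable_heat_cut.
  by apply: measurableT_comp => //; apply: measurable_funB => //; exact: measurable_newton.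
have -> : (\int[leb3]_x F (x, w) =
    \int[leb3]_x (heat_cut T x y * `|newton x w - newton y w|)%:E * `|phi w|%:E)%E.
  rewrite -ge0_integralZr ?lee_fin //.
  - by apply: eq_integral => x _; rewrite -EFinM /F /= mulrA.
  - exact/measurable_EFinP.
  - by move=> x _; rewrite lee_fin mulr_ge0 ?heat_cut_ge0.
apply: (@le_trans _ _ ((T / newton_const * osc T y w)%:E * `|phi w|%:E)%E).
  by rewrite lee_wpmul2r ?lee_fin //; exact: heat_cut_oscillation.
by rewrite -!EFinM lee_fin le_eqVlt; apply/orP; left; apply/eqP; ring.
Qed.

(** As T / [newton_const] is the mass of r_T(., y), subtracting that multiple of theta(U phi(y))
    leaves the average of g(x) - g(y). Since theta is 1-Lipschitz, |g(x) - g(y)| <= |U phi(x) - U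
    phi(y)|, which is split over the sources w. *)
Lemma heat_average_close y : (apot mu phi y < +oo)%E ->
  (`|newton_const / T * heat_average th T y - th (pot mu phi y)|%:E <=
   \int[mu]_w (`|phi w| * osc T y w)%:E)%E.
Proof.
move=> ay; have c0 := @newton_const_gt0 R.
have Tc : 0 < T / newton_const by rewrite divr_gt0.
have h0 x := heat_cut_ge0 T x y.
have mh : measurable_fun setT (fun x => heat_cut T x y) by exact: measurable_heat_cut.
have ih : leb3.-integrable setT (fun x => (heat_cut T x y)%:E).
  apply/integrableP; split; first exact/measurable_EFinP.
  under eq_integral do rewrite gee0_abs ?lee_fin ?heat_cut_ge0 //.
  by rewrite integral_heat_cut // ltry.
have ihg : leb3.-integrable setT (fun x => (heat_cut T x y * g x)%:E).
  apply: (@le_integrable _ _ _ leb3 setT _ _ (fun x => b%:E * (heat_cut T x y)%:E)%E) => //.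
  - by apply/measurable_EFinP; exact: measurable_funM.
  - move=> x _; rewrite -EFinM !abse_EFin lee_fin normrM mulrC normrM.
    by rewrite ler_wpM2r // (le_trans (th_bound _)) // ler_norm.
  - exact: integrableZl.
have igy : leb3.-integrable setT (fun x => (g y)%:E * (heat_cut T x y)%:E)%E.
  exact: integrableZl.
have eqh : (\int[leb3]_x ((heat_cut T x y * g x)%:E - (g y)%:E * (heat_cut T x y)%:E) =
    (heat_average th T y - T / newton_const * g y)%:E)%E.
  rewrite integralB // integralZl // integral_heat_cut // EFinB; congr (_ - _)%E.
    by rewrite /heat_average fineK // integrable_fin_num.
  by rewrite -EFinM mulrC.
have le1 : (`|heat_average th T y - T / newton_const * g y|%:E <=
    \int[leb3]_x ((heat_cut T x y)%:E * diff y x))%E.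
  rewrite -abse_EFin -eqh; apply: (le_trans (le_abse_integral _ _ _)) => //.
    by apply: emeasurable_funB; [apply: measurable_int ihg|apply: measurable_int igy].
  apply: ae_ge0_le_integral => //.
  - apply: measurableT_comp => //.
    by apply: emeasurable_funB; [apply: measurable_int ihg|apply: measurable_int igy].
  - by move=> x _; rewrite mule_ge0 ?lee_fin.
  - by apply: emeasurable_funM => //; exact/measurable_EFinP.
  apply: filterS apot_ae_leb3 => x ax _.
  rewrite -EFinM -EFinB abse_EFin [g y * _]mulrC -mulrBr normrM ger0_norm //.
  by rewrite EFinM lee_wpmul2l ?lee_fin //; exact: theta_diff.
have := le_trans le1 (integral_diff_le y).
have -> : newton_const / T * heat_average th T y - th (pot mu phi y) =
    newton_const / T * (heat_average th T y - T / newton_const * g y).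
  by rewrite /g; field; rewrite !gt_eqF.
move=> h; rewrite normrM gtr0_norm ?divr_gt0 // EFinM.
have -> : (\int[mu]_w (`|phi w| * osc T y w)%:E = (newton_const / T)%:E *
    ((T / newton_const)%:E * \int[mu]_w (`|phi w| * osc T y w)%:E))%E.
  rewrite muleA -EFinM (_ : _ * _ = 1) ?mul1e //.
  by field; rewrite !gt_eqF.
by rewrite lee_wpmul2l // lee_fin ltW // divr_gt0.
Qed.

End Averages.

End HeatFlow.

(** * The energy form on square integrable densities *)

Section Energy.
Context {R : realType}.
Local Notation X := (R * R * R)%type.
Implicit Types (x y z w : X) (phi psi : X -> R).
Variable mu : {finite_measure set X -> \bar R}.
Variables (M : R).
Hypothesis newton_bound : forall x, (\int[mu]_y (newton x y)%:E <= M%:E)%E.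

Lemma sqint_norm phi : sqint mu phi -> sqint mu (fun y => `|phi y|).
Proof.
move=> [mphi phi2]; split; first exact: measurableT_comp.
rewrite (eq_integral (fun y => (phi y ^+ 2)%:E)) // => y _.
by rewrite real_normK // num_real.
Qed.

Let pair phi psi (q : X * X) := newton q.1 q.2 * (phi q.1 * psi q.2).

Let measurable_pair phi psi : measurable_fun setT phi -> measurable_fun setT psi ->
  measurable_fun setT (pair phi psi).
Proof.
move=> mphi mpsi; apply: measurable_funM; first exact: measurable_newton.
apply: measurable_funM.
  exact: (measurableT_comp mphi measurable_fst).
exact: (measurableT_comp mpsi measurable_snd).
Qed.

Let integral_sqr phi : sqint mu phi ->
  (\int[mu]_y \int[mu]_w (newton y w * phi y ^+ 2)%:E < +oo)%E.
Proof.
move=> [mphi phi2].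
have M0 : (0 <= M%:E)%E.
  apply: le_trans (newton_bound (0, 0, 0)).
  by apply: integral_ge0 => y _; rewrite lee_fin newton_ge0.
have m2 : measurable_fun setT (fun y => (phi y ^+ 2)%:E).
  by apply/measurable_EFinP; exact: measurable_funX.
apply: (@le_lt_trans _ _ (\int[mu]_y (M%:E * (phi y ^+ 2)%:E))%E).
  apply: ge0_le_integral => //.
  - by move=> y _; apply: integral_ge0 => w _; rewrite lee_fin mulr_ge0 ?newton_ge0 ?sqr_ge0.
  - apply: (@measurable_fun_fubini_tonelli_F _ _ _ _ _ mu
      (fun q : X * X => (newton q.1 q.2 * phi q.1 ^+ 2)%:E)).
      apply/measurable_EFinP; apply: measurable_funM; first exact: measurable_newton.
      by apply: measurable_funX; exact: (measurableT_comp mphi).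
    by move=> q; rewrite lee_fin mulr_ge0 ?newton_ge0 ?sqr_ge0.
  - exact: emeasurable_funM.
  - move=> y _; under eq_integral do rewrite EFinM.
    rewrite ge0_integralZr ?lee_fin ?sqr_ge0 //.
    + by rewrite lee_wpmul2r ?lee_fin ?sqr_ge0.
    + by apply/measurable_EFinP; exact: measurable_newton.
    + by move=> w _; rewrite lee_fin newton_ge0.
rewrite ge0_integralZl_EFin //; first by rewrite lte_mul_pinfty.
by move=> y _; rewrite lee_fin sqr_ge0.
Qed.

(** Schur's test: |phi(y) psi(w)| <= phi(y)^2 + psi(w)^2, and integrating the kernel in the other
    variable costs at most M. *)
Let integrable_pair phi psi : sqint mu phi -> sqint mu psi ->
  (mu \x mu)%E.-integrable setT (fun q => (pair phi psi q)%:E).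
Proof.
move=> hphi hpsi; have [mphi _] := hphi; have [mpsi _] := hpsi.
apply/integrableP; split; first by apply/measurable_EFinP; exact: measurable_pair.
pose F (f : X -> R) (u : X * X -> X) q := (newton q.1 q.2 * f (u q) ^+ 2)%:E.
have F0 f u q : (0 <= F f u q)%E by rewrite lee_fin mulr_ge0 ?newton_ge0 ?sqr_ge0.
have mF f u : measurable_fun setT f -> measurable_fun setT u -> measurable_fun setT (F f u).
  move=> mf mu_; apply/measurable_EFinP; apply: measurable_funM; first exact: measurable_newton.
  by apply: measurable_funX; exact: (measurableT_comp mf).
apply: (@le_lt_trans _ _ (\int[mu \x mu]_q (F phi fst q + F psi snd q))%E).
  apply: ge0_le_integral => //.
  - apply/measurable_EFinP; apply: measurableT_comp => //; exact: measurable_pair.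
  - by apply: emeasurable_funD; apply: mF.
  - move=> q _; rewrite abse_EFin -EFinD lee_fin /pair normrM (ger0_norm (newton_ge0 _ _)).
    rewrite -mulrDr ler_wpM2l ?newton_ge0 // normrM.
    have := sqr_ge0 (`|phi q.1| - `|psi q.2|).
    rewrite -(real_normK (num_real (phi q.1))) -(real_normK (num_real (psi q.2))).
    have := normr_ge0 (phi q.1); have := normr_ge0 (psi q.2); nra.
rewrite ge0_integralD //; [|exact: mF|exact: mF].
rewrite lte_add_pinfty //.
  rewrite (fubini_tonelli1 (F phi fst)) //; last exact: mF.
  exact: (integral_sqr hphi).
rewrite (fubini_tonelli2 (F psi snd)) //; last exact: mF.
rewrite [ltLHS](_ : _ = (\int[mu]_y \int[mu]_w (newton y w * psi y ^+ 2)%:E)%E).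
  exact: (integral_sqr hpsi).
by apply: eq_integral => y _; apply: eq_integral => w _; rewrite newtonC.
Qed.

Let fubini_pair phi psi : sqint mu phi -> sqint mu psi ->
  {ae mu, forall y, (\int[mu]_w (pair phi psi (y, w))%:E = (phi y * pot mu psi y)%:E)%E}.
Proof.
move=> hphi hpsi; apply: filterS (apot_ae newton_bound hpsi) => y ay.
under eq_integral do rewrite /pair /= mulrCA EFinM.
have i := pot_integrable hpsi ay.
by rewrite integralZl // /pot EFinM fineK // integrable_fin_num.
Qed.

Lemma integrable_energy phi psi : sqint mu phi -> sqint mu psi ->
  mu.-integrable setT (fun y => (phi y * pot mu psi y)%:E).
Proof.
move=> hphi hpsi; have i := integrable_pair hphi hpsi.
apply/integrableP; split.
  apply/measurable_EFinP; apply: measurable_funM; first exact: hphi.1.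
  exact: (measurable_pot _ hpsi.1).
have /integrableP[mf] := integrable_fubini_F i; apply: le_lt_trans.
apply: ae_ge0_le_integral => //.
- apply: measurableT_comp => //; apply/measurable_EFinP.
  by apply: measurable_funM; [exact: hphi.1|exact: (measurable_pot _ hpsi.1)].
- exact: measurableT_comp.
by apply: filterS (fubini_pair hphi hpsi) => y e _; rewrite /fubini_F e.
Qed.

Let integral_pair phi psi : sqint mu phi -> sqint mu psi ->
  (\int[mu]_y (phi y * pot mu psi y)%:E = \int[mu \x mu]_q (pair phi psi q)%:E)%E.
Proof.
move=> hphi hpsi; have i := integrable_pair hphi hpsi.
rewrite -(integral12_prod_meas1 i); apply: ae_eq_integral => //.
- apply/measurable_EFinP; apply: measurable_funM; first exact: hphi.1.
  exact: (measurable_pot _ hpsi.1).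
- exact: measurable_fubini_F i.
by apply: filterS (fubini_pair hphi hpsi) => y e _; rewrite /fubini_F e.
Qed.

Lemma energyC phi psi : sqint mu phi -> sqint mu psi ->
  (\int[mu]_y (phi y * pot mu psi y)%:E = \int[mu]_y (psi y * pot mu phi y)%:E)%E.
Proof.
move=> hphi hpsi; rewrite integral_pair // integral_pair //.
rewrite -(integral12_prod_meas1 (integrable_pair hphi hpsi)).
rewrite -(integral21_prod_meas1 (integrable_pair hpsi hphi)).
apply: eq_integral => y _; apply: eq_integral => w _.
by rewrite /pair /= newtonC [phi y * _]mulrC.
Qed.

End Energy.

Ltac minmax_lra := rewrite /Order.max /Order.min;
  repeat match goal with |- context [if (?a < ?b)%R then _ else _] =>
    lazymatch b with
    | context [if _ then _ else _] => fail
    | _ => case: (ltP a b) => ?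
    end end; lra.

(** * The limits T -> 0 and theta -> min(., 0) *)

Section ClippedEnergy.
Context {R : realType}.
Local Notation X := (R * R * R)%type.
Variable mu : {finite_measure set X -> \bar R}.
Variables (M r0 : R).
Hypothesis newton_bound : forall x, (\int[mu]_y (newton x y)%:E <= M%:E)%E.
Hypothesis mu_atomless : forall x, mu [set x] = 0%E.
Hypothesis mu_support : mu (~` box r0) = 0%E.
Variable phi : X -> R.
Hypothesis phi2 : sqint mu phi.

Let mphi : measurable_fun setT phi := phi2.1.

Let sqnphi : sqint mu (fun y => `|phi y|) := sqint_norm phi2.

Let iphi : mu.-integrable setT (fun y => (phi y)%:E).
Proof.
apply/integrableP; split; first exact/measurable_EFinP.
exact: (sqint_norm1 phi2).
Qed.

Section Theta.
Variables (th : R -> R) (b rho : R).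
Hypothesis th_mono : {homo th : a c / a <= c}.
Hypothesis th_lip : forall a c, `|th a - th c| <= `|a - c|.
Hypothesis th_bound : forall a, `|th a| <= b.
Hypothesis rho0 : 0 < rho.
Hypothesis th_zero : forall a, `|a| <= rho -> th a = 0.

(** Times tending to 0, squared so that the factor sqrt T of the oscillation bound is 1 / (n +
    1). *)
Let tm (n : nat) : R := n.+1%:R^-1 ^+ 2.

Let tm_gt0 n : 0 < tm n.
Proof. by rewrite exprn_gt0 // invr_gt0. Qed.

Let osc_le n (y w : X) : osc (tm n) y w <= 32 * newton y w ^+ 2 * n.+1%:R^-1.
Proof.
rewrite ge_min; apply/orP; right.
rewrite sqrtr_sqr ger0_norm ?invr_ge0 // le_eqVlt; apply/orP; left; apply/eqP; ring.
Qed.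

Let osc_cvg (y w : X) : osc (tm n) y w @[n --> \oo] --> (0 : R).
Proof.
apply: (@squeeze_cvgr _ _ _ _ (cst 0) (fun n => 32 * newton y w ^+ 2 * n.+1%:R^-1)).
- by apply: nearW => n; rewrite osc_ge0 osc_le.
- exact: cvg_cst.
- rewrite -[X in _ --> X](mulr0 (32 * newton y w ^+ 2)).
  by apply: cvgMr; exact: cvg_harmonic.
Qed.

Let modulus n y : \bar R := (\int[mu]_w (`|phi w| * osc (tm n) y w)%:E)%E.

Let osc_newton n (y w : X) : `|phi w| * osc (tm n) y w <= 2 * (newton y w * `|phi w|).
Proof.
rewrite [leRHS](_ : _ = `|phi w| * (2 * newton y w)); last by ring.
by rewrite ler_wpM2l // ge_min lexx.
Qed.

Let modulus_le n y : (apot mu phi y < +oo)%E ->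
  (modulus n y <= 2%:E * apot mu phi y)%E.
Proof.
move=> ay; rewrite /apot -ge0_integralZl_EFin //; last 2 first.
- by move=> w _; rewrite lee_fin mulr_ge0 ?newton_ge0.
- apply/measurable_EFinP; apply: measurable_funM; first exact: measurable_newton.
  exact: measurableT_comp.
apply: ge0_le_integral => //.
- by move=> w _; rewrite lee_fin mulr_ge0 ?osc_ge0.
- apply/measurable_EFinP; apply: measurable_funM; first exact: measurableT_comp.
  exact: measurable_osc.
- apply: emeasurable_funM => //; apply/measurable_EFinP; apply: measurable_funM.
    exact: measurable_newton.
  exact: measurableT_comp.
- by move=> w _; rewrite -EFinM lee_fin osc_newton.
Qed.

(** Dominated convergence in the source w: the second entry of [osc] tends to 0 pointwise, the first
    supplies the integrable majorant. *)
Let modulus_cvg y : (apot mu phi y < +oo)%E -> modulus n y @[n --> \oo] --> 0%E.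
Proof.
move=> ay; have mn : measurable_fun setT (fun w => `|phi w|) by exact: measurableT_comp.
have mo n : measurable_fun setT (fun w => (`|phi w| * osc (tm n) y w)%:E).
  by apply/measurable_EFinP; apply: measurable_funM => //; exact: measurable_osc.
have ig : mu.-integrable setT (fun w => (2 * (newton y w * `|phi w|))%:E).
  under eq_fun do rewrite EFinM; apply: integrableZl => //.
  apply/integrableP; split.
    by apply/measurable_EFinP; apply: measurable_funM => //; exact: measurable_newton.
  by under eq_integral do rewrite gee0_abs ?lee_fin ?mulr_ge0 ?newton_ge0 //.
have lim0 : {ae mu, forall w, [set: X] w ->
    (`|phi w| * osc (tm n) y w)%:E @[n --> \oo] --> 0%E}.
  apply: aeW => w _; apply: cvg_EFin; first by apply: nearW.
  rewrite -[X in _ --> X](mulr0 `|phi w|).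
  by apply: cvgMr; exact: osc_cvg.
have dom : {ae mu, forall w n, [set: X] w ->
    (`|(`|phi w| * osc (tm n) y w)%:E| <= (2 * (newton y w * `|phi w|))%:E)%E}.
  apply: aeW => w n _; rewrite abse_EFin lee_fin ger0_norm ?osc_newton //.
  by rewrite mulr_ge0 ?osc_ge0.
have [_ _] := dominated_convergence (mu := mu) measurableT mo
  (measurable_cst 0%E) lim0 ig dom.
by rewrite integral0.
Qed.

Lemma clipped_energy_ge0 : (0 <= \int[mu]_y (phi y * th (pot mu phi y))%:E)%E.
Proof.
have c0 := @newton_const_gt0 R.
pose a n y := phi y * (newton_const / tm n * heat_average mu phi th (tm n) y).
have ma n : measurable_fun setT (fun y => (a n y)%:E).
  apply/measurable_EFinP.
  have := @measurable_heat_average _ _ _ mu_support _ phi2 _ _ _ _ th_mono th_bound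
    rho0 th_zero (tm_gt0 n).
  move=> /(measurable_funM (measurable_cst (newton_const / tm n))).
  by apply: eq_measurable_fun => y _; rewrite /a /=; ring.
have mth : measurable_fun setT (fun y => (phi y * th (pot mu phi y))%:E).
  apply/measurable_EFinP; apply: measurable_funM => //.
  apply: measurableT_comp; first exact: nondecreasing_measurable.
  exact: measurable_pot.
(* The majorant: the normalized average is within 2 U|phi| of theta(U phi), which is at most b in
   absolute value, and |phi| U|phi| is integrable as an energy density. *)
pose G y := b * `|phi y| + 2 * (`|phi y| * pot mu (fun y => `|phi y|) y).
have iG : mu.-integrable setT (fun y => (G y)%:E).
  under eq_fun do rewrite EFinD 2!EFinM; apply: integrableD => //.
    apply: integrableZl => //; exact: (integrable_abse iphi).
  apply: integrableZl => //; exact: (integrable_energy newton_bound sqnphi sqnphi).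
have close n y : (apot mu phi y < +oo)%E ->
    (`|newton_const / tm n * heat_average mu phi th (tm n) y - th (pot mu phi y)|%:E
       <= modulus n y)%E.
  exact: heat_average_close (tm_gt0 n) _.
have lim_a : {ae mu, forall y, [set: X] y ->
    (a n y)%:E @[n --> \oo] --> (phi y * th (pot mu phi y))%:E}.
  apply: filterS (apot_ae newton_bound phi2) => y ay _.
  apply: cvg_EFin; first by apply: nearW.
  apply: cvgMr; apply/subr_cvg0; apply: norm_cvg0.
  rewrite -[X in X @ _](_ : (fine \o (fun n =>
    `|newton_const / tm n * heat_average mu phi th (tm n) y - th (pot mu phi y)|%:E)) = _) //.
  apply: (@fine_cvg R nat _ _ _ (0 : R)); apply: (@squeeze_cvge _ _ _ _ (cst 0%E) _ _) (modulus_cvg ay).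
    by apply: nearW => n; rewrite lee_fin normr_ge0 /= close.
  exact: cvg_cst.
have dom_a : {ae mu, forall y n, [set: X] y -> (`|(a n y)%:E| <= (G y)%:E)%E}.
  apply: filterS (apot_ae newton_bound phi2) => y ay n _.
  have aE : apot mu phi y = (pot mu (fun y => `|phi y|) y)%:E by rewrite fineK // ge0_fin_numE // apot_ge0.
  have h := le_trans (close n y ay) (modulus_le n ay).
  rewrite aE -EFinM lee_fin in h.
  rewrite abse_EFin lee_fin /a /G normrM.
  rewrite (_ : _ + _ = `|phi y| * (2 * pot mu (fun y => `|phi y|) y + b)); last by ring.
  apply: ler_wpM2l => //; apply: le_trans (lerD h (th_bound (pot mu phi y))).
  by rewrite -[X in `|X| <= _](subrK (th (pot mu phi y))) ler_normD.
have [_ _ cv] := dominated_convergence (mu := mu) measurableT ma mth lim_a iG dom_a.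
rewrite -(cvg_lim _ cv) //; apply: lime_ge; first by apply/cvg_ex; eexists; exact: cv.
apply: nearW => n.
have ia : mu.-integrable setT (fun y => (a n y)%:E).
  apply/integrableP; split; first exact: ma.
  have /integrableP[mG] := iG; apply: le_lt_trans; apply: ae_ge0_le_integral => //.
  - exact: (measurableT_comp _ (ma n)).
  - exact: (measurableT_comp _ mG).
  by apply: filterS dom_a => y h _; apply: le_trans (h n I) _; rewrite abse_EFin lee_fin ler_norm.
have k0 : 0 < newton_const / tm n by rewrite divr_gt0.
rewrite -(@pmule_rge0 _ (newton_const / tm n)^-1%:E) ?lte_fin ?invr_gt0 //.
rewrite -integralZl //.
rewrite (eq_integral (fun y => (phi y * heat_average mu phi th (tm n) y)%:E)).
  exact: (@heat_average_ge0 _ _ _ mu_support _ phi2 _ _ _ _ th_mono th_bound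
    rho0 th_zero (tm_gt0 n)).
by move=> y _; rewrite -EFinM /a mulrCA mulKf // gt_eqF.
Qed.

End Theta.

(** Admissible approximations of min(., 0): the shift makes them vanish for |a| <= 1 / (m + 1), the
    truncation bounds them by m, and |a| dominates them all. *)
Let clip (m : nat) (a : R) : R := Num.max (- m%:R) (Num.min (a + m.+1%:R^-1) 0).

Let inv0 (m : nat) : 0 < m.+1%:R^-1 :> R.
Proof. by rewrite invr_gt0. Qed.

Let clip_energy_ge0 m : (0 <= \int[mu]_y (phi y * clip m (pot mu phi y))%:E)%E.
Proof.
have m0 : 0 <= m%:R :> R by [].
apply: (@clipped_energy_ge0 (clip m) m%:R m.+1%:R^-1) => // [a c ac|a c|a|a].
- by rewrite /clip; move: (inv0 m); move: _^-1 => i i0; minmax_lra.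
- have := ler_norm (a - c); have := ler_norm (c - a); rewrite (distrC c a) ler_norml.
  by move=> h1 h2; rewrite /clip; move: (inv0 m); move: _^-1 => i i0; apply/andP; split; minmax_lra.
- by rewrite ler_norml /clip; move: (inv0 m); move: _^-1 => i i0; apply/andP; split; minmax_lra.
- rewrite ler_norml => /andP[]; rewrite /clip; move: (inv0 m); move: _^-1 => i i0 h1 h2; minmax_lra.
Qed.

Let clip_cvg a : clip m a @[m --> \oo] --> Num.min a 0.
Proof.
have h : Num.min (a + m.+1%:R^-1) 0 @[m --> \oo] --> Num.min a 0.
  apply: (@squeeze_cvgr _ _ _ _ (cst (Num.min a 0)) (fun m => Num.min a 0 + m.+1%:R^-1)).
  - by apply: nearW => m /=; move: (inv0 m); move: _^-1 => i i0; apply/andP; split; minmax_lra.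
  - exact: cvg_cst.
  - rewrite -[X in _ --> X]addr0; apply: cvgD; first exact: cvg_cst.
    exact: cvg_harmonic.
apply: cvg_trans h; apply: near_eq_cvg; near=> m.
rewrite /clip max_r // le_min oppr_le0 ler0n andbT.
have am : - a <= m%:R by near: m; exact: nbhs_infty_ger.
by move: (inv0 m); move: _^-1 => i i0; minmax_lra.
Unshelve. all: end_near. Qed.

Let clip_le m a : `|clip m a| <= `|a|.
Proof.
have m0 : 0 <= m%:R :> R by [].
have := ler_norm a; have := ler_norm (- a); rewrite normrN ler_norml /clip.
move: (inv0 m); move: _^-1 => i i0 h1 h2; apply/andP; split; minmax_lra.
Qed.

Lemma min_energy_ge0 : (0 <= \int[mu]_y (phi y * Num.min (pot mu phi y) 0)%:E)%E.
Proof.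
have mpot : measurable_fun setT (pot mu phi) by exact: measurable_pot.
have mclip m : measurable_fun setT (fun y => (phi y * clip m (pot mu phi y))%:E).
  apply/measurable_EFinP; apply: measurable_funM => //.
  apply: measurable_maxr => //; apply: measurable_minr => //.
  exact: measurable_funD.
have mmin : measurable_fun setT (fun y => (phi y * Num.min (pot mu phi y) 0)%:E).
  by apply/measurable_EFinP; apply: measurable_funM => //; exact: measurable_minr.
have lim : {ae mu, forall y, [set: X] y ->
    (phi y * clip m (pot mu phi y))%:E @[m --> \oo] -->
    (phi y * Num.min (pot mu phi y) 0)%:E}.
  apply: aeW => y _; apply: cvg_EFin; first by apply: nearW.
  by apply: cvgMr; exact: clip_cvg.
have ig := integrable_abse (integrable_energy newton_bound phi2 phi2).
have dom : {ae mu, forall y m, [set: X] y ->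
    (`|(phi y * clip m (pot mu phi y))%:E| <= `|(phi y * pot mu phi y)%:E|)%E}.
  by apply: aeW => y m _; rewrite !abse_EFin lee_fin !normrM ler_wpM2l.
have [_ _ cv] := dominated_convergence (mu := mu) measurableT mclip mmin lim ig dom.
rewrite -(cvg_lim _ cv) //; apply: lime_ge; first by apply/cvg_ex; eexists; exact: cv.
apply: nearW => m; exact: clip_energy_ge0.
Qed.

End ClippedEnergy.

(** * Surfaces of resonators *)

Lemma compact_cover3 (R : realType) (E : set (R * R * R)) (I : choiceType) (D : set I)
    (f : I -> set (R * R * R)) :
  compact E -> (forall i, D i -> open (f i)) -> E `<=` \bigcup_(i in D) f i ->
  exists F : set I, [/\ finite_set F, F `<=` D & E `<=` \bigcup_(i in F) f i].
Proof.
(* [compact_cover] asks for a pointed topological type. *)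
pose PT : ptopologicalType := HB.pack (R * R * R)%type.
have e : @compact PT E = @cover_compact PT E by rewrite (@compact_cover PT).
have h : compact E -> cover_compact E by rewrite -[cover_compact E]/(@cover_compact PT E) -e.
move=> /h cE of_ Ef; have [F FD EF] := cE I D f of_ Ef.
by exists [set` F]; split => // i /FD/set_mem.
Qed.

Section Topology.
Context {R : realType}.
Local Notation X := (R * R * R)%type.

(* A replacement for [ge0_le_integral] when A and f are not known to be
   measurable, as for the parameter domains and densities of patches. *)
Lemma ge0_le_integral_patch d (T : measurableType d) (mu : {measure set T -> \bar R})
    (A B : set T) (f g : T -> \bar R) :
  (forall x, A x -> 0 <= f x)%E -> (forall x, B x -> 0 <= g x)%E ->
  (forall x, A x -> B x /\ (f x <= g x)%E) ->
  (\int[mu]_(x in A) f x <= \int[mu]_(x in B) g x)%E.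
Proof.
move=> f0 g0 fg; rewrite !ge0_integralE //; apply: ereal_sup_le => _ [h hf <-].
exists h => // x; apply: le_trans (hf x) _; rewrite !patchE.
case: ifPn => [|_]; first by move=> /set_mem /fg[Bx fgx]; rewrite mem_set.
by case: ifPn => // /set_mem /g0.
Qed.

Lemma measurable_ball3 (x : X) e : measurable (ball x e).
Proof.
have -> : ball x e = (ball x.1.1 e `*` ball x.1.2 e) `*` ball x.2 e by [].
by apply: measurableX; [apply: measurableX|]; exact: measurable_ball.
Qed.

(* A compact set is the intersection over n of finite unions of balls of
   radius 1/n. *)
Lemma compact_measurable3 (E : set X) : compact E -> measurable E.
Proof.
move=> cE; have clE : closed E.
  by apply: compact_closed => //; exact: norm_hausdorff.
have cov (n : nat) : exists F : set X, [/\ finite_set F, F `<=` E &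
    E `<=` \bigcup_(p in F) ball p n.+1%:R^-1].
  apply: (compact_cover3 cE) => [p _|p Ep]; first exact: ball_open.
  by exists p => //; apply: ballxx; rewrite invr_gt0.
have [F /all_and3[finF FE EF]] := choice cov.
have -> : E = \bigcap_n \bigcup_(p in F n) ball p n.+1%:R^-1.
  apply/seteqP; split=> [x Ex n _|x Fx]; first exact: EF.
  rewrite (closure_id E).1 // => B /nbhs_ballP[e /= e0 eB].
  have [n _ /(_ _ (leqnn _)) ne] : \forall n \near \oo, n.+1%:R^-1 < e.
    exact: near_infty_natSinv_lt (PosNum e0).
  have [p Fp px] := Fx n I; exists p; split; first exact: FE Fp.
  by apply: eB; apply: ball_sym; apply: le_ball px; exact: ltW.
apply: bigcap_measurable => // n _; apply: fin_bigcup_measurable => // p _.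
exact: measurable_ball3.
Qed.

Lemma box_compact (r : R) : compact (box r).
Proof.
by apply: compact_setX; [apply: compact_setX|]; exact: segment_compact.
Qed.

Lemma bounded_sub_box (E : set X) : bounded_set E -> exists r, E `<=` box r.
Proof.
move=> [M [_ EM]]; exists (M + 1) => x /(EM _ _) h.
have : `|x| <= M + 1 by apply: h; rewrite ltrDl.
by rewrite prod_normE ge_max prod_normE ge_max -andbA => /and3P[h1 h2 h3]; apply/boxP.
Qed.

Lemma closure_sub_box (E : set X) r : E `<=` box r -> closure E `<=` box r.
Proof.
have : closed (box r) by apply: compact_closed; [exact: norm_hausdorff|exact: box_compact].
by move=> /closure_id e /closure_subset; rewrite -e.
Qed.

(** With empty boundary E would be closed as well as open. Its trace on a line through one of its
    points would be all of the connected line, and so unbounded. *)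
Lemma boundary_nonempty (E : set X) r : open E -> E !=set0 -> E `<=` box r ->
  boundary E !=set0.
Proof.
move=> oE [p Ep] Er; apply: contrapT => /set0P/negP/negPn/eqP b0.
have cE : closed E.
  apply/closure_id/seteqP; split; first exact: subset_closure.
  move=> x cx; apply: contrapT => nx; have : boundary E x.
    by split => //; rewrite -(proj1 (interior_id E) oE) in nx.
  by rewrite b0.
pose l (t : R) : X := (p.1.1 + t, p.1.2, p.2).
have cl : continuous l.
  move=> t; apply: (cvg_pair (cvg_pair _ (cvg_cst _)) (cvg_cst _)).
  by apply: cvgD; [exact: cvg_cst|exact: cvg_id].
have cR : connected [set: R] by apply/connected_intervalP => x y _ _ z _.
have : l @^-1` E = setT.
  apply: cR; first by exists 0; rewrite /= /l addr0 -!surjective_pairing.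
  - exists (l @^-1` E); last by rewrite setTI.
    by apply: open_comp => // x _; exact: cl.
  - exists (l @^-1` E); last by rewrite setTI.
    by apply: closed_comp => // x _; exact: cl.
move=> /seteqP[_ /(_ (`|r| + `|p.1.1| + 1) I)] /Er /boxP[] /= h _ _.
move: h; have := ler_norm (- p.1.1); have := ler_norm r.
have := ler_norm (p.1.1 + (`|r| + `|p.1.1| + 1)); rewrite normrN; lra.
Qed.

End Topology.

(** * The boundary of a union with disjoint closures *)

Section Resonators.
Context {R : realType}.
Local Notation X := (R * R * R)%type.

Lemma boundary_closed (E : set X) : closed (boundary E).
Proof.
apply: closedI; first exact: closed_closure.
by apply: open_closedC; exact: open_interior.
Qed.

Lemma boundary_open (E : set X) : open E -> boundary E = closure E `\` E.
Proof. by rewrite /boundary => /interior_id ->. Qed.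

Section Disjoint.
Variables (n : nat) (D : 'I_n -> set X).
Hypothesis oD : forall k, open (D k).
Hypothesis dD : forall j k, j != k -> closure (D j) `&` closure (D k) = set0.

Let oU : open (\bigcup_k D k). Proof. exact: bigcup_open. Qed.

Let closureU : closure (\bigcup_k D k) = \bigcup_k closure (D k).
Proof.
apply/seteqP; split; last first.
  by move=> x [k _]; apply: closure_subset => y Dy; exists k.
have c : closed (\bigcup_k closure (D k)).
  by apply: closed_bigcup => [|k _]; [exact: finite_finset|exact: closed_closure].
rewrite [X in _ `<=` X]((closure_id _).1 c); apply: closure_subset.
by move=> x [k _ Dx]; exists k => //; exact: subset_closure.
Qed.

Lemma boundary_bigcup_local k x : closure (D k) x ->
  boundary (\bigcup_k D k) x <-> boundary (D k) x.
Proof.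
move=> cx; rewrite !boundary_open // closureU; split=> [[_ nx]|[_ nx]].
  by split=> // Dx; apply: nx; exists k.
split; first by exists k.
move=> [j _ Dx]; have [jk|jk] := eqVneq j k; first by apply: nx; rewrite -jk.
by rewrite -[False]/(set0 x) -(dD jk); split => //; exact: subset_closure.
Qed.

Lemma boundary_bigcup : boundary (\bigcup_k D k) = \bigcup_k boundary (D k).
Proof.
apply/seteqP; split=> [x bx|x [k _ bx]].
  have [] := bx; rewrite closureU => -[k _ cx] _; exists k => //.
  exact/(boundary_bigcup_local cx).
by apply/(boundary_bigcup_local (proj1 bx)).
Qed.

(** Removing the finitely many other closures leaves an open set around p. Local graphs of one
    boundary thereby become local graphs of the whole surface. *)
Lemma boundary_isolated k p : closure (D k) p ->
  exists W, [/\ open W, W p & forall x, W x ->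
    boundary (\bigcup_k D k) x <-> boundary (D k) x].
Proof.
move=> cp; exists (~` \bigcup_(j in [set j | j != k]) closure (D j)); split.
- apply: closed_openC; apply: closed_bigcup => [|j _]; last exact: closed_closure.
  exact: finite_finset.
- by move=> [j /= jk cj]; rewrite -[False]/(set0 p) -(dD jk).
move=> x Wx; split=> [bx|bx]; last by apply/(boundary_bigcup_local (proj1 bx)).
have [] := bx; rewrite closureU => -[j _ cx] _.
have [jk|jk] := eqVneq j k; last by exfalso; apply: Wx; exists j.
by apply/boundary_bigcup_local; rewrite -?jk.
Qed.

Lemma boundary_disjoint j k x : boundary (D j) x -> boundary (D k) x -> j = k.
Proof.
move=> [cj _] [ck _]; have [//|jk] := eqVneq j k.
by exfalso; rewrite -[False]/(set0 x) -(dD jk).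
Qed.

End Disjoint.

End Resonators.

(** * Mass estimates on one graph patch *)

Section Patch.
Context {R : realType}.
Local Notation X := (R * R * R)%type.
Implicit Types (F : frame R) (g : R * R -> R) (V : set (R * R)) (x y z : X) (w : R * R).

Lemma dot3Dl x y z : dot3 (x + y) z = dot3 x z + dot3 y z.
Proof. by rewrite /dot3 /=; ring. Qed.

Lemma dot3Bl x y z : dot3 (x - y) z = dot3 x z - dot3 y z.
Proof. by rewrite /dot3 /=; ring. Qed.

Lemma dot3Zl (a : R) x z : dot3 (a *: x) z = a * dot3 x z.
Proof.
have -> : a *: x = (a * x.1.1, a * x.1.2, a * x.2) by [].
by rewrite /dot3 /=; ring.
Qed.

Lemma dot3C x y : dot3 x y = dot3 y x.
Proof. by rewrite /dot3; ring. Qed.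

Lemma norm_dot3_le x y : `|dot3 x y| <= enorm3 x * enorm3 y.
Proof.
rewrite ler_norml dot3_le andbT lerNl.
have -> : - dot3 x y = dot3 (- x) y by rewrite /dot3 /=; ring.
have -> : enorm3 x = enorm3 (- x) by rewrite /enorm3 /dot3 /= !mulrNN.
exact: dot3_le.
Qed.

(** A left inverse of every [graph_pt F g] that does not increase distances: points of a patch that
    are close together have close parameters, whatever g is. *)
Definition frame_proj F x : R * R :=
  (dot3 (x - origin F) (axis1 F), dot3 (x - origin F) (axis2 F)).

Lemma frame_proj_graph F g w : frame_proj F (graph_pt F g w) = w.
Proof.
have -> : w = (w.1, w.2) by case: w.
rewrite /frame_proj /graph_pt /=.
have e a b c : origin F + a + b + c - origin F = a + b + c.
  by rewrite -!addrA (addrC (origin F)) -!addrA addNr addr0.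
rewrite e !dot3Dl !dot3Zl (dot3C (axis2 F) (axis1 F)) (dot3C (axis3 F) (axis1 F)).
rewrite (dot3C (axis3 F) (axis2 F)) axis11 axis12 axis13 axis22 axis23.
by rewrite !mulr0 !mulr1 !addr0 add0r.
Qed.

Lemma frame_proj_le F x y : `|frame_proj F x - frame_proj F y| <= enorm3 (x - y).
Proof.
have e a : dot3 a a = 1 -> `|dot3 (x - origin F) a - dot3 (y - origin F) a| <= enorm3 (x - y).
  move=> a1; rewrite -dot3Bl opprB addrA subrK -[leRHS]mulr1 (le_trans (norm_dot3_le _ _)) //.
  by rewrite /enorm3 a1 sqrtr1.
by rewrite prod_normE ge_max /= !e ?axis11 ?axis22.
Qed.

Lemma graph_pt_continuous F g w : differentiable g w -> {for w, continuous (graph_pt F g)}.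
Proof.
move=> dg; rewrite /graph_pt; apply: cvgD; first apply: cvgD; first apply: cvgD.
- exact: cvg_cst.
- by apply: cvgZ; [exact: cvg_fst|exact: cvg_cst].
- by apply: cvgZ; [exact: cvg_snd|exact: cvg_cst].
- by apply: cvgZ; [exact: differentiable_continuous|exact: cvg_cst].
Qed.

(** Regularity provides patches of one boundary B, whereas the surface measure is described on
    patches of the union E; on an open O where B and E agree, one is the other. *)
Lemma graph_patch_restrict (E B U O : set X) F V g :
  graph_patch B U F V g -> (forall w, V w -> differentiable g w) ->
  open O -> O `<=` U -> (forall x, O x -> E x <-> B x) ->
  graph_patch E O F (V `&` graph_pt F g @^-1` O) g.
Proof.
move=> [oU oV BU] dg oO OU EB; split => //.
  rewrite openE => w [Vw Ow]; apply: filterI; first exact: open_nbhs_nbhs.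
  by apply: (graph_pt_continuous (dg w Vw)); exact: open_nbhs_nbhs.
apply/seteqP; split=> [x [Ex Ox]|x [w [Vw Ow] <-]].
  have [w Vw wx] : (graph_pt F g @` V) x by rewrite -BU; split; [exact/(EB x Ox)|exact: OU].
  by exists w => //; split => //; rewrite /preimage /= wx.
split => //; apply/(EB _ Ow).
by have [] : (B `&` U) (graph_pt F g w) by rewrite BU; exists w.
Qed.

Lemma holder_continuous s V (f : R * R -> R) w : 0 < s -> open V -> V w ->
  holder_on s V f -> {for w, continuous f}.
Proof.
move=> s0 oV Vw [K fK]; apply/cvgrPdist_le => e e0.
have K0 : 0 < `|K| + 1 by rewrite ltr_pwDr.
(* Chosen so that (|K| + 1) d^s = e; K itself may be zero or negative. *)
pose d := (e / (`|K| + 1)) `^ s^-1.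
have d0 : 0 < d by rewrite powR_gt0 // divr_gt0.
have nV : nbhs w V by exact: open_nbhs_nbhs.
suff : nbhs w [set w' | `|f w - f w'| <= e] by [].
apply: filterS (filterI nV (nbhsx_ballx w d d0)) => w' [Vw'].
rewrite -ball_normE /= => /ltW h.
apply: (le_trans (fK w w' Vw Vw')).
have hs : `|w - w'| `^ s <= e / (`|K| + 1).
  have -> : e / (`|K| + 1) = d `^ s.
    by rewrite -powRrM mulVf ?gt_eqF // powRr1 // ltW // divr_gt0.
  by rewrite ge0_ler_powR ?nnegrE ?(ltW s0) ?(ltW d0).
have hK : K <= `|K| + 1 by rewrite (le_trans (ler_norm K)) // lerDl.
apply: (le_trans (ler_wpM2r (powR_ge0 _ _) hK)).
by rewrite mulrC -ler_pdivlMr.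
Qed.

Lemma C1holder_C1 s V g : 0 < s -> open V -> C1holder_on s V g -> C1_on V g.
Proof.
move=> s0 oV [dg h1 h2] w Vw; split; first exact: dg.
- exact: holder_continuous h1.
- exact: holder_continuous h2.
Qed.

Lemma holder_bounded s V (f : R * R -> R) w0 : 0 < s -> V w0 -> holder_on s V f ->
  exists K, forall w, V w -> `|w - w0| <= 1 -> `|f w| <= K.
Proof.
move=> s0 Vw0 [K fK]; exists (`|f w0| + `|K|) => w Vw ww0.
have -> : f w = f w0 + (f w - f w0) by rewrite addrC subrK.
rewrite (le_trans (ler_normD _ _)) // lerD2l (le_trans (fK w w0 Vw Vw0)) //.
apply: (le_trans (ler_wpM2r (powR_ge0 _ _) (ler_norm K))).
rewrite -[leRHS]mulr1 ler_wpM2l //.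
have := ge0_ler_powR (ltW s0) _ _ ww0.
by rewrite powR1; apply; rewrite nnegrE.
Qed.

Let leb2 := (@lebesgue_measure R \x @lebesgue_measure R)%E.

Let density g w := Num.sqrt (1 + partial1 g w ^+ 2 + partial2 g w ^+ 2).

Lemma leb2_ball w r : 0 < r -> leb2 (ball w r) = ((2 * r) ^+ 2)%:E.
Proof.
move=> r0; have -> : ball w r = ball w.1 r `*` ball w.2 r by [].
rewrite /leb2 product_measure1E; [|exact: measurable_ball|exact: measurable_ball].
have e (a : R) : lebesgue_measure (ball a r : set R) = (r *+ 2)%:E.
  by apply: lebesgue_measure_ball; exact: ltW.
transitivity (lebesgue_measure (ball w.1 r : set R) * lebesgue_measure (ball w.2 r : set R))%E => //.
by rewrite !e -EFinM mulr_natl expr2.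
Qed.

Let density_ge1 g w : 1 <= density g w.
Proof.
by rewrite -{1}sqrtr1 ler_sqrt -?addrA ?lerDl ?ltr_pwDl ?addr_ge0 ?sqr_ge0.
Qed.

Let density_le g w a b : `|partial1 g w| <= a -> `|partial2 g w| <= b ->
  density g w <= 1 + a + b.
Proof.
move=> ha hb; have a0 := le_trans (normr_ge0 _) ha; have b0 := le_trans (normr_ge0 _) hb.
rewrite -[leRHS]ger0_norm; last by rewrite !addr_ge0.
rewrite -sqrtr_sqr ler_sqrt ?sqr_ge0 //.
rewrite -(real_normK (num_real (partial1 g w))) -(real_normK (num_real (partial2 g w))).
have := normr_ge0 (partial1 g w); have := normr_ge0 (partial2 g w); nra.
Qed.

Lemma ball_le x y e : 0 < e -> ball x e y -> enorm3 (x - y) <= 2 * e.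
Proof.
move=> e0 [[h1 h2] h3]; rewrite /enorm3 -[leRHS]ger0_norm; last by lra.
rewrite -sqrtr_sqr ler_sqrt ?sqr_ge0 // /dot3.
have h a b : `|a - b| < e -> (a - b) * (a - b) <= e ^+ 2.
  move=> ab; rewrite -expr2 -(real_normK (num_real (a - b))).
  by rewrite ler_pXn2r ?nnegrE // ltW.
have := h _ _ h1; have := h _ _ h2; have := h _ _ h3; rewrite /=; nra.
Qed.

(** The density sqrt (1 + |grad g|^2) is at least 1 and, by the Hoelder condition, at most 1 + K1 +
    K2 near p. The lower bound on a small parameter square gives positive mass. For growth, the
    parameters of a ball of radius r lie in an open square of half-side 2 r, of area 16 r^2. *)
Lemma patch_mass (E B U : set X) F V g s (sigma : {measure set X -> \bar R}) p :
  is_surface_measure E sigma -> 0 < s -> graph_patch B U F V g -> C1holder_on s V g ->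
  B p -> U p -> (exists W, [/\ open W, W p & forall x, W x -> E x <-> B x]) ->
  exists e K, [/\ 0 < e, ball p e `&` E = ball p e `&` B,
    (0 < sigma (ball p e `&` E))%E &
    forall x r, 0 < r -> (sigma (eball x r `&` (ball p e `&` E)) <= (K * r ^+ 2)%:E)%E].
Proof.
move=> sigmaP s0 BUV gV Bp Up [W [oW Wp EB]].
have [oU oV BU] := BUV; have [dg h1 h2] := gV.
(* Inside the sup ball of radius 1/2 the Euclidean distance to p is at most 1, so parameters stay
   within 1 of w0, where the derivative bounds hold. *)
have [e e0 eUW] : exists2 e, 0 < e & ball p e `<=` U `&` W `&` ball p 2^-1.
  suff /nbhs_ballP[e /= e0 h] : nbhs p (U `&` W `&` ball p 2^-1) by exists e.
  apply: filterI; first by apply: filterI; exact: open_nbhs_nbhs.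
  by apply: nbhsx_ballx.
pose O := ball p e.
have oO : open O by exact: ball_open.
have EBO x : O x -> E x <-> B x by move=> /eUW[[_ Wx] _]; exact: EB.
have OU : O `<=` U by move=> x /eUW[[]].
have rp := graph_patch_restrict BUV dg oO OU EBO.
set V' := V `&` _ in rp.
have gV' : C1_on V' g by move=> w [Vw _]; exact: (C1holder_C1 s0 oV gV).
have Ep : E p by apply/(EBO p) => //; exact: ballxx.
have [w0 [Vw0 Ow0] w0p] : (graph_pt F g @` V') p.
  by have [_ _ <-] := rp; split => //; exact: ballxx.
have [K1 hK1] := holder_bounded s0 Vw0 h1; have [K2 hK2] := holder_bounded s0 Vw0 h2.
have near0 w : V' w -> `|w - w0| <= 1.
  move=> [Vw Ow]; rewrite -(frame_proj_graph F g w) -(frame_proj_graph F g w0).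
  apply: (le_trans (frame_proj_le _ _ _)); rewrite w0p enorm3C.
  have [_ hb] := eUW _ Ow; have := ball_le _ hb; lra.
have J0 w : (0 <= (density g w)%:E)%E by rewrite lee_fin sqrtr_ge0.
have sE A : measurable A -> sigma (A `&` (O `&` E)) =
    (\int[leb2]_(w in V' `&` graph_pt F g @^-1` A) (density g w)%:E)%E.
  by move=> mA; rewrite (setIC O); exact: sigmaP rp gV' _ mA.
exists e, (4 * 4 * (1 + K1 + K2)); split => //.
- by apply/seteqP; split=> x [Ox] => [/EBO|/EBO] h; split => //; exact: h.
- have [d d0 dV'] : exists2 d, 0 < d & ball w0 d `<=` V'.
    have [_ oV' _] := rp; have := open_nbhs_nbhs (conj oV' (conj Vw0 Ow0)).
    by move=> /nbhs_ballP[d /= d0 h]; exists d.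
  rewrite -[X in sigma X]setTI sE // preimage_setT setIT.
  apply: (@lt_le_trans _ _ (\int[leb2]_(w in ball w0 d) (cst 1 w))%E).
    rewrite integral_cst; last by apply: measurableX; exact: measurable_ball.
    rewrite mul1e [ltRHS](_ : _ = ((2 * d) ^+ 2)%:E); last exact: leb2_ball.
    by rewrite lte_fin exprn_gt0 // mulr_gt0.
  apply: ge0_le_integral_patch => // w /dV' V'w; split => //.
  by rewrite lee_fin density_ge1.
- move=> x r r0; rewrite sE; last exact: measurable_eball.
  apply: (@le_trans _ _ (\int[leb2]_(w in ball (frame_proj F x) (2 * r)) (cst (1 + K1 + K2)%:E w))%E).
    apply: ge0_le_integral_patch => // [w _|w [V'w wx]].
      rewrite lee_fin; have := le_trans (normr_ge0 _) (hK1 w0 Vw0 _).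
      have := le_trans (normr_ge0 _) (hK2 w0 Vw0 _).
      by rewrite subrr normr0; lra.
    split.
      rewrite -ball_normE /= -(frame_proj_graph F g w).
      by apply: (le_lt_trans (frame_proj_le _ _ _)); apply: (le_lt_trans wx); lra.
    rewrite lee_fin; have [Vw _] := V'w.
    by apply: density_le; [apply: hK1|apply: hK2] => //; exact: near0.
  rewrite integral_cst; last by apply: measurableX; exact: measurable_ball.
  rewrite [X in (_ * X <= _)%E](_ : _ = ((2 * (2 * r)) ^+ 2)%:E); last first.
    by apply: leb2_ball; rewrite mulr_gt0.
  by rewrite -EFinM lee_fin le_eqVlt; apply/orP; left; apply/eqP; ring.
Qed.

End Patch.

(** * Global properties of the surface measure *)

Section Surface.
Context {R : realType}.
Local Notation X := (R * R * R)%type.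
Variables (s : R) (n : nat) (D : 'I_n.+1 -> set X) (sigma : {measure set X -> \bar R}).
Hypothesis s0 : 0 < s.
Hypothesis resD : resonators s D.
Let E := boundary (\bigcup_k D k).
Hypothesis sigmaP : is_surface_measure E sigma.

Let oD k : open (D k). Proof. by have [h _ _] := resD; have [] := h k. Qed.

Let dD j k : j != k -> closure (D j) `&` closure (D k) = set0.
Proof. by have [_ h _] := resD; exact: h. Qed.

Let EU : E = \bigcup_k boundary (D k). Proof. exact: boundary_bigcup. Qed.

Let D_box : exists r, forall k, D k `<=` box r.
Proof.
have h k : exists r, D k `<=` box r.
  by have [h _ _] := resD; have [_ + _] := h k; exact: bounded_sub_box.
have [f Df] := choice h; exists (\sum_k `|f k|) => k x /Df /boxP[h1 h2 h3].
have le : f k <= \sum_j `|f j|.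
  rewrite (bigD1 k) //= (le_trans (ler_norm _)) // lerDl sumr_ge0 //.
by apply/boxP; split; apply: le_trans le.
Qed.

Lemma boundary_compact k : compact (boundary (D k)).
Proof.
have [r Dr] := D_box; apply: subclosed_compact (@box_compact R r) _.
  exact: boundary_closed.
by move=> x [cx _]; exact: closure_sub_box cx.
Qed.

Lemma surface_box : exists r, E `<=` box r.
Proof.
have [r Dr] := D_box; exists r; rewrite EU => x [k _ [cx _]].
exact: closure_sub_box cx.
Qed.

Lemma surface_compact : compact E.
Proof.
have [r Er] := surface_box; apply: subclosed_compact (@box_compact R r) Er.
exact: boundary_closed.
Qed.

Lemma measurable_surface : measurable E.
Proof. exact: compact_measurable3 surface_compact. Qed.

Lemma measurable_boundary k : measurable (boundary (D k)).
Proof. exact: compact_measurable3 (@boundary_compact k). Qed.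

Let patch k p : boundary (D k) p ->
  exists e K, [/\ 0 < e, ball p e `&` E = ball p e `&` boundary (D k),
    (0 < sigma (ball p e `&` E))%E &
    forall x r, 0 < r -> (sigma (eball x r `&` (ball p e `&` E)) <= (K * r ^+ 2)%:E)%E].
Proof.
move=> bp; have [_ _ h] := resD; have [U [F [V [g [Up gp hg]]]]] := h k p bp.
apply: (patch_mass sigmaP s0 gp hg bp Up).
by apply: boundary_isolated => //; have [] := bp.
Qed.

Lemma boundary_mass_gt0 k : (0 < sigma (boundary (D k)))%E.
Proof.
have [r Dr] := D_box; have [D0 _ _] := resD; have [Dk _ _] := D0 k.
have [p bp] := boundary_nonempty (@oD k) Dk (Dr k).
have [e [K [_ eE s_gt0 _]]] := patch bp; apply: (lt_le_trans s_gt0).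
rewrite eE; apply: le_measure; rewrite ?inE.
- by apply: measurableI; [exact: measurable_ball3|exact: measurable_boundary].
- exact: measurable_boundary.
- exact: subIsetr.
Qed.

(** Finitely many patches cover the compact surface, and their growth constants add up. *)
Lemma surface_growth : exists C, 0 <= C /\
  forall x r, 0 < r -> (sigma (E `&` eball x r) <= (C * r ^+ 2)%:E)%E.
Proof.
have h p : E p -> exists eK : R * R, 0 < eK.1 /\ forall x r, 0 < r ->
    (sigma (eball x r `&` (ball p eK.1 `&` E)) <= (eK.2 * r ^+ 2)%:E)%E.
  move=> Ep; have [k _ bp] : (\bigcup_k boundary (D k)) p by rewrite -EU.
  by have [e [K [e0 _ _ hK]]] := patch bp; exists (e, K).
pose f p : R * R := if pselect (E p) is left Ep then projT1 (cid (h p Ep)) else (0, 0).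
have fP p : E p -> 0 < (f p).1 /\ forall x r, 0 < r ->
    (sigma (eball x r `&` (ball p (f p).1 `&` E)) <= ((f p).2 * r ^+ 2)%:E)%E.
  by move=> Ep; rewrite /f; case: pselect => // Ep'; case: cid.
have [|p Ep|P [finP PE EP]] := @compact_cover3 R E _ E (fun p => ball p (f p).1) surface_compact.
- by move=> p _; exact: ball_open.
- by exists p => //; apply: ballxx; have [] := fP p Ep.
exists (\sum_(p \in P) `|(f p).2|); split; first exact: fsumr_ge0.
move=> x r r0.
apply: (@le_trans _ _ (\sum_(p \in P) sigma (eball x r `&` (ball p (f p).1 `&` E)))%E).
  apply: content_sub_fsum => //.
  - move=> p _; apply: measurableI; first exact: measurable_eball.
    by apply: measurableI; [exact: measurable_ball3|exact: measurable_surface].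
  - by apply: measurableI; [exact: measurable_surface|exact: measurable_eball].
  - by move=> y [Ey xy]; have [p Pp py] := EP y Ey; exists p.
rewrite mulrC mulr_fsumr // -fsumEFin //; apply: lee_fsum => // p Pp.
have [_ /(_ x r r0)] := fP p (PE p Pp); move/le_trans; apply.
by rewrite lee_fin mulrC ler_wpM2l ?sqr_ge0 // ler_norm.
Qed.

Lemma surface_finite : (sigma E < +oo)%E.
Proof.
have [C [_ hC]] := surface_growth; have [r Er] := surface_box.
(* A ball of this radius contains the box, whose points have norm at most sqrt 3 |r|. *)
have r1 : 0 < 2 * `|r| + 1 by rewrite ltr_pwDr // mulr_ge0.
apply: le_lt_trans (ltry _); apply: le_trans (hC (0, 0, 0) _ r1).
rewrite (_ : E `&` _ = E) //; apply/setIidPl => x /Er /boxP[h1 h2 h3].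
rewrite /eball /= enorm3C /enorm3 -[leRHS]ger0_norm ?(ltW r1) //.
rewrite -sqrtr_sqr ler_sqrt ?sqr_ge0 // /dot3 /= !subr0.
have h (a : R) : `|a| <= r -> a * a <= `|r| ^+ 2.
  move=> ar; rewrite -expr2 -(real_normK (num_real a)).
  by rewrite ler_pXn2r ?nnegrE // (le_trans ar) // ler_norm.
have := h _ h1; have := h _ h2; have := h _ h3; have := normr_ge0 r; nra.
Qed.

(** Quadratic growth on balls shrinking to x; the radius is chosen with C r^2 <= e. *)
Lemma surface_atomless x : sigma (E `&` [set x]) = 0%E.
Proof.
have [C [C0 hC]] := surface_growth.
apply/eqP; rewrite eq_le measure_ge0 andbT; apply/lee_addgt0Pr => e e0.
rewrite add0e; pose r := Num.sqrt (e / (C + 1)).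
have eC : 0 < e / (C + 1) by rewrite divr_gt0 // ltr_pwDr.
have r0 : 0 < r by rewrite sqrtr_gt0.
apply: (@le_trans _ _ (sigma (E `&` eball x r))).
  apply: le_measure; rewrite ?inE.
  - by apply: measurableI; [exact: measurable_surface|exact: measurable_set1_3].
  - by apply: measurableI; [exact: measurable_surface|exact: measurable_eball].
  - apply: setIS => y ->; rewrite /eball /= /enorm3 /dot3 /= !subrr !mulr0 !addr0 sqrtr0.
    exact: ltW.
apply: (le_trans (hC x r r0)); rewrite lee_fin sqr_sqrtr ?(ltW eC) //.
rewrite mulrA ler_pdivrMr ?ltr_pwDr // mulrC ler_wpM2l ?(ltW e0) //.
by rewrite lerDl.
Qed.

End Surface.

(** * The capacitance matrix *)

Section SquareIntegrable.
Context {R : realType}.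
Local Notation X := (R * R * R)%type.
Variable mu : {finite_measure set X -> \bar R}.
Implicit Types phi psi : X -> R.

Lemma sqintZ (c : R) phi : sqint mu phi -> sqint mu (fun y => c * phi y).
Proof.
move=> [mphi phi2]; split; first exact: measurable_funM.
under eq_integral do rewrite exprMn EFinM.
rewrite ge0_integralZl_EFin ?sqr_ge0 //.
- by rewrite lte_mul_pinfty // lee_fin sqr_ge0.
- by move=> y _; rewrite lee_fin sqr_ge0.
- by apply/measurable_EFinP; exact: measurable_funX.
Qed.

Lemma sqintD phi psi : sqint mu phi -> sqint mu psi -> sqint mu (fun y => phi y + psi y).
Proof.
move=> [mphi phi2] [mpsi psi2]; split; first exact: measurable_funD.
have m2 (f : X -> R) : measurable_fun setT f -> measurable_fun setT (fun y => (f y ^+ 2)%:E).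
  by move=> mf; apply/measurable_EFinP; exact: measurable_funX.
apply: (@le_lt_trans _ _ (\int[mu]_y (2%:E * ((phi y ^+ 2)%:E + (psi y ^+ 2)%:E)))%E).
  apply: ge0_le_integral => //.
  - by move=> y _; rewrite lee_fin sqr_ge0.
  - by apply: m2; exact: measurable_funD.
  - by apply: emeasurable_funM => //; apply: emeasurable_funD; exact: m2.
  - move=> y _; rewrite -EFinD -EFinM lee_fin.
    have := sqr_ge0 (phi y - psi y); nra.
rewrite ge0_integralZl_EFin //; last 2 first.
- by move=> y _; rewrite -EFinD lee_fin addr_ge0 ?sqr_ge0.
- by apply: emeasurable_funD; exact: m2.
rewrite ge0_integralD //; [|by move=> y _; rewrite lee_fin sqr_ge0|exact: m2
  |by move=> y _; rewrite lee_fin sqr_ge0|exact: m2].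
by rewrite lte_mul_pinfty // lte_add_pinfty.
Qed.

Lemma sqint_sum (I : Type) (r : seq I) (F : I -> X -> R) :
  (forall i, sqint mu (F i)) -> sqint mu (fun y => \sum_(i <- r) F i y).
Proof.
move=> hF; elim: r => [|i r ih].
  under eq_fun do rewrite big_nil; split => //.
  by under eq_integral do rewrite expr0n /=; rewrite integral0.
by under eq_fun do rewrite big_cons; exact: sqintD.
Qed.

Lemma sqint_indic (A : set X) : measurable A -> sqint mu (\1_A).
Proof.
move=> mA; split; first exact: measurable_indic.
apply: (@le_lt_trans _ _ (\int[mu]_y cst 1%:E y)%E).
  apply: ge0_le_integral => //.
  - by apply/measurable_EFinP; apply: measurable_funX; exact: measurable_indic.
  - by move=> y _; rewrite lee_fin indicE; case: (_ \in _); rewrite ?expr1n ?expr0n.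
by rewrite integral_cst // mul1e ltey_eq fin_num_measure.
Qed.

Lemma sqint_integrable phi : sqint mu phi -> mu.-integrable setT (fun y => (phi y)%:E).
Proof.
move=> hphi; apply/integrableP; split; first by apply/measurable_EFinP; exact: hphi.1.
exact: sqint_norm1.
Qed.

Lemma pot_lin (a b : R) phi psi x : sqint mu phi -> sqint mu psi ->
  (apot mu phi x < +oo)%E -> (apot mu psi x < +oo)%E ->
  pot mu (fun y => a * phi y + b * psi y) x = a * pot mu phi x + b * pot mu psi x.
Proof.
move=> hphi hpsi /(pot_integrable hphi) i1 /(pot_integrable hpsi) i2.
rewrite /pot (eq_integral (fun y => a%:E * (newton x y * phi y)%:E +
    b%:E * (newton x y * psi y)%:E)%E); last first.
  by move=> y _; rewrite -!EFinM -EFinD; congr EFin; ring.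
rewrite integralD //; [|exact: integrableZl|exact: integrableZl].
rewrite !integralZl // fineD ?fin_numM ?integrable_fin_num //.
by rewrite !fineM ?integrable_fin_num.
Qed.

End SquareIntegrable.

(** * Signs of the energies of equilibrium densities *)

Section Capacitance.
Context {R : realType}.
Local Notation X := (R * R * R)%type.
Implicit Types phi psi : X -> R.
Variable mu : {finite_measure set X -> \bar R}.
Variables (M r0 : R).
Hypothesis newton_bound : forall x, (\int[mu]_y (newton x y)%:E <= M%:E)%E.
Hypothesis mu_atomless : forall x, mu [set x] = 0%E.
Hypothesis mu_support : mu (~` box r0) = 0%E.

Definition energy phi psi : R := fine (\int[mu]_y (phi y * pot mu psi y)%:E)%E.

Lemma energyE phi psi : sqint mu phi -> sqint mu psi ->
  (\int[mu]_y (phi y * pot mu psi y)%:E)%E = (energy phi psi)%:E.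
Proof.
move=> hphi hpsi; rewrite fineK //; apply: integrable_fin_num => //.
exact: (integrable_energy newton_bound).
Qed.

Lemma energy_sym phi psi : sqint mu phi -> sqint mu psi -> energy phi psi = energy psi phi.
Proof. by move=> hphi hpsi; rewrite /energy (energyC newton_bound). Qed.

Lemma energy_lin (a b : R) phi psi xi : sqint mu phi -> sqint mu psi -> sqint mu xi ->
  energy (fun y => a * phi y + b * psi y) xi = a * energy phi xi + b * energy psi xi.
Proof.
move=> hphi hpsi hxi; have i1 := integrable_energy newton_bound hphi hxi.
have i2 := integrable_energy newton_bound hpsi hxi.
rewrite /energy (eq_integral (fun y => a%:E * (phi y * pot mu xi y)%:E +
    b%:E * (psi y * pot mu xi y)%:E)%E); last first.
  by move=> y _; rewrite -!EFinM -EFinD; congr EFin; ring.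
rewrite integralD //; [|exact: integrableZl|exact: integrableZl].
rewrite !integralZl // fineD ?fin_numM ?integrable_fin_num //.
by rewrite !fineM ?integrable_fin_num.
Qed.

Lemma energy_sum (I : Type) (r : seq I) (c : I -> R) (F : I -> X -> R) xi :
  (forall i, sqint mu (F i)) -> sqint mu xi ->
  energy (fun y => \sum_(i <- r) c i * F i y) xi = \sum_(i <- r) c i * energy (F i) xi.
Proof.
move=> hF hxi; elim: r => [|i r ih].
  rewrite big_nil /energy; under eq_integral do rewrite big_nil mul0r.
  by rewrite integral0.
rewrite big_cons -ih -[X in _ + X]mul1r -energy_lin //.
  by congr energy; apply/funext => y; rewrite big_cons mul1r.
by apply: sqint_sum => j; exact: sqintZ.
Qed.

Lemma energy_ge0 phi : sqint mu phi -> 0 <= energy phi phi.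
Proof.
move=> hphi; rewrite -lee_fin -energyE //.
have hN := sqintZ (-1) hphi.
have mpot psi : sqint mu psi -> measurable_fun setT (fun y => (psi y * Num.min (pot mu psi y) 0)%:E).
  move=> hpsi; apply/measurable_EFinP; apply: measurable_funM; first exact: hpsi.1.
  by apply: measurable_minr => //; exact: (measurable_pot _ hpsi.1).
have ipot psi : sqint mu psi -> mu.-integrable setT (fun y => (psi y * Num.min (pot mu psi y) 0)%:E).
  move=> hpsi; have i := integrable_energy newton_bound hpsi hpsi.
  apply: (le_integrable measurableT (mpot _ hpsi) _ i) => y _.
  rewrite !abse_EFin lee_fin !normrM ler_wpM2l // /Order.min.
  by case: ifPn => // _; rewrite normr0.
have h1 := min_energy_ge0 newton_bound mu_atomless mu_support hphi.
have h2 := min_energy_ge0 newton_bound mu_atomless mu_support hN.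
have := adde_ge0 h1 h2; rewrite -integralD //; [|exact: ipot|exact: ipot].
(* The two clipped energies add up because a = min(a, 0) - min(-a, 0). *)
rewrite (ae_eq_integral (fun y => (phi y * pot mu phi y)%:E)) //.
- by apply: emeasurable_funD; exact: mpot.
- by have /integrableP[] := integrable_energy newton_bound hphi hphi.
apply: filterS (apot_ae newton_bound hphi) => y ay _.
have -> : pot mu (fun y => -1 * phi y) y = - pot mu phi y.
  have := pot_lin (-1) 0 hphi hphi ay ay; rewrite mul0r addr0 mulN1r => <-.
  by congr (pot mu _ y); apply/funext => z; rewrite mul0r addr0.
rewrite -EFinD; congr EFin; rewrite mulN1r mulNr -mulrBr; congr (_ * _).
rewrite /Order.min oppr_lt0; case: ltgtP => //; lra.
Qed.

Lemma energy_quad phi psi (t : R) : sqint mu phi -> sqint mu psi ->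
  0 <= energy phi phi + 2 * t * energy phi psi + t ^+ 2 * energy psi psi.
Proof.
move=> hphi hpsi; have h : sqint mu (fun y => 1 * phi y + t * psi y).
  by apply: sqintD; exact: sqintZ.
have := energy_ge0 h; rewrite (energy_lin 1 t hphi hpsi h) (energy_sym hphi h).
rewrite (energy_sym hpsi h) (energy_lin 1 t hphi hpsi hphi).
rewrite (energy_lin 1 t hphi hpsi hpsi) (energy_sym hpsi hphi).
by move: (energy phi phi) (energy phi psi) (energy psi psi) => a b c; lra.
Qed.

(** A nonnegative form cannot have a null vector with a nonzero pairing. Evaluate it at phi + t psi
    with t = -b / (|q| + 1): then t^2 q <= -t b, and [energy phi phi] >= -t b > 0. *)
Lemma energy_gt0 phi psi : sqint mu phi -> sqint mu psi -> energy phi psi < 0 ->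
  0 < energy phi phi.
Proof.
move=> hphi hpsi b0; set b := energy phi psi in b0 *.
set q := energy psi psi; pose t := - b / (`|q| + 1).
have q1 : 0 < `|q| + 1 by rewrite ltr_pwDr.
have t0 : 0 < t by rewrite divr_gt0 // oppr_gt0.
have tq : t * q <= - b.
  apply: (@le_trans _ _ (t * (`|q| + 1))); last by rewrite divfK // gt_eqF.
  by rewrite ler_wpM2l ?(ltW t0) // (le_trans (ler_norm q)) // lerDl.
have := energy_quad t hphi hpsi; rewrite -/b -/q; nra.
Qed.

Section Equilibrium.
Variables (n : nat) (A : 'I_n -> set X) (phi : 'I_n -> X -> R).
Hypothesis mA : forall k, measurable (A k).
Hypothesis dA : forall j k x, A j x -> A k x -> j = k.
Hypothesis A_gt0 : forall k, (0 < mu (A k))%E.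
Hypothesis phi2 : forall k, sqint mu (phi k).
Hypothesis phiP : forall k, {ae mu, forall y, pot mu (phi k) y = - \1_(A k) y}.

Lemma energy_equilibrium psi k : sqint mu psi ->
  energy psi (phi k) = - fine (\int[mu]_(y in A k) (psi y)%:E)%E.
Proof.
move=> hpsi; have m1 : measurable_fun setT (fun y => (psi y * \1_(A k) y)%:E).
  apply/measurable_EFinP; apply: measurable_funM; first exact: hpsi.1.
  exact: measurable_indic.
have i : mu.-integrable setT (fun y => (psi y * \1_(A k) y)%:E).
  apply: (le_integrable measurableT m1 _ (sqint_integrable hpsi)) => y _.
  rewrite !abse_EFin lee_fin normrM indicE.
  by case: (_ \in _); rewrite ?normr1 ?mulr1 // normr0 mulr0.
have -> : (\int[mu]_(y in A k) (psi y)%:E = \int[mu]_y (psi y * \1_(A k) y)%:E)%E.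
  rewrite integral_mkcond; apply: eq_integral => y _.
  by rewrite patchE indicE; case: (_ \in _); rewrite ?mulr1 ?mulr0.
rewrite /energy (ae_eq_integral (fun y => (-1)%:E * (psi y * \1_(A k) y)%:E)%E) //.
- by rewrite integralZl // fineM ?integrable_fin_num // mulN1r.
- by have /integrableP[] := integrable_energy newton_bound hpsi (phi2 k).
- by apply: emeasurable_funM.
- by apply: filterS (phiP k) => y -> _; rewrite -EFinM mulN1r mulrN.
Qed.

(** For e > 0 the density e phi_i - phi_j has potential -e 1_i + 1_j, and since the sets are
    disjoint its negative part min(., 0) is -e 1_i = e U phi_i. The clipped inequality thus reads e
    (e E_ii - E_ij) >= 0; divide by e and let e -> 0. *)
Lemma energy_offdiag i j : i != j -> energy (phi i) (phi j) <= 0.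
Proof.
move=> ij; have key (e : R) : 0 < e ->
    energy (phi i) (phi j) <= e * energy (phi i) (phi i).
  move=> e0; have hh : sqint mu (fun y => e * phi i y + -1 * phi j y).
    by apply: sqintD; exact: sqintZ.
  have := min_energy_ge0 newton_bound mu_atomless mu_support hh.
  have ie := integrable_energy newton_bound hh (phi2 i).
  rewrite (ae_eq_integral (fun y => e%:E *
      ((e * phi i y + -1 * phi j y) * pot mu (phi i) y)%:E)%E) //.
  - rewrite integralZl // energyE // -EFinM lee_fin pmulr_rge0 //.
    by rewrite energy_lin // (energy_sym (phi2 j) (phi2 i)) mulN1r subr_ge0.
  - apply/measurable_EFinP; apply: measurable_funM; first exact: hh.1.
    by apply: measurable_minr => //; exact: (measurable_pot _ hh.1).
  - by apply: emeasurable_funM => //; have /integrableP[] := ie.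
  suff h : forall y, (apot mu (phi i) y < +oo)%E -> (apot mu (phi j) y < +oo)%E ->
      pot mu (phi i) y = - \1_(A i) y -> pot mu (phi j) y = - \1_(A j) y ->
      ((e * phi i y + -1 * phi j y) *
        Num.min (pot mu (fun y => e * phi i y + -1 * phi j y) y) 0)%:E =
      (e%:E * ((e * phi i y + -1 * phi j y) * pot mu (phi i) y)%:E)%E.
    have aeI (P Q : X -> Prop) : {ae mu, forall y, P y} -> {ae mu, forall y, Q y} ->
      {ae mu, forall y, P y /\ Q y} by move=> hP hQ; exact: filterI.
    have ae1 := aeI _ _ (phiP i) (phiP j).
    have ae2 := aeI _ _ (apot_ae newton_bound (phi2 i)) (apot_ae newton_bound (phi2 j)).
    by apply: filterS (aeI _ _ ae1 ae2) => y [[pi pj] [ai aj]] _; exact: h.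
  move=> y ai aj pi pj.
  rewrite (pot_lin e (-1) (phi2 i) (phi2 j) ai aj) pi pj -EFinM; congr EFin.
  rewrite mulrCA; congr (_ * _); rewrite !indicE.
  have [yi|_] := boolP (y \in A i); have [yj|_] := boolP (y \in A j) => /=.
  - by case/eqP: ij; apply: (@dA i j y); exact: set_mem.
  - by rewrite oppr0 mulr0 addr0 mulrN1 min_l // oppr_le0 ltW.
  - by rewrite oppr0 mulr0 add0r mulrNN mulr1 min_r.
  - by rewrite oppr0 !mulr0 addr0 min_r.
apply/ler_addgt0Pr => d d0; rewrite add0r.
have e0 : 0 <= energy (phi i) (phi i) by exact: energy_ge0.
have e1 : 0 < energy (phi i) (phi i) + 1 by rewrite ltr_pwDr.
apply: (le_trans (key (d / (energy (phi i) (phi i) + 1)) _)); first exact: divr_gt0.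
by rewrite mulrAC ler_pdivrMr // ler_wpM2l ?(ltW d0) // lerDl.
Qed.

(** The quadratic form is the energy of a = sum c_i phi_i. Its pairing with f = sum c_i 1_i is -sum
    c_i^2 mu(A_i) < 0, which makes that energy positive. *)
Lemma energy_posdef (c : 'I_n -> R) k : c k != 0 ->
  0 < \sum_i \sum_j c i * energy (phi i) (phi j) * c j.
Proof.
move=> ck; pose a y := \sum_i c i * phi i y; pose f y := \sum_i c i * \1_(A i) y.
have ha : sqint mu a by apply: sqint_sum => i; exact: sqintZ.
have h1 i : sqint mu (\1_(A i)) by exact: sqint_indic.
have hf : sqint mu f by apply: sqint_sum => i; exact: sqintZ.
have -> : \sum_i \sum_j c i * energy (phi i) (phi j) * c j = energy a a.
  rewrite energy_sum //; apply: eq_bigr => i _; rewrite energy_sym // energy_sum //.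
  rewrite mulr_sumr; apply: eq_bigr => j _.
  by rewrite (energy_sym (phi2 j) (phi2 i)); ring.
apply: (energy_gt0 ha hf); rewrite energy_sum //.
have mu_fin i : mu (A i) \is a fin_num by exact: fin_num_measure.
rewrite (eq_bigr (fun i => - (c i ^+ 2 * fine (mu (A i))))); last first.
  move=> i _; rewrite energy_sym // energy_sum // (bigD1 i) //= big1 ?addr0.
    rewrite energy_equilibrium // integral_indic // setIid; ring.
  move=> j ji; rewrite energy_equilibrium // integral_indic // (_ : _ `&` _ = set0).
    by rewrite measure0 oppr0 mulr0.
  by apply/seteqP; split=> // y [yj yi]; case/eqP: ji; exact: dA yj yi.
have p i : 0 <= c i ^+ 2 * fine (mu (A i)) by rewrite mulr_ge0 ?sqr_ge0 ?fine_ge0.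
rewrite sumrN oppr_lt0 (bigD1 k) //= ltr_pwDl ?sumr_ge0 //.
by rewrite mulr_gt0 ?exprn_even_gt0 // fine_gt0 // A_gt0 ltey_eq mu_fin.
Qed.

End Equilibrium.

End Capacitance.

(** * The capacitance matrix as a matrix of energies *)

Section CapacitanceMatrix.
Context {R : realType}.
Local Notation X := (R * R * R)%type.
Variables (s : R) (n : nat) (D : 'I_n.+1 -> set X).
Variables (sigma : {measure set X -> \bar R}) (psi : 'I_n.+1 -> X -> R).
Hypothesis s0 : 0 < s.
Hypothesis resD : resonators s D.
Let E := boundary (\bigcup_k D k).
Hypothesis sigmaP : is_surface_measure E sigma.
Hypothesis psiP : forall j, is_single_layer_preimage sigma E (\1_(boundary (D j))) (psi j).

Let mE : measurable E := measurable_surface resD.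

(** [sigma] is prescribed on the surface only; its restriction is finite, carried by a box and
    without atoms. *)
Let mu : {finite_measure set X -> \bar R} := mfrestr mE (surface_finite s0 resD sigmaP).

Let muE A : mu A = sigma (A `&` E). Proof. by []. Qed.

Let newton_bound : exists M : R, forall x, (\int[mu]_y (newton x y)%:E <= M%:E)%E.
Proof.
have [C [C0 hC]] := surface_growth s0 resD sigmaP.
exists (fine (sigma E) + 4 * C) => x; apply: integral_newton_le => //.
  rewrite -[X in (X <= _)%E]/(sigma (setT `&` E)) setTI fineK // ge0_fin_numE //.
  exact: (surface_finite s0 resD sigmaP).
move=> r /andP[r0 _]; rewrite setTI -[X in (X <= _)%E]/(sigma (eball x r `&` E)) setIC.
exact: hC.
Qed.

Let mu_atomless x : mu [set x] = 0%E.
Proof. by rewrite muE setIC; exact: (surface_atomless s0 resD sigmaP). Qed.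

Let mu_support : exists r0, mu (~` box r0) = 0%E.
Proof.
have [r Er] := surface_box resD; exists r; rewrite muE (_ : _ `&` _ = set0) ?measure0 //.
by apply/seteqP; split => // x [nx /Er].
Qed.

Let bE k : boundary (D k) `<=` E.
Proof.
have [oD dD _] := resD; rewrite /E boundary_bigcup //; last by move=> j; have [] := oD j.
by move=> x bx; exists k.
Qed.

Let integral_sigma A (f : X -> \bar R) : A `<=` E ->
  (\int[sigma]_(y in A) f y = \int[mu]_(y in A) f y)%E.
Proof.
move=> AE; apply: eq_measure_integral => B mB BA.
by rewrite -[RHS]/(sigma (B `&` E)) ((setIidPl _ _).2 (subset_trans BA AE)).
Qed.

Let psiE j y := (psi j \_ E) y.

(** Extension by 0 makes the density measurable on all of R^3, and the factor turns the single layer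
    potential into minus [pot]. *)
Let phi j y := (4 * pi)^-1 * psiE j y.

Let psiE_sqint j : sqint mu (psiE j).
Proof.
have [[mpsi psi2] _] := psiP j; split; first exact/(measurable_restrictT _ mE).
move: psi2; rewrite integral_sigma // integral_mkcond.
congr (_ < _)%E; apply: eq_integral => y _; rewrite /psiE !patchE.
by case: ifP => // _; rewrite expr0n.
Qed.

Let phi_sqint j : sqint mu (phi j).
Proof. by apply: sqintZ; exact: psiE_sqint. Qed.

Let pot_phi j x : pot mu (phi j) x = - single_layer sigma E (psi j) x.
Proof.
rewrite /single_layer opprK /Rintegral integral_sigma // integral_mkcond /pot; congr fine.
apply: eq_integral => y _; rewrite patchE /phi /psiE /newton patchE.
by case: ifP => _; [congr EFin; rewrite [in RHS]invfM; ring|rewrite !mulr0].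
Qed.

Let phiP j : {ae mu, forall y, pot mu (phi j) y = - \1_(boundary (D j)) y}.
Proof.
have [_ [N [mN N0 subN]]] := psiP j.
exists (N `|` ~` E); split.
- by apply: measurableU => //; exact: measurableC.
- rewrite muE setIUl setICl setU0; apply/eqP; rewrite eq_le measure_ge0 andbT -N0.
  apply: le_measure; [apply: mem_set; exact: measurableI|exact: mem_set|].
  exact: subIsetl.
move=> y /= h; have [Ey|] := pselect (E y); last by right.
left; apply: subN => /= h'; apply: h; rewrite pot_phi; congr (- _); exact: h'.
Qed.

Let mA k : measurable (boundary (D k)) := measurable_boundary resD k.

Let dA j k x : boundary (D j) x -> boundary (D k) x -> j = k.
Proof. by have [_ dD _] := resD; exact: boundary_disjoint. Qed.

Let A_gt0 k : (0 < mu (boundary (D k)))%E.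
Proof.
by rewrite muE ((setIidPl _ _).2 (@bE k)); exact: (boundary_mass_gt0 s0 resD sigmaP).
Qed.

Let pi4 : 0 < 4 * pi :> R.
Proof. by rewrite mulr_gt0 ?pi_gt0. Qed.

Lemma capacitanceE i j : capacitance_mx sigma D psi i j = 4 * pi * energy mu (phi i) (phi j).
Proof.
have [M hM] := newton_bound.
(* By symmetry phi_j becomes the free density, to be integrated against U phi_i = -chi_i; the added
   zero term lets [energy_lin] absorb the factor 4 pi, which turns phi_j back into psi_j. *)
rewrite (energy_sym hM) // -[RHS]addr0 -[X in _ + X](mul0r (energy mu (phi j) (phi i))).
rewrite -(energy_lin hM) // (energy_equilibrium hM mA phi_sqint phiP); last first.
  by apply: sqintD; exact: sqintZ.
rewrite mxE /Rintegral integral_sigma //; congr (- fine _).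
apply: eq_integral => y /set_mem by_; congr EFin.
rewrite mul0r addr0 /phi mulrA divff ?mul1r ?gt_eqF // /psiE patchE mem_set //.
exact: bE by_.
Qed.

Lemma capacitance_offdiag_le0 : offdiag_le0 (capacitance_mx sigma D psi).
Proof.
move=> i j ij; rewrite capacitanceE pmulr_rle0 //.
have [M hM] := newton_bound; have [r hr] := mu_support.
exact: (energy_offdiag hM mu_atomless hr dA phi_sqint phiP).
Qed.

Lemma capacitance_pos_def : pos_def (capacitance_mx sigma D psi).
Proof.
move=> x x0; have [k xk] : exists k, x k 0 != 0.
  apply/existsP; apply: contraNT x0; rewrite negb_exists => /forallP h.
  apply/eqP/matrixP => i j; rewrite ord1 mxE.
  by apply/eqP; rewrite -[_ == _]negbK h.
have [M hM] := newton_bound; have [r hr] := mu_support.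
have := energy_posdef hM mu_atomless hr mA dA A_gt0 phi_sqint phiP (c := fun i => x i 0) xk.
rewrite -(pmulr_rgt0 _ pi4) mulr_sumr /quad_form; congr (_ < _).
apply: eq_bigr => i _; rewrite mulr_sumr; apply: eq_bigr => j _.
by rewrite capacitanceE; ring.
Qed.

End CapacitanceMatrix.

Unset Implicit Arguments.
Set Strict Implicit.

Theorem theorem3p5 (R : realType) (s : R) (n : nat)
    (D : 'I_n.+1 -> set (R * R * R))
    (sigma : {measure set (R * R * R) -> \bar R})
    (psi : 'I_n.+1 -> R * R * R -> R)
    (s01 : 0 < s < 1)
    (resD : resonators s D)
    (sigmaP : is_surface_measure (boundary (\bigcup_k D k)) sigma)
    (psiP : forall j, is_single_layer_preimage sigma (boundary (\bigcup_k D k))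
                        (\1_(boundary (D j))) (psi j)) :
  let C := capacitance_mx sigma D psi in
  let mu := 2 * \big[Num.max/C ord0 ord0]_(i < n.+1) C i i in
  [/\ 0 < mu,
      exists! u : 'cV[R]_n.+1, comparison_mx (mu%:M - C) *m u = const_mx 1 &
      forall u : 'cV[R]_n.+1, comparison_mx (mu%:M - C) *m u = const_mx 1 ->
      forall (lambda : R) (v : 'cV[R]_n.+1),
        0 < lambda -> v != 0 -> C *m v = lambda *: v ->
      forall i, `|v i 0| / supnorm v <= (mu - lambda) * u i 0].
Proof.
have /andP[s0 _] := s01; apply: landscape_bound.
  exact: (capacitance_pos_def s0 resD sigmaP psiP).
exact: (capacitance_offdiag_le0 s0 resD sigmaP psiP).
Qed.
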